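(* Let $s=a+ib$ with $a>0$, $b\in\mathbb{R}$, let $k\in[0,1)$, and let $f\in\mathcal{A}$. Assume that there is a constant $c\in\mathbb{C}$ such that, for all $z\in\mathbb{D}$, the expression below is defined and finite (with $zf'(z)/f(z)$ interpreted as $1$ at $z=0$) and $$\left| c|z|^{2}+s-a(1-|z|^{2})\left\{s\left(1+ \frac{zf''(z)}{f'(z)}\right)+(1-s)\frac{zf'(z)}{f(z)}\right\}\right|\leq M,$$ where $$M=\begin{cases} ak|s|+(a-1)|s+c|, & 0<a\le 1,\\ k|s|, & a>1.\end{cases}$$ Then $f$ has an $l$-quasiconformal extension to $\mathbb{C}$, where $$l=\frac{2ka+(1-k^{2})|b|}{(1+k^{2})a+(1-k^{2})|s|}<1.$$
   Context: $\mathbb{D}=\{z\in\mathbb{C}:|z|<1\}$. $\mathcal{A}$ denotes the family of analytic functions $f$ on $\mathbb{D}$ of the form $f(z)=z+\sum_{n\ge2}a_nz^n$. A sense-preserving homeomorphism $F$ of a plane domain $G$ is $k$-quasiconformal ($0\le k<1$) if $F$ is absolutely continuous on almost all lines parallel to the coordinate axes and $|F_{\bar z}|\le k|F_z|$ almost everywhere in $G$. ''$f$ has an $l$-quasiconformal extension to $\mathbb{C}$'' means there is an $l$-quasiconformal homeomorphism of $\mathbb{C}$ onto itself whose restriction to $\mathbb{D}$ is $f$. *)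

(* Defs.v *)
From Stdlib Require Import Reals Lra List.
Import ListNotations.
Open Scope R_scope.

Definition Cplx : Type := (R * R)%type.
Definition Cre (z : Cplx) : R := fst z.
Definition Cim (z : Cplx) : R := snd z.
Definition C0 : Cplx := (0, 0).
Definition C1 : Cplx := (1, 0).
Definition Ci : Cplx := (0, 1).
Definition RtoC (r : R) : Cplx := (r, 0).
Definition Cadd (z w : Cplx) : Cplx := (fst z + fst w, snd z + snd w).
Definition Copp (z : Cplx) : Cplx := (- fst z, - snd z).
Definition Csub (z w : Cplx) : Cplx := Cadd z (Copp w).
Definition Cmul (z w : Cplx) : Cplx :=
  (fst z * fst w - snd z * snd w, fst z * snd w + snd z * fst w).
Definition Cinv (z : Cplx) : Cplx :=
  (fst z / (fst z ^ 2 + snd z ^ 2), - snd z / (fst z ^ 2 + snd z ^ 2)).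
Definition Cdiv (z w : Cplx) : Cplx := Cmul z (Cinv w).
Definition Cnorm (z : Cplx) : R := sqrt (fst z ^ 2 + snd z ^ 2).

Definition Ceq_dec (z w : Cplx) : {z = w} + {z <> w}.
Proof.
  destruct z as [x y], w as [u v].
  destruct (Req_EM_T x u) as [H1|H1]; [destruct (Req_EM_T y v) as [H2|H2]|].
  - left; subst; reflexivity.
  - right; intro H; inversion H; contradiction.
  - right; intro H; inversion H; contradiction.
Defined.

Definition inD (z : Cplx) : Prop := Cnorm z < 1.

Definition has_cderiv (f : Cplx -> Cplx) (z L : Cplx) : Prop :=
  forall eps, 0 < eps -> exists del, 0 < del /\
    forall h, h <> C0 -> Cnorm h < del ->
      Cnorm (Csub (Cdiv (Csub (f (Cadd z h)) (f z)) h) L) < eps.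

Definition classA (f : Cplx -> Cplx) : Prop :=
  (forall z, inD z -> exists L, has_cderiv f z L) /\
  f C0 = C0 /\ has_cderiv f C0 C1.

Definition Ccont_at (F : Cplx -> Cplx) (z : Cplx) : Prop :=
  forall eps, 0 < eps -> exists del, 0 < del /\
    forall w, Cnorm (Csub w z) < del -> Cnorm (Csub (F w) (F z)) < eps.

Definition homeomorphism_C (F : Cplx -> Cplx) : Prop :=
  (forall z, Ccont_at F z) /\
  exists G : Cplx -> Cplx, (forall z, G (F z) = z) /\ (forall w, F (G w) = w) /\
                     (forall w, Ccont_at G w).

(** Sense-preserving: the image of every positively oriented circle about z0
    winds once positively about F z0 (measured by a continuous argument). *)
Definition sense_preserving (F : Cplx -> Cplx) : Prop :=
  forall (z0 : Cplx) (r : R), 0 < r ->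
    exists theta : R -> R, (forall t, continuity_pt theta t) /\
      (forall t, 0 <= t <= 1 ->
         let w := Csub (F (Cadd z0 (r * cos (2 * PI * t), r * sin (2 * PI * t)))) (F z0) in
         w = (Cnorm w * cos (theta t), Cnorm w * sin (theta t))) /\
      theta 1 - theta 0 = 2 * PI.

Definition null1 (S : R -> Prop) : Prop :=
  forall eps, 0 < eps -> exists u v : nat -> R,
    (forall n, u n <= v n) /\
    (forall x, S x -> exists n, u n <= x <= v n) /\
    (forall N, sum_f_R0 (fun n => v n - u n) N <= eps).

Definition null2 (S : Cplx -> Prop) : Prop :=
  forall eps, 0 < eps -> exists x1 x2 y1 y2 : nat -> R,
    (forall n, x1 n <= x2 n /\ y1 n <= y2 n) /\
    (forall z, S z -> exists n, x1 n <= fst z <= x2 n /\ y1 n <= snd z <= y2 n) /\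
    (forall N, sum_f_R0 (fun n => (x2 n - x1 n) * (y2 n - y1 n)) N <= eps).

Fixpoint intervals_in (lo hi : R) (l : list (R * R)) : Prop :=
  match l with
  | nil => lo <= hi
  | (u, v) :: t => lo <= u /\ u <= v /\ intervals_in v hi t
  end.

Definition abs_cont_on (g : R -> Cplx) (a b : R) : Prop :=
  forall eps, 0 < eps -> exists del, 0 < del /\
    forall l : list (R * R), intervals_in a b l ->
      fold_right Rplus 0 (map (fun p => snd p - fst p) l) < del ->
      fold_right Rplus 0 (map (fun p => Cnorm (Csub (g (snd p)) (g (fst p)))) l) < eps.

Definition ACL_C (F : Cplx -> Cplx) : Prop :=
  null1 (fun y => ~ (forall a b, a <= b -> abs_cont_on (fun x => F (x, y)) a b)) /\
  null1 (fun x => ~ (forall a b, a <= b -> abs_cont_on (fun y => F (x, y)) a b)).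

Definition has_pdx (F : Cplx -> Cplx) (z L : Cplx) : Prop :=
  forall eps, 0 < eps -> exists del, 0 < del /\
    forall h : R, h <> 0 -> Rabs h < del ->
      Cnorm (Csub (Cmul (RtoC (/ h)) (Csub (F (fst z + h, snd z)) (F z))) L) < eps.
Definition has_pdy (F : Cplx -> Cplx) (z L : Cplx) : Prop :=
  forall eps, 0 < eps -> exists del, 0 < del /\
    forall h : R, h <> 0 -> Rabs h < del ->
      Cnorm (Csub (Cmul (RtoC (/ h)) (Csub (F (fst z, snd z + h)) (F z))) L) < eps.

Definition Fz (Fx Fy : Cplx) : Cplx := Cmul (RtoC (/ 2)) (Csub Fx (Cmul Ci Fy)).
Definition Fzbar (Fx Fy : Cplx) : Cplx := Cmul (RtoC (/ 2)) (Cadd Fx (Cmul Ci Fy)).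

Definition quasiconformal_C (k : R) (F : Cplx -> Cplx) : Prop :=
  0 <= k < 1 /\
  homeomorphism_C F /\ sense_preserving F /\ ACL_C F /\
  null2 (fun z => ~ (exists Fx Fy, has_pdx F z Fx /\ has_pdy F z Fy /\
                        Cnorm (Fzbar Fx Fy) <= k * Cnorm (Fz Fx Fy))).

Definition has_qc_extension (l : R) (f : Cplx -> Cplx) : Prop :=
  exists F : Cplx -> Cplx, quasiconformal_C l F /\ (forall z, inD z -> F z = f z).

Definition zf'_over_f (f f1 : Cplx -> Cplx) (z : Cplx) : Cplx :=
  if Ceq_dec z C0 then C1 else Cdiv (Cmul z (f1 z)) (f z).

Definition the_expr (a : R) (s c : Cplx) (f f1 f2 : Cplx -> Cplx) (z : Cplx) : Cplx :=
  Csub (Cadd (Cmul c (RtoC (Cnorm z ^ 2))) s)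
       (Cmul (RtoC (a * (1 - Cnorm z ^ 2)))
          (Cadd (Cmul s (Cadd C1 (Cdiv (Cmul z (f2 z)) (f1 z))))
                (Cmul (Csub C1 s) (zf'_over_f f f1 z)))).

Definition bound_M (a k : R) (s c : Cplx) : R :=
  if Rle_dec a 1 then a * k * Cnorm s + (a - 1) * Cnorm (Cadd s c)
  else k * Cnorm s.

Definition dil_l (a b k : R) (s : Cplx) : R :=
  (2 * k * a + (1 - k ^ 2) * Rabs b) / ((1 + k ^ 2) * a + (1 - k ^ 2) * Cnorm s).

(* Main.v *)
(** Write [s = a + i b], [p = z f' / f], [E = s (1 + z f'' / f') + (1 - s) p], [G(T, w) = a T E(w) - c],
    [q(T, w) = 1 - (a T / c) p(w)] and [Psi_T(w) = f(w) q(T, w)^s].  The boundary behaviour of [E]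
    forces [|s + c| <= M], and a convex combination of this bound with the hypothesis gives
    [|G - s (1 + T)| <= k |s| (1 + T)] on the region [|w|^2 <= (1 + T)^(-a)].  So [Psi] is a Loewner
    chain: it is constant along [dw/dT = - a s w / G], and the region shrinks more slowly than these
    trajectories.  The extension of [f] is [F(z) = Psi_T(1 / conj z)] with [1 + T = |z|^(2/a)] for
    [|z| > 1]; its dilatation has modulus [|1 - G / (s (1 + T))| <= k <= l].

    Instead of solving the characteristic equation one follows Euler steps with an arbitrarily small
    total error, continued by a supremum argument.  They transport information from large [T], where
    [q] is close to a multiple of [T] and [Psi_T] is injective: hence [q] avoids [(-oo, 0]], [log (f / z)]
    is bounded, and [F] is injective.  As [eta = log f' + (1 / s - 1) log (f / z)] satisfies
    [|eta'| <= k / (1 - |z|) + O(1)], this gives [|f'| = O((1 - |z|)^(-k))], so [f] and [F] extend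
    continuously to the circle and [F] is absolutely continuous on lines.  Finally an injective
    continuous [F] tending to infinity with [F'(0) = 1] has winding number one about each value, so it is a sense-preserving homeomorphism. *)

(* With [1 + T = e^(2t)] and [w = e^(-st) z] the region is [|z| <= 1] and [Psi] is a chain
   [f(e^(-st) z) (1 - (a/c) (e^(2t) - 1) p(e^(-st) z))^s] in the usual form. Keeping [w] and [T] as
   variables removes the rotation [e^(-ibt)], so [b] enters the dilatation only through [s] and the
   bound is [k] itself. It also makes [1 - q] linear in [T]: a value of [q] on the negative axis at
   one time forces a zero of [q] at an earlier one. The obstacle is that nothing is known in advance
   about [f] near the circle, which dictates an order. The power [q^s] needs a logarithm, so zeros
   of [q] are excluded before [Psi] can be differentiated; [log q] then bounds [log (f/z)]; only
   then does the estimate of [eta'] control [f']. The coefficient of [1 / (1 - |z|)] in that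
   estimate must stay below 1, since [(1 - |z|)^(-k)] has to be integrable along radii and along
   lines crossing the circle. Trajectories are only approximate and values on the circle are limits,
   so bare injectivity would be lost on the way. It is therefore proved as separation: points at
   distance at least [del] have images at distance at least some [m > 0] that does not depend on the
   points. *)
From Stdlib Require Import Reals Psatz List ClassicalEpsilon.
Require Import Defs.
From Coquelicot Require Import Coquelicot.
Open Scope R_scope.

(** * Complex numbers *)

Lemma Cmod_sub_sym (z w : C) : Cmod (z - w) = Cmod (w - z).
Proof. rewrite <- Cmod_opp. f_equal. ring. Qed.

Lemma Cmod_diff_triangle (x y z : C) : Cmod (x - z) <= Cmod (x - y) + Cmod (y - z).
Proof. replace (x - z)%C with ((x - y) + (y - z))%C by ring. apply Cmod_triangle. Qed.

Lemma Cmod_triangle_rev (z w : C) : Cmod z - Cmod w <= Cmod (z - w).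
Proof.
  assert (H := Cmod_triangle (z - w) w).
  replace (z - w + w)%C with z in H by ring. lra.
Qed.

Lemma Cmod_minus_le (z w : C) : Cmod (z - w) <= Cmod z + Cmod w.
Proof. rewrite <- (Cmod_opp w). apply Cmod_triangle. Qed.

Lemma Cmod_sqr (z : C) : Cmod z * Cmod z = fst z * fst z + snd z * snd z.
Proof. generalize (Cmod2_alt z). unfold Re, Im. simpl. lra. Qed.

Lemma fst_le_Cmod (z : C) : Rabs (fst z) <= Cmod z.
Proof. apply (re_le_Cmod z). Qed.

Lemma snd_le_Cmod (z : C) : Rabs (snd z) <= Cmod z.
Proof. apply Rle_trans with (2 := Rmax_Cmod z). apply Rmax_r. Qed.

Lemma Cmod_le_abs (z : C) : Cmod z <= Rabs (fst z) + Rabs (snd z).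
Proof.
  assert (H := Cmod_sqr z). assert (H0 := Cmod_ge_0 z).
  assert (H1 := Rabs_pos (fst z)). assert (H2 := Rabs_pos (snd z)).
  assert (H3 : fst z * fst z = Rabs (fst z) * Rabs (fst z)).
  { rewrite <- Rabs_mult. symmetry. apply Rabs_pos_eq. nra. }
  assert (H4 : snd z * snd z = Rabs (snd z) * Rabs (snd z)).
  { rewrite <- Rabs_mult. symmetry. apply Rabs_pos_eq. nra. }
  nra.
Qed.

Lemma Cmod_RtoC_mult (r : R) (z : C) : Cmod (r * z) = Rabs r * Cmod z.
Proof. rewrite Cmod_mult, Cmod_R. reflexivity. Qed.

Lemma Cmod_pos (z : C) : z <> 0 -> 0 < Cmod z.
Proof. apply Cmod_gt_0. Qed.

Lemma Cmod_nz (z : C) : 0 < Cmod z -> z <> RtoC 0.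
Proof. apply Cmod_gt_0. Qed.

Lemma Cminus_eq0 (z w : C) : (z - w)%C = 0 -> z = w.
Proof. intros H. replace z with (z - w + w)%C by ring. rewrite H. ring. Qed.

Lemma Cmod_diff_pos (z w : C) : z <> w -> 0 < Cmod (z - w).
Proof. intros H. apply Cmod_gt_0. intros H0. apply H, Cminus_eq0, H0. Qed.

Lemma Cmod_le_eps_eq (z w : C) : (forall eps, 0 < eps -> Cmod (z - w) <= eps) -> z = w.
Proof.
  intros H. apply NNPP. intros H0. apply Cmod_diff_pos in H0.
  specialize (H (Cmod (z - w) / 2)). lra.
Qed.

Lemma C_ext (z w : C) : fst z = fst w -> snd z = snd w -> z = w.
Proof. destruct z, w; simpl; intros; subst; reflexivity. Qed.

Lemma dot_le_Cmod (e z : C) : Cmod e = 1 -> fst e * fst z + snd e * snd z <= Cmod z.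
Proof.
  intros He. assert (H1 := Cmod_sqr e). assert (H2 := Cmod_sqr z). rewrite He in H1.
  assert (H3 := Cmod_ge_0 z).
  assert (H : (fst e * fst z + snd e * snd z) * (fst e * fst z + snd e * snd z) <= Cmod z * Cmod z).
  { assert (H := Rle_0_sqr (fst e * snd z - snd e * fst z)). unfold Rsqr in H.
    replace (Cmod z * Cmod z) with ((1 * 1) * (Cmod z * Cmod z)) by ring. rewrite H1, H2. lra. }
  nra.
Qed.

(** The modulus is attained by a real linear functional of norm 1. This transfers real mean value,
    integral and monotonicity arguments to complex-valued functions. *)
Lemma unit_dir (z : C) : exists e : C, Cmod e = 1 /\ fst e * fst z + snd e * snd z = Cmod z.
Proof.
  destruct (Req_dec (Cmod z) 0) as [H|H].
  - exists 1. rewrite Cmod_1. split; auto. apply Cmod_eq_0 in H. subst z. simpl.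
    rewrite Cmod_0. ring.
  - exists (z * (/ Cmod z)%R)%C.
    assert (H0 := Cmod_ge_0 z). split.
    + rewrite Cmod_mult, Cmod_R, Rabs_pos_eq. field; auto.
      left. apply Rinv_0_lt_compat. lra.
    + simpl.
      transitivity (/ Cmod z * (Cmod z * Cmod z)).
      * rewrite Cmod_sqr. ring.
      * field; auto.
Qed.

(** * Sequential compactness *)

Definition ccv (u : nat -> C) (l : C) : Prop :=
  forall eps, 0 < eps -> exists N : nat, forall n, (N <= n)%nat -> Cmod (u n - l) < eps.

Lemma incr_ge (phi : nat -> nat) : (forall n, (phi n < phi (S n))%nat) -> forall n, (n <= phi n)%nat.
Proof. intros H. induction n. lia. specialize (H n). lia. Qed.

Lemma incr_mono (phi : nat -> nat) : (forall n, (phi n < phi (S n))%nat) ->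
  forall n m, (n <= m)%nat -> (phi n <= phi m)%nat.
Proof. intros H n m Hnm. induction Hnm. lia. specialize (H m). lia. Qed.

Lemma R_subseq (u : nat -> R) (B : R) : (forall n, Rabs (u n) <= B) ->
  exists (phi : nat -> nat) (l : R), (forall n, (phi n < phi (S n))%nat) /\
    forall eps, 0 < eps -> exists N : nat, forall n, (N <= n)%nat -> Rabs (u (phi n) - l) < eps.
Proof.
  intros HB.
  destruct (Bolzano_Weierstrass u (fun x => -B <= x <= B) (compact_P3 (-B) B)) as [l Hl].
  { intros n. specialize (HB n). apply Rabs_le_between in HB. exact HB. }
  assert (H : forall N n : nat, exists m : nat, (N < m)%nat /\ Rabs (u m - l) < / (INR n + 1)).
  { intros N n. assert (Hp : 0 < / (INR n + 1)) by (apply Rinv_0_lt_compat; assert (H0 := pos_INR n); lra).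
    destruct (Hl (disc l (mkposreal _ Hp)) (S N)) as [p [Hp1 Hp2]].
    - exists (mkposreal _ Hp). intros x Hx. exact Hx.
    - exists p. split. lia. exact Hp2. }
  set (nx := fun N n => proj1_sig (constructive_indefinite_description _ (H N n))).
  assert (Hnx : forall N n, (N < nx N n)%nat /\ Rabs (u (nx N n) - l) < / (INR n + 1)).
  { intros N n. exact (proj2_sig (constructive_indefinite_description _ (H N n))). }
  set (phi := fix phi (n : nat) : nat := match n with O => nx O O | S m => nx (phi m) (S m) end).
  assert (Hphi : forall n, Rabs (u (phi n) - l) < / (INR n + 1)).
  { intros [|n]; apply Hnx. }
  exists phi, l. split.
  - intros n. apply (Hnx (phi n) (S n)).
  - intros eps Heps. destruct (archimed_cor1 eps Heps) as [N [HN1 HN2]].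
    exists N. intros n Hn. apply Rlt_trans with (1 := Hphi n). apply Rle_lt_trans with (2 := HN1).
    apply Rinv_le_contravar. apply lt_0_INR; auto. apply le_INR in Hn. lra.
Qed.

Lemma C_subseq (u : nat -> C) (B : R) : (forall n, Cmod (u n) <= B) ->
  exists (phi : nat -> nat) (l : C), (forall n, (phi n < phi (S n))%nat) /\ ccv (fun n => u (phi n)) l.
Proof.
  intros HB.
  destruct (R_subseq (fun n => fst (u n)) B) as [p1 [l1 [Hp1 Hl1]]].
  { intros n. apply Rle_trans with (2 := HB n). apply fst_le_Cmod. }
  destruct (R_subseq (fun n => snd (u (p1 n))) B) as [p2 [l2 [Hp2 Hl2]]].
  { intros n. apply Rle_trans with (2 := HB (p1 n)). apply snd_le_Cmod. }
  exists (fun n => p1 (p2 n)), (l1, l2). split.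
  - intros n. apply Nat.lt_le_trans with (p1 (S (p2 n))). apply Hp1. apply incr_mono; auto. apply Hp2.
  - intros eps Heps. destruct (Hl1 (eps / 2)) as [N1 H1]; [lra|]. destruct (Hl2 (eps / 2)) as [N2 H2]; [lra|].
    exists (max N1 N2). intros n Hn. apply Rle_lt_trans with (1 := Cmod_le_abs _). simpl.
    specialize (H2 n ltac:(lia)). assert (Hn' := incr_ge p2 Hp2 n). specialize (H1 (p2 n) ltac:(lia)).
    unfold Rminus in *. lra.
Qed.

Lemma ccv_sub (u : nat -> C) (l : C) (phi : nat -> nat) : (forall n, (phi n < phi (S n))%nat) ->
  ccv u l -> ccv (fun n => u (phi n)) l.
Proof.
  intros Hphi H eps Heps. destruct (H eps Heps) as [N HN]. exists N. intros n Hn.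
  apply HN. assert (H0 := incr_ge phi Hphi n). lia.
Qed.

Lemma CC_subseq (u v : nat -> C) (B : R) : (forall n, Cmod (u n) <= B) -> (forall n, Cmod (v n) <= B) ->
  exists (phi : nat -> nat) (l m : C), (forall n, (phi n < phi (S n))%nat) /\
    ccv (fun n => u (phi n)) l /\ ccv (fun n => v (phi n)) m.
Proof.
  intros Hu Hv.
  destruct (C_subseq u B Hu) as [p1 [l1 [Hp1 Hl1]]].
  destruct (C_subseq (fun n => v (p1 n)) B) as [p2 [l2 [Hp2 Hl2]]]. { intros; apply Hv. }
  exists (fun n => p1 (p2 n)), l1, l2. split; [|split].
  - intros n. apply Nat.lt_le_trans with (p1 (S (p2 n))). apply Hp1. apply incr_mono; auto. apply Hp2.
  - apply (ccv_sub (fun n => u (p1 n))); auto.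
  - exact Hl2.
Qed.

(** The only form in which compactness is used: a property with a positive margin [m] that holds
    locally holds with a common margin. *)
Lemma compact_uniform (B : R) (K : C -> C -> Prop) (Q : C -> C -> R -> Prop) :
  (forall p q, K p q -> Cmod p <= B /\ Cmod q <= B) ->
  (forall p q, (forall del, 0 < del -> exists p' q', K p' q' /\ Cmod (p' - p) < del /\ Cmod (q' - q) < del)
     -> K p q) ->
  (forall p q m m', 0 < m' -> m' <= m -> Q p q m -> Q p q m') ->
  (forall p q, K p q -> exists del m, 0 < del /\ 0 < m /\ forall p' q', K p' q' ->
     Cmod (p' - p) < del -> Cmod (q' - q) < del -> Q p' q' m) ->
  exists m, 0 < m /\ forall p q, K p q -> Q p q m.
Proof.
  intros Hb Hcl Hmono Hloc. apply NNPP. intros Hno.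
  assert (H : forall n : nat, exists pq : C * C, K (fst pq) (snd pq) /\ ~ Q (fst pq) (snd pq) (/ (INR n + 1))).
  { intros n. apply NNPP. intros H0. apply Hno. exists (/ (INR n + 1)). split.
    - apply Rinv_0_lt_compat. assert (H1 := pos_INR n). lra.
    - intros p q Hpq. apply NNPP. intros H1. apply H0. exists (p, q). split; auto. }
  destruct (choice _ H) as [s Hs]. clear H.
  destruct (CC_subseq (fun n => fst (s n)) (fun n => snd (s n)) B) as [phi [p [q [Hphi [Hp Hq]]]]].
  { intros n. apply (Hb _ _ (proj1 (Hs n))). }
  { intros n. apply (Hb _ _ (proj1 (Hs n))). }
  assert (HK : K p q).
  { apply Hcl. intros del Hdel. destruct (Hp del Hdel) as [N1 H1]. destruct (Hq del Hdel) as [N2 H2].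
    exists (fst (s (phi (max N1 N2)))), (snd (s (phi (max N1 N2)))). split. apply Hs.
    split. apply H1; lia. apply H2; lia. }
  destruct (Hloc p q HK) as [del [m [Hdel [Hm HQ]]]].
  destruct (Hp del Hdel) as [N1 H1]. destruct (Hq del Hdel) as [N2 H2].
  destruct (archimed_cor1 m Hm) as [N3 [HN3 HN3']].
  set (n := max (max N1 N2) N3).
  assert (Hn := incr_ge phi Hphi n).
  apply (proj2 (Hs (phi n))).
  apply Hmono with m.
  - apply Rinv_0_lt_compat. assert (H3 := pos_INR (phi n)). lra.
  - apply Rlt_le. apply Rle_lt_trans with (2 := HN3). apply Rinv_le_contravar.
    apply lt_0_INR; auto. assert (N3 <= phi n)%nat by lia. apply le_INR in H. lra.
  - apply HQ. apply Hs. apply H1; lia. apply H2; lia.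
Qed.

(** * Derivatives *)

(** [dG i f x L]: [L] is the derivative of [f] at [x] with respect to the parametrisation [i];
    real and complex derivatives are the cases [i = RtoC] and [i = id]. *)
Definition dG {X : Type} (i f : X -> C) (x : X) (L : C) : Prop :=
  forall eps, 0 < eps -> exists del, 0 < del /\ forall y, Cmod (i y - i x) < del ->
    Cmod (f y - f x - (i y - i x) * L) <= eps * Cmod (i y - i x).
Definition cG {X : Type} (i f : X -> C) (x : X) : Prop :=
  forall eps, 0 < eps -> exists del, 0 < del /\ forall y, Cmod (i y - i x) < del -> Cmod (f y - f x) < eps.

Notation dC := (dG (fun z : C => z)).
Notation dR := (dG RtoC).
Notation cC := (cG (fun z : C => z)).
Notation cR := (cG RtoC).

Section Rules.
Context {X : Type} (i : X -> C).

Lemma dG_lip (f : X -> C) x L : dG i f x L ->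
  exists del, 0 < del /\ forall y, Cmod (i y - i x) < del -> Cmod (f y - f x) <= (Cmod L + 1) * Cmod (i y - i x).
Proof.
  intros H. destruct (H 1 Rlt_0_1) as [del [Hdel H1]]. exists del. split; auto. intros y Hy.
  specialize (H1 y Hy).
  replace (f y - f x)%C with ((f y - f x - (i y - i x) * L) + (i y - i x) * L)%C by ring.
  apply Rle_trans with (1 := Cmod_triangle _ _). rewrite Cmod_mult. lra.
Qed.

Lemma dG_cG (f : X -> C) x L : dG i f x L -> cG i f x.
Proof.
  intros H eps Heps. destruct (dG_lip f x L H) as [del [Hdel H1]].
  assert (H0 := Cmod_ge_0 L).
  exists (Rmin del (eps / (Cmod L + 1))). split.
  - apply Rmin_glb_lt; auto. apply Rdiv_lt_0_compat; lra.
  - intros y Hy. apply Rle_lt_trans with ((Cmod L + 1) * Cmod (i y - i x)).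
    + apply H1. apply Rlt_le_trans with (1 := Hy). apply Rmin_l.
    + apply Rlt_le_trans with ((Cmod L + 1) * (eps / (Cmod L + 1))).
      * apply Rmult_lt_compat_l. lra. apply Rlt_le_trans with (1 := Hy). apply Rmin_r.
      * right. field. lra.
Qed.

Lemma dG_const c x : dG i (fun _ => c) x 0.
Proof.
  intros eps Heps. exists 1. split. lra. intros y Hy.
  replace (c - c - (i y - i x) * 0)%C with (RtoC 0) by ring. rewrite Cmod_0.
  apply Rmult_le_pos. lra. apply Cmod_ge_0.
Qed.

Lemma dG_param x : dG i i x 1.
Proof.
  intros eps Heps. exists 1. split. lra. intros y Hy.
  replace (i y - i x - (i y - i x) * 1)%C with (RtoC 0) by ring. rewrite Cmod_0.
  apply Rmult_le_pos. lra. apply Cmod_ge_0.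
Qed.

Lemma dG_plus (f g : X -> C) x L M : dG i f x L -> dG i g x M -> dG i (fun y => f y + g y)%C x (L + M).
Proof.
  intros Hf Hg eps Heps. destruct (Hf (eps / 2)) as [d1 [Hd1 H1]]; [lra|].
  destruct (Hg (eps / 2)) as [d2 [Hd2 H2]]; [lra|].
  exists (Rmin d1 d2). split. apply Rmin_glb_lt; auto. intros y Hy.
  specialize (H1 y (Rlt_le_trans _ _ _ Hy (Rmin_l _ _))).
  specialize (H2 y (Rlt_le_trans _ _ _ Hy (Rmin_r _ _))).
  replace (f y + g y - (f x + g x) - (i y - i x) * (L + M))%C with
    ((f y - f x - (i y - i x) * L) + (g y - g x - (i y - i x) * M))%C by ring.
  apply Rle_trans with (1 := Cmod_triangle _ _). lra.
Qed.

Lemma dG_mult (f g : X -> C) x L M : dG i f x L -> dG i g x M ->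
  dG i (fun y => f y * g y)%C x (L * g x + f x * M).
Proof.
  intros Hf Hg eps Heps.
  set (A := Cmod L + 1). assert (HA : 0 < A) by (unfold A; assert (H := Cmod_ge_0 L); lra).
  set (G := Cmod (g x) + 1). assert (HG : 0 < G) by (unfold G; assert (H := Cmod_ge_0 (g x)); lra).
  set (F := Cmod (f x) + 1). assert (HF : 0 < F) by (unfold F; assert (H := Cmod_ge_0 (f x)); lra).
  destruct (Hf (eps / (3 * G))) as [d1 [Hd1 H1]]. { apply Rdiv_lt_0_compat; lra. }
  destruct (Hg (eps / (3 * F))) as [d2 [Hd2 H2]]. { apply Rdiv_lt_0_compat; lra. }
  destruct (dG_lip f x L Hf) as [d3 [Hd3 H3]].
  destruct (dG_cG g x M Hg (eps / (3 * A))) as [d4 [Hd4 H4]]. { apply Rdiv_lt_0_compat; lra. }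
  exists (Rmin (Rmin d1 d2) (Rmin d3 d4)). split. { repeat apply Rmin_glb_lt; auto. }
  intros y Hy.
  assert (Hy1 : Cmod (i y - i x) < d1).
  { apply Rlt_le_trans with (1 := Hy). eapply Rle_trans. apply Rmin_l. apply Rmin_l. }
  assert (Hy2 : Cmod (i y - i x) < d2).
  { apply Rlt_le_trans with (1 := Hy). eapply Rle_trans. apply Rmin_l. apply Rmin_r. }
  assert (Hy3 : Cmod (i y - i x) < d3).
  { apply Rlt_le_trans with (1 := Hy). eapply Rle_trans. apply Rmin_r. apply Rmin_l. }
  assert (Hy4 : Cmod (i y - i x) < d4).
  { apply Rlt_le_trans with (1 := Hy). eapply Rle_trans. apply Rmin_r. apply Rmin_r. }
  specialize (H1 y Hy1). specialize (H2 y Hy2). specialize (H3 y Hy3). specialize (H4 y Hy4).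
  set (D := (i y - i x)%C) in *. fold A in H3.
  replace (f y * g y - f x * g x - D * (L * g x + f x * M))%C with
    ((f y - f x - D * L) * g x + (f y - f x) * (g y - g x) + f x * (g y - g x - D * M))%C by ring.
  apply Rle_trans with (1 := Cmod_triangle _ _).
  apply Rle_trans with (1 := Rplus_le_compat_r _ _ _ (Cmod_triangle _ _)).
  rewrite !Cmod_mult.
  assert (HD := Cmod_ge_0 D).
  assert (E1 : Cmod (f y - f x - D * L) * Cmod (g x) <= eps / 3 * Cmod D).
  { apply Rle_trans with (eps / (3 * G) * Cmod D * G).
    - apply Rmult_le_compat; auto using Cmod_ge_0. unfold G; lra.
    - right. field. lra. }
  assert (E2 : Cmod (f y - f x) * Cmod (g y - g x) <= eps / 3 * Cmod D).
  { apply Rle_trans with (A * Cmod D * (eps / (3 * A))).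
    - apply Rmult_le_compat; auto using Cmod_ge_0. lra.
    - right. field. lra. }
  assert (E3 : Cmod (f x) * Cmod (g y - g x - D * M) <= eps / 3 * Cmod D).
  { apply Rle_trans with (F * (eps / (3 * F) * Cmod D)).
    - apply Rmult_le_compat; auto using Cmod_ge_0. unfold F; lra.
    - right. field. lra. }
  lra.
Qed.

Lemma dG_comp (h : C -> C) (f : X -> C) x L M : dG i f x L -> dC h (f x) M ->
  dG i (fun y => h (f y)) x (L * M).
Proof.
  intros Hf Hh eps Heps.
  set (A := Cmod L + 1). assert (HA : 0 < A) by (unfold A; assert (H := Cmod_ge_0 L); lra).
  set (G := Cmod M + 1). assert (HG : 0 < G) by (unfold G; assert (H := Cmod_ge_0 M); lra).
  destruct (Hf (eps / (2 * G))) as [d1 [Hd1 H1]]. { apply Rdiv_lt_0_compat; lra. }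
  destruct (dG_lip f x L Hf) as [d3 [Hd3 H3]].
  destruct (Hh (eps / (2 * A))) as [d2 [Hd2 H2]]. { apply Rdiv_lt_0_compat; lra. }
  destruct (dG_cG f x L Hf d2 Hd2) as [d4 [Hd4 H4]].
  exists (Rmin d1 (Rmin d3 d4)). split. { repeat apply Rmin_glb_lt; auto. }
  intros y Hy.
  assert (Hy1 : Cmod (i y - i x) < d1).
  { apply Rlt_le_trans with (1 := Hy). apply Rmin_l. }
  assert (Hy3 : Cmod (i y - i x) < d3).
  { apply Rlt_le_trans with (1 := Hy). eapply Rle_trans. apply Rmin_r. apply Rmin_l. }
  assert (Hy4 : Cmod (i y - i x) < d4).
  { apply Rlt_le_trans with (1 := Hy). eapply Rle_trans. apply Rmin_r. apply Rmin_r. }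
  specialize (H1 y Hy1). specialize (H3 y Hy3). specialize (H2 (f y) (H4 y Hy4)).
  set (D := (i y - i x)%C) in *. fold A in H3.
  replace (h (f y) - h (f x) - D * (L * M))%C with
    ((h (f y) - h (f x) - (f y - f x) * M) + (f y - f x - D * L) * M)%C by ring.
  apply Rle_trans with (1 := Cmod_triangle _ _). rewrite !Cmod_mult.
  assert (HD := Cmod_ge_0 D).
  assert (E1 : Cmod (h (f y) - h (f x) - (f y - f x) * M) <= eps / 2 * Cmod D).
  { apply Rle_trans with (1 := H2). apply Rle_trans with (eps / (2 * A) * (A * Cmod D)).
    - apply Rmult_le_compat_l; auto. left. apply Rdiv_lt_0_compat; lra.
    - right. field. lra. }
  assert (E2 : Cmod (f y - f x - D * L) * Cmod M <= eps / 2 * Cmod D).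
  { apply Rle_trans with (eps / (2 * G) * Cmod D * G).
    - apply Rmult_le_compat; auto using Cmod_ge_0. unfold G; lra.
    - right. field. lra. }
  lra.
Qed.

Lemma dG_eq (f : X -> C) x L M : dG i f x L -> L = M -> dG i f x M.
Proof. intros H E. subst M. exact H. Qed.

Lemma dG_ext_loc (f g : X -> C) x L d : 0 < d ->
  (forall y, Cmod (i y - i x) < d -> f y = g y) -> dG i f x L -> dG i g x L.
Proof.
  intros Hd Hfg H eps Heps. destruct (H eps Heps) as [del [Hdel H1]].
  exists (Rmin d del). split. apply Rmin_glb_lt; auto. intros y Hy.
  rewrite <- !Hfg.
  - apply H1. apply Rlt_le_trans with (1 := Hy). apply Rmin_r.
  - replace (i x - i x)%C with (RtoC 0) by ring. rewrite Cmod_0. exact Hd.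
  - apply Rlt_le_trans with (1 := Hy). apply Rmin_l.
Qed.

Lemma dG_opp (f : X -> C) x L : dG i f x L -> dG i (fun y => - f y)%C x (- L).
Proof.
  intros H eps Heps. destruct (H eps Heps) as [del [Hdel H1]]. exists del. split; auto.
  intros y Hy. rewrite <- Cmod_opp.
  replace (- (- f y - - f x - (i y - i x) * - L))%C with (f y - f x - (i y - i x) * L)%C by ring. auto.
Qed.

Lemma dG_minus (f g : X -> C) x L M : dG i f x L -> dG i g x M -> dG i (fun y => f y - g y)%C x (L - M).
Proof. intros Hf Hg. apply dG_plus; auto. apply dG_opp; auto. Qed.

Lemma dG_scal (c : C) (f : X -> C) x L : dG i f x L -> dG i (fun y => c * f y)%C x (c * L).
Proof.
  intros Hf. eapply dG_eq. apply dG_mult. apply dG_const. exact Hf. simpl. ring.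
Qed.

Lemma cG_const c x : cG i (fun _ => c) x.
Proof. apply dG_cG with (RtoC 0). apply dG_const. Qed.

Lemma cG_plus (f g : X -> C) x : cG i f x -> cG i g x -> cG i (fun y => f y + g y)%C x.
Proof.
  intros Hf Hg eps Heps. destruct (Hf (eps / 2)) as [d1 [Hd1 H1]]; [lra|].
  destruct (Hg (eps / 2)) as [d2 [Hd2 H2]]; [lra|].
  exists (Rmin d1 d2). split. apply Rmin_glb_lt; auto. intros y Hy.
  specialize (H1 y (Rlt_le_trans _ _ _ Hy (Rmin_l _ _))).
  specialize (H2 y (Rlt_le_trans _ _ _ Hy (Rmin_r _ _))).
  replace (f y + g y - (f x + g x))%C with ((f y - f x) + (g y - g x))%C by ring.
  apply Rle_lt_trans with (1 := Cmod_triangle _ _). lra.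
Qed.

Lemma cG_comp (h : C -> C) (f : X -> C) x : cG i f x -> cC h (f x) -> cG i (fun y => h (f y)) x.
Proof.
  intros Hf Hh eps Heps. destruct (Hh eps Heps) as [d1 [Hd1 H1]].
  destruct (Hf d1 Hd1) as [d2 [Hd2 H2]]. exists d2. split; auto.
Qed.

Lemma cG_bound (f : X -> C) x : cG i f x -> exists del, 0 < del /\
  forall y, Cmod (i y - i x) < del -> Cmod (f y) <= Cmod (f x) + 1.
Proof.
  intros H. destruct (H 1 Rlt_0_1) as [d [Hd H1]]. exists d. split; auto. intros y Hy.
  specialize (H1 y Hy). assert (H2 := Cmod_triangle_rev (f y) (f x)). lra.
Qed.

Lemma cG_mult (f g : X -> C) x : cG i f x -> cG i g x -> cG i (fun y => f y * g y)%C x.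
Proof.
  intros Hf Hg eps Heps.
  set (G := Cmod (g x) + 1). assert (HG : 0 < G) by (unfold G; assert (H := Cmod_ge_0 (g x)); lra).
  set (F := Cmod (f x) + 1). assert (HF : 0 < F) by (unfold F; assert (H := Cmod_ge_0 (f x)); lra).
  destruct (Hf (eps / (2 * G))) as [d1 [Hd1 H1]]. { apply Rdiv_lt_0_compat; lra. }
  destruct (Hg (eps / (2 * F))) as [d2 [Hd2 H2]]. { apply Rdiv_lt_0_compat; lra. }
  destruct (cG_bound f x Hf) as [d3 [Hd3 H3]].
  exists (Rmin d1 (Rmin d2 d3)). split. { repeat apply Rmin_glb_lt; auto. }
  intros y Hy.
  assert (Hy1 : Cmod (i y - i x) < d1).
  { apply Rlt_le_trans with (1 := Hy). apply Rmin_l. }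
  assert (Hy3 : Cmod (i y - i x) < d2).
  { apply Rlt_le_trans with (1 := Hy). eapply Rle_trans. apply Rmin_r. apply Rmin_l. }
  assert (Hy4 : Cmod (i y - i x) < d3).
  { apply Rlt_le_trans with (1 := Hy). eapply Rle_trans. apply Rmin_r. apply Rmin_r. }
  specialize (H1 y Hy1). specialize (H2 y Hy3). specialize (H3 y Hy4).
  replace (f y * g y - f x * g x)%C with ((f y - f x) * g x + f y * (g y - g x))%C by ring.
  apply Rle_lt_trans with (1 := Cmod_triangle _ _). rewrite !Cmod_mult.
  assert (E1 : Cmod (f y - f x) * Cmod (g x) <= eps / (2 * G) * Cmod (g x)).
  { apply Rmult_le_compat_r. apply Cmod_ge_0. lra. }
  assert (E1' : eps / (2 * G) * Cmod (g x) < eps / 2).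
  { replace (eps / 2) with (eps / (2 * G) * G) by (field; lra). apply Rmult_lt_compat_l.
    apply Rdiv_lt_0_compat; lra. unfold G; lra. }
  assert (E2 : Cmod (f y) * Cmod (g y - g x) <= F * (eps / (2 * F))).
  { apply Rmult_le_compat; auto using Cmod_ge_0. lra. }
  assert (E2' : F * (eps / (2 * F)) = eps / 2) by (field; lra).
  lra.
Qed.

End Rules.

Lemma dC_inv (z : C) : z <> 0 -> dC Cinv z (- / (z * z)).
Proof.
  intros Hz eps Heps. assert (Hm := Cmod_pos z Hz). set (m := Cmod z) in *.
  exists (Rmin (m / 2) (eps * (m * m * m) / 2)). split.
  { apply Rmin_glb_lt. lra. repeat apply Rmult_lt_0_compat; lra. }
  intros w Hw.
  assert (Hw1 : Cmod (w - z) < m / 2) by (apply Rlt_le_trans with (1 := Hw); apply Rmin_l).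
  assert (Hw2 : Cmod (w - z) < eps * (m * m * m) / 2) by (apply Rlt_le_trans with (1 := Hw); apply Rmin_r).
  assert (Hwm : m / 2 < Cmod w).
  { assert (H := Cmod_triangle_rev z w). rewrite Cmod_sub_sym in H. fold m in H. lra. }
  assert (Hw0 : w <> 0) by (apply Cmod_gt_0; lra).
  replace (/ w - / z - (w - z) * - / (z * z))%C with ((w - z) * (w - z) / (w * z * z))%C
    by (field; auto).
  rewrite Cmod_div, !Cmod_mult. 2: { repeat apply Cmult_neq_0; auto. }
  fold m.
  set (D := Cmod (w - z)) in *. set (W := Cmod w) in *.
  assert (0 <= D) by apply Cmod_ge_0.
  apply Rle_div_l. { repeat apply Rmult_lt_0_compat; lra. }
  replace (eps * D * (W * m * m)) with (D * (eps * (W * m * m))) by ring.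
  apply Rmult_le_compat_l; auto.
  apply Rlt_le. apply Rlt_le_trans with (1 := Hw2).
  replace (eps * (m * m * m) / 2) with (eps * (m / 2 * m * m)) by field.
  apply Rmult_le_compat_l. lra. apply Rmult_le_compat_r. lra. apply Rmult_le_compat_r; lra.
Qed.

Lemma dG_inv {X} (i f : X -> C) x L : f x <> 0 -> dG i f x L -> dG i (fun y => / f y)%C x (- L / (f x * f x)).
Proof.
  intros Hx Hf. eapply dG_eq. apply (dG_comp i Cinv f x L (- / (f x * f x)) Hf). apply dC_inv; auto.
  field. auto.
Qed.

Lemma dG_div {X} (i f g : X -> C) x L M : g x <> 0 -> dG i f x L -> dG i g x M ->
  dG i (fun y => f y / g y)%C x ((L * g x - f x * M) / (g x * g x)).
Proof.
  intros Hx Hf Hg. eapply dG_eq. apply dG_mult. exact Hf. apply dG_inv; eauto.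
  simpl. field. auto.
Qed.

Lemma cG_inv {X} (i f : X -> C) x : f x <> 0 -> cG i f x -> cG i (fun y => / f y)%C x.
Proof.
  intros Hx Hf. apply (cG_comp i Cinv f x Hf). eapply dG_cG. apply dC_inv; auto.
Qed.

Lemma dC_unique (f : C -> C) z L M : dC f z L -> dC f z M -> L = M.
Proof.
  intros H1 H2. apply Cmod_le_eps_eq. intros eps Heps.
  destruct (H1 (eps / 2)) as [d1 [Hd1 K1]]; [lra|]. destruct (H2 (eps / 2)) as [d2 [Hd2 K2]]; [lra|].
  set (h := Rmin d1 d2 / 2). assert (Hh : 0 < h < Rmin d1 d2).
  { assert (0 < Rmin d1 d2) by (apply Rmin_glb_lt; auto). unfold h. lra. }
  assert (Hhm : Cmod (z + h - z) = h).
  { replace (z + h - z)%C with (RtoC h) by ring. rewrite Cmod_R. apply Rabs_pos_eq. lra. }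
  assert (E1 := K1 (z + h)%C). assert (E2 := K2 (z + h)%C). cbv beta in E1, E2. rewrite Hhm in E1, E2.
  specialize (E1 (Rlt_le_trans _ _ _ (proj2 Hh) (Rmin_l _ _))).
  specialize (E2 (Rlt_le_trans _ _ _ (proj2 Hh) (Rmin_r _ _))).
  assert (E : h * Cmod (L - M) <= h * eps).
  { rewrite <- Hhm at 1. rewrite <- Cmod_mult.
    replace ((z + h - z) * (L - M))%C with ((f (z + h) - f z - (z + h - z) * M) - (f (z + h) - f z - (z + h - z) * L))%C by ring.
    apply Rle_trans with (1 := Cmod_minus_le _ _). lra. }
  nra.
Qed.

(** * Curves *)

Lemma dR_components (g : R -> C) t v : dR g t v ->
  is_derive (fun s => fst (g s)) t (fst v) /\ is_derive (fun s => snd (g s)) t (snd v).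
Proof.
  intros H. split; apply is_derive_Reals; intros eps Heps;
  (destruct (H (eps / 2)) as [d [Hd H1]]; [lra|]); exists (mkposreal d Hd); intros h Hh0 Hh; simpl in Hh;
  assert (E := H1 (t + h)); rewrite <- RtoC_minus in E; replace (t + h - t) with h in E by ring;
  rewrite Cmod_R in E; specialize (E Hh).
  - assert (E1 := Rle_trans _ _ _ (fst_le_Cmod _) E). simpl in E1.
    replace ((fst (g (t + h)) - fst (g t)) / h - fst v) with
      ((fst (g (t + h)) + - fst (g t) + - (h * fst v - 0 * snd v)) * / h) by (field; auto).
    rewrite Rabs_mult, Rabs_inv.
    apply Rle_lt_trans with (eps / 2 * Rabs h * / Rabs h).
    + apply Rmult_le_compat_r; auto. left. apply Rinv_0_lt_compat, Rabs_pos_lt; auto.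
    + rewrite Rmult_assoc, Rinv_r. lra. apply Rabs_no_R0; auto.
  - assert (E1 := Rle_trans _ _ _ (snd_le_Cmod _) E). simpl in E1.
    replace ((snd (g (t + h)) - snd (g t)) / h - snd v) with
      ((snd (g (t + h)) + - snd (g t) + - (h * snd v + 0 * fst v)) * / h) by (field; auto).
    rewrite Rabs_mult, Rabs_inv.
    apply Rle_lt_trans with (eps / 2 * Rabs h * / Rabs h).
    + apply Rmult_le_compat_r; auto. left. apply Rinv_0_lt_compat, Rabs_pos_lt; auto.
    + rewrite Rmult_assoc, Rinv_r. lra. apply Rabs_no_R0; auto.
Qed.

Lemma dR_of_components (g : R -> C) t (v : C) :
  is_derive (fun s => fst (g s)) t (fst v) -> is_derive (fun s => snd (g s)) t (snd v) -> dR g t v.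
Proof.
  intros H1 H2 eps Heps. apply is_derive_Reals in H1. apply is_derive_Reals in H2.
  destruct (H1 (eps / 2)) as [d1 K1]; [lra|]. destruct (H2 (eps / 2)) as [d2 K2]; [lra|].
  exists (Rmin d1 d2). split. { apply Rmin_glb_lt; apply cond_pos. }
  intros s Hs. rewrite <- RtoC_minus in *. rewrite Cmod_R in *.
  destruct (Req_dec s t) as [->|Hst].
  - replace (g t - g t - (t - t)%R * v)%C with (RtoC 0). rewrite Cmod_0. apply Rmult_le_pos; [lra|apply Rabs_pos].
    rewrite RtoC_minus. ring.
  - assert (Hst' : s - t <> 0) by lra.
    specialize (K1 (s - t) Hst' (Rlt_le_trans _ _ _ Hs (Rmin_l _ _))).
    specialize (K2 (s - t) Hst' (Rlt_le_trans _ _ _ Hs (Rmin_r _ _))).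
    replace (t + (s - t)) with s in * by ring.
    apply Rle_trans with (1 := Cmod_le_abs _). simpl.
    set (A := (fst (g s) - fst (g t)) / (s - t) - fst v) in *.
    set (D := (snd (g s) - snd (g t)) / (s - t) - snd v) in *.
    replace (fst (g s) + - fst (g t) + - ((s - t) * fst v - 0 * snd v)) with ((s - t) * A) by (unfold A; field; auto).
    replace (snd (g s) + - snd (g t) + - ((s - t) * snd v + 0 * fst v)) with ((s - t) * D) by (unfold D; field; auto).
    rewrite !Rabs_mult. assert (H := Rabs_pos (s - t)). nra.
Qed.

Lemma nondecreasing_of_derive (phi d : R -> R) (a b : R) : a <= b ->
  (forall t, a < t < b -> is_derive phi t (d t) /\ 0 <= d t) ->
  (forall t, a <= t <= b -> continuity_pt phi t) -> phi a <= phi b.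
Proof.
  intros [Hab| ->] Hd Hc; [|lra].
  assert (Hpr : forall t, a < t < b -> derivable_pt phi t).
  { intros t Ht. exists (d t). apply is_derive_Reals. apply Hd, Ht. }
  destruct (MVT phi id a b Hpr (fun t _ => derivable_pt_id t) Hab Hc) as [c [P Hc1]].
  { intros t _. apply derivable_continuous_pt, derivable_pt_id. }
  rewrite derive_pt_id in Hc1. unfold id in Hc1.
  rewrite (derive_pt_eq_0 phi c (d c) (Hpr c P)) in Hc1.
  - destruct (Hd c P). nra.
  - apply is_derive_Reals, Hd, P.
Qed.

Lemma cR_components (g : R -> C) t : cR g t ->
  continuity_pt (fun s => fst (g s)) t /\ continuity_pt (fun s => snd (g s)) t.
Proof.
  intros H; split; intros eps Heps; destruct (H eps Heps) as [d [Hd1 Hd2]]; exists d; split; auto;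
  intros s [_ Hs]; simpl in *; unfold R_dist in *;
  (apply Rle_lt_trans with (2 := Hd2 s ltac:(rewrite <- RtoC_minus, Cmod_R; auto))).
  - apply (fst_le_Cmod (g s - g t)%C).
  - apply (snd_le_Cmod (g s - g t)%C).
Qed.

Lemma cR_of_components (g : R -> C) t :
  continuity_pt (fun s => fst (g s)) t -> continuity_pt (fun s => snd (g s)) t -> cR g t.
Proof.
  intros H1 H2 eps Heps.
  destruct (H1 (eps / 2)) as [d1 [Hd1 K1]]; [lra|]. destruct (H2 (eps / 2)) as [d2 [Hd2 K2]]; [lra|].
  exists (Rmin d1 d2). split. apply Rmin_glb_lt; auto. intros s. rewrite <- RtoC_minus, Cmod_R. intros Hs.
  destruct (Req_dec t s) as [<-|Hst].
  - replace (g t - g t)%C with (RtoC 0) by ring. rewrite Cmod_0. lra.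
  - apply Rle_lt_trans with (1 := Cmod_le_abs _). simpl.
    specialize (K1 s). specialize (K2 s). simpl in K1, K2. unfold R_dist in *.
    assert (Rabs (fst (g s) - fst (g t)) < eps / 2).
    { apply K1. split. split; [exact I|auto]. apply Rlt_le_trans with (1 := Hs), Rmin_l. }
    assert (Rabs (snd (g s) - snd (g t)) < eps / 2).
    { apply K2. split. split; [exact I|auto]. apply Rlt_le_trans with (1 := Hs), Rmin_r. }
    unfold Rminus in *. lra.
Qed.

(** Projecting [g] on the direction of [g b - g a] reduces the claim to the monotonicity of a real
    function. Derivatives are required only inside the interval, so that the majorant [G] may have
    an infinite slope at an endpoint. *)
Lemma dR_mvt (g v : R -> C) (G G1 : R -> R) (a b : R) : a <= b ->
  (forall t, a < t < b -> dR g t (v t) /\ is_derive G t (G1 t) /\ Cmod (v t) <= G1 t) ->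
  (forall t, a <= t <= b -> cR g t /\ continuity_pt G t) ->
  Cmod (g b - g a) <= G b - G a.
Proof.
  intros Hab Hd Hc.
  destruct (unit_dir (g b - g a)) as [e [He1 He2]].
  set (phi := fun t => G t - (fst e * fst (g t) + snd e * snd (g t))).
  enough (phi a <= phi b). { unfold phi in H. simpl in He2. lra. }
  apply nondecreasing_of_derive with (fun t => G1 t - (fst e * fst (v t) + snd e * snd (v t))); auto.
  - intros t Ht. destruct (Hd t Ht) as [H1 [H2 H5]]. destruct (dR_components _ _ _ H1) as [H3 H4]. split.
    + unfold phi.
      apply (is_derive_minus (V := R_NormedModule)); auto. apply (is_derive_plus (V := R_NormedModule)).
      apply is_derive_scal with (f := fun s => fst (g s)); auto.
      apply is_derive_scal with (f := fun s => snd (g s)); auto.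
    + assert (H0 := dot_le_Cmod e (v t) He1). lra.
  - intros t Ht. destruct (Hc t Ht) as [H1 H2]. destruct (cR_components _ _ H1) as [H3 H4].
    unfold phi. apply continuity_pt_minus; auto. apply continuity_pt_plus; apply continuity_pt_mult; auto;
    apply continuity_pt_const; intros x y; reflexivity.
Qed.

Lemma ex_derive_continuity_pt (g : R -> R) x : ex_derive g x -> continuity_pt g x.
Proof.
  intros [l Hl]. apply derivable_continuous_pt. exists l. apply is_derive_Reals, Hl.
Qed.

Lemma is_derive_linear (m t : R) : is_derive (fun t => m * t) t m.
Proof.
  apply is_derive_Reals. assert (H := derivable_pt_lim_scal id m t 1 (derivable_pt_lim_id t)).
  rewrite Rmult_1_r in H. exact H.
Qed.

Lemma dR_lipschitz (g v : R -> C) (M a b : R) : a <= b ->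
  (forall t, a <= t <= b -> dR g t (v t) /\ Cmod (v t) <= M) -> Cmod (g b - g a) <= M * (b - a).
Proof.
  intros Hab H. replace (M * (b - a)) with (M * b - M * a) by ring.
  apply (dR_mvt g v (fun t => M * t) (fun _ => M)); auto.
  - intros t Ht. destruct (H t) as [H1 H2]; [lra|]. split; [auto|split; auto].
    apply is_derive_linear.
  - intros t Ht. destruct (H t) as [H1 H2]; [lra|]. split. eapply dG_cG; eauto.
    apply derivable_continuous_pt, derivable_pt_scal, derivable_pt_id.
Qed.

Lemma dR_affine (z h : C) (t : R) : dR (fun t => z + t * h)%C t h.
Proof.
  eapply dG_eq. apply dG_plus. apply dG_const. apply dG_mult. apply dG_param. apply dG_const. simpl. ring.
Qed.

Definition segment (z w : C) (t : R) : C := (z + t * (w - z))%C.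

Lemma segment_dist (z w : C) t : 0 <= t <= 1 -> Cmod (segment z w t - z) <= Cmod (w - z).
Proof.
  intros Ht. unfold segment. replace (z + t * (w - z) - z)%C with (t * (w - z))%C by ring.
  rewrite Cmod_RtoC_mult, Rabs_pos_eq by lra. assert (H := Cmod_ge_0 (w - z)). nra.
Qed.

Lemma segment_ball (z w z0 : C) t r : 0 <= t <= 1 -> Cmod (z - z0) <= r -> Cmod (w - z0) <= r ->
  Cmod (segment z w t - z0) <= r.
Proof.
  intros Ht Hz Hw. unfold segment.
  replace (z + t * (w - z) - z0)%C with ((1 - t)%R * (z - z0) + t * (w - z0))%C by (rewrite RtoC_minus; ring).
  apply Rle_trans with (1 := Cmod_triangle _ _). rewrite !Cmod_RtoC_mult, !Rabs_pos_eq by lra. nra.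
Qed.

(** The free slope [L] serves three purposes: [L = 0] gives Lipschitz bounds, [L = f1 z] first-order
    expansions, and a fixed [L] shows that [f] is close to a dilation. *)
Lemma dC_lipschitz_segment (f f1 : C -> C) (z w L : C) (M : R) :
  (forall t, 0 <= t <= 1 -> dC f (segment z w t) (f1 (segment z w t)) /\ Cmod (f1 (segment z w t) - L) <= M) ->
  Cmod (f w - f z - (w - z) * L) <= M * Cmod (w - z).
Proof.
  intros H.
  set (g := fun t : R => (f (segment z w t) - segment z w t * L)%C).
  assert (E : (f w - f z - (w - z) * L)%C = (g 1 - g 0)%C).
  { unfold g, segment. replace (z + 1 * (w - z))%C with w by ring. replace (z + 0 * (w - z))%C with z by ring. ring. }
  rewrite E. replace (M * Cmod (w - z)) with (M * Cmod (w - z) * (1 - 0)) by ring.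
  apply (dR_lipschitz g (fun t => (w - z) * (f1 (segment z w t) - L))%C). lra.
  intros t Ht. destruct (H t Ht) as [H1 H2]. split.
  - unfold g. eapply dG_eq. apply dG_minus. apply (dG_comp RtoC f (segment z w)). apply dR_affine. exact H1.
    apply dG_mult. apply dR_affine. apply dG_const. simpl. ring.
  - rewrite Cmod_mult, Rmult_comm. apply Rmult_le_compat_r. apply Cmod_ge_0. exact H2.
Qed.

(** * Integrals *)

Definition CInt (phi : R -> C) (a b : R) : C := (RInt (fun t => fst (phi t)) a b, RInt (fun t => snd (phi t)) a b).

Definition cont_on (phi : R -> C) (a b : R) : Prop := forall t, a <= t <= b -> cR phi t.

Lemma cont_on_ex (phi : R -> C) a b : a <= b -> cont_on phi a b ->
  ex_RInt (fun t => fst (phi t)) a b /\ ex_RInt (fun t => snd (phi t)) a b.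
Proof.
  intros Hab H. split; apply (ex_RInt_continuous (V := R_CompleteNormedModule)); intros t Ht;
  rewrite Rmin_left, Rmax_right in Ht by auto; apply continuity_pt_filterlim; apply cR_components, H, Ht.
Qed.

Lemma CInt_plus (phi psi : R -> C) a b : a <= b -> cont_on phi a b -> cont_on psi a b ->
  CInt (fun t => phi t + psi t)%C a b = (CInt phi a b + CInt psi a b)%C.
Proof.
  intros Hab H1 H2. destruct (cont_on_ex _ _ _ Hab H1). destruct (cont_on_ex _ _ _ Hab H2).
  apply C_ext; simpl; apply (RInt_plus (V := R_CompleteNormedModule)); auto.
Qed.

Lemma CInt_scal (c : C) (phi : R -> C) a b : a <= b -> cont_on phi a b ->
  CInt (fun t => c * phi t)%C a b = (c * CInt phi a b)%C.
Proof.
  intros Hab H. destruct (cont_on_ex _ _ _ Hab H) as [H1 H2].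
  apply C_ext; simpl.
  - rewrite (RInt_minus (V := R_CompleteNormedModule)).
    + rewrite !(RInt_scal (V := R_CompleteNormedModule)); auto.
    + apply (ex_RInt_scal (V := R_CompleteNormedModule)); auto.
    + apply (ex_RInt_scal (V := R_CompleteNormedModule)); auto.
  - rewrite (RInt_plus (V := R_CompleteNormedModule)).
    + rewrite !(RInt_scal (V := R_CompleteNormedModule)); auto.
    + apply (ex_RInt_scal (V := R_CompleteNormedModule)); auto.
    + apply (ex_RInt_scal (V := R_CompleteNormedModule)); auto.
Qed.

Lemma CInt_ext (phi psi : R -> C) a b : a <= b -> (forall t, a <= t <= b -> phi t = psi t) ->
  CInt phi a b = CInt psi a b.
Proof.
  intros Hab H. apply C_ext; simpl; apply (RInt_ext (V := R_CompleteNormedModule)); intros t Ht;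
  rewrite Rmin_left, Rmax_right in Ht by auto; rewrite H; auto; lra.
Qed.

Lemma CInt_bound (phi : R -> C) a b M : a <= b -> cont_on phi a b ->
  (forall t, a <= t <= b -> Cmod (phi t) <= M) -> Cmod (CInt phi a b) <= M * (b - a).
Proof.
  intros Hab H HM. destruct (cont_on_ex _ _ _ Hab H) as [H1 H2].
  destruct (unit_dir (CInt phi a b)) as [e [He1 He2]]. rewrite <- He2. simpl.
  assert (E : is_RInt (fun t => plus (scal (fst e) (fst (phi t))) (scal (snd e) (snd (phi t)))) a b
     (plus (scal (fst e) (RInt (fun t => fst (phi t)) a b)) (scal (snd e) (RInt (fun t => snd (phi t)) a b)))).
  { apply (is_RInt_plus (V := R_NormedModule)); apply (is_RInt_scal (V := R_NormedModule));
    apply (RInt_correct (V := R_CompleteNormedModule)); auto. }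
  apply is_RInt_le with (a := a) (b := b) (1 := Hab) (2 := E) (g := fun _ => M).
  - replace (M * (b - a)) with (scal (b - a) M) by apply Rmult_comm. apply (is_RInt_const (V := R_NormedModule)).
  - intros t Ht. apply Rle_trans with (2 := HM t ltac:(lra)). apply (dot_le_Cmod e (phi t) He1).
Qed.

Lemma CInt_FTC (g phi : R -> C) a b : a <= b -> cont_on phi a b ->
  (forall t, a <= t <= b -> dR g t (phi t)) -> CInt phi a b = (g b - g a)%C.
Proof.
  intros Hab H Hd.
  apply C_ext; simpl; apply (is_RInt_unique (V := R_CompleteNormedModule)).
  - apply (is_RInt_derive (V := R_CompleteNormedModule) (fun t => fst (g t))); intros t Ht;
    rewrite Rmin_left, Rmax_right in Ht by auto.
    + apply dR_components, Hd, Ht.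
    + apply continuity_pt_filterlim; apply cR_components, H, Ht.
  - apply (is_RInt_derive (V := R_CompleteNormedModule) (fun t => snd (g t))); intros t Ht;
    rewrite Rmin_left, Rmax_right in Ht by auto.
    + apply dR_components, Hd, Ht.
    + apply continuity_pt_filterlim; apply cR_components, H, Ht.
Qed.

Lemma dG_CInt {X : Type} (i : X -> C) (k k1 : X -> R -> C) (x : X) (a b : R) : a <= b ->
  (exists d, 0 < d /\ forall y, Cmod (i y - i x) < d -> cont_on (k y) a b) ->
  cont_on (k1 x) a b ->
  (forall eps, 0 < eps -> exists del, 0 < del /\ forall y, Cmod (i y - i x) < del ->
     forall t, a <= t <= b -> Cmod (k y t - k x t - (i y - i x) * k1 x t) <= eps * Cmod (i y - i x)) ->
  dG i (fun y => CInt (k y) a b) x (CInt (k1 x) a b).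
Proof.
  intros Hab [d [Hd Hk]] Hk1 H eps Heps.
  (* The [+ 1] keeps the denominator positive when [a = b]. *)
  destruct (H (eps / (b - a + 1))) as [del [Hdel H1]]. { apply Rdiv_lt_0_compat; lra. }
  exists (Rmin d del). split. apply Rmin_glb_lt; auto. intros y Hy.
  assert (Hkx : cont_on (k x) a b).
  { apply Hk. replace (i x - i x)%C with (RtoC 0) by ring. rewrite Cmod_0. auto. }
  assert (Hky : cont_on (k y) a b). { apply Hk. apply Rlt_le_trans with (1 := Hy), Rmin_l. }
  assert (E : (CInt (k y) a b - CInt (k x) a b - (i y - i x) * CInt (k1 x) a b)%C =
     CInt (fun t => (k y t + ((- (1)) * k x t + (- (i y - i x)) * k1 x t))%C) a b).
  { rewrite (CInt_plus (k y)); auto. rewrite CInt_plus; auto. rewrite !CInt_scal; auto. ring.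
    - intros t Ht. apply cG_mult. apply cG_const. auto.
    - intros t Ht. apply cG_mult. apply cG_const. auto.
    - intros t Ht. apply cG_plus; apply cG_mult; try apply cG_const; auto. }
  rewrite E.
  apply Rle_trans with (eps / (b - a + 1) * Cmod (i y - i x) * (b - a)).
  - apply CInt_bound; auto.
    + intros t Ht. apply cG_plus; auto. apply cG_plus; apply cG_mult; try apply cG_const; auto.
    + intros t Ht.
      replace (k y t + (- (1) * k x t + - (i y - i x) * k1 x t))%C with (k y t - k x t - (i y - i x) * k1 x t)%C by ring.
      apply H1; auto. apply Rlt_le_trans with (1 := Hy), Rmin_r.
  - assert (H2 := Cmod_ge_0 (i y - i x)).
    replace (eps / (b - a + 1) * Cmod (i y - i x) * (b - a)) with (eps * Cmod (i y - i x) * ((b - a) / (b - a + 1))) by (field; lra).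
    rewrite <- (Rmult_1_r (eps * Cmod (i y - i x))) at 2. apply Rmult_le_compat_l. nra.
    apply Rle_div_l; lra.
Qed.

(** * Exponential and logarithm *)

Definition Cexp (z : C) : C := (exp (fst z) * cos (snd z), exp (fst z) * sin (snd z)).

Lemma Cexp_plus (z w : C) : Cexp (z + w) = (Cexp z * Cexp w)%C.
Proof. unfold Cexp. apply C_ext; simpl; rewrite exp_plus; [rewrite cos_plus|rewrite sin_plus]; ring. Qed.

Lemma Cexp_0 : Cexp 0 = 1.
Proof. unfold Cexp. simpl. rewrite exp_0, cos_0, sin_0. apply C_ext; simpl; ring. Qed.

Lemma Cmod_Cexp (z : C) : Cmod (Cexp z) = exp (fst z).
Proof.
  assert (H := Cmod_sqr (Cexp z)). unfold Cexp at 3 4 5 6 in H. simpl in H.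
  assert (H1 := sin2_cos2 (snd z)). unfold Rsqr in H1. assert (H2 := exp_pos (fst z)).
  assert (H3 := Cmod_ge_0 (Cexp z)).
  assert (Cmod (Cexp z) * Cmod (Cexp z) = exp (fst z) * exp (fst z)).
  { rewrite H. transitivity (exp (fst z) * exp (fst z) * (sin (snd z) * sin (snd z) + cos (snd z) * cos (snd z))). ring. rewrite H1. ring. }
  nra.
Qed.

Lemma Cexp_neq_0 (z : C) : Cexp z <> 0.
Proof. apply Cmod_gt_0. rewrite Cmod_Cexp. apply exp_pos. Qed.

Lemma Cexp_opp (z : C) : Cexp (- z) = (/ Cexp z)%C.
Proof.
  assert (H := Cexp_neq_0 z).
  assert (H1 : (Cexp (- z) * Cexp z)%C = 1). { rewrite <- Cexp_plus. replace (- z + z)%C with (RtoC 0) by ring. apply Cexp_0. }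
  rewrite <- (Cmult_1_l (/ Cexp z)), <- H1. field. auto.
Qed.

Lemma Cexp_minus (z w : C) : Cexp (z - w) = (Cexp z / Cexp w)%C.
Proof. unfold Cminus. rewrite Cexp_plus, Cexp_opp. reflexivity. Qed.

Lemma dR_Cexp_line (h : C) (t : R) : dR (fun t => Cexp (t * h)) t (h * Cexp (t * h)).
Proof.
  apply dR_of_components; unfold Cexp; simpl; auto_derive; auto; unfold Rminus; ring.
Qed.

Lemma Cexp_lin (h : C) : Cmod h <= 1 -> Cmod (Cexp h - 1) <= exp 1 * Cmod h.
Proof.
  intros Hh.
  replace (Cexp h - 1)%C with (Cexp (1 * h) - Cexp (0 * h))%C.
  2: { replace (0 * h)%C with (RtoC 0) by ring. rewrite Cexp_0. replace (1 * h)%C with h by ring. ring. }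
  replace (exp 1 * Cmod h) with (exp 1 * Cmod h * (1 - 0)) by ring.
  apply (dR_lipschitz (fun t => Cexp (t * h)) (fun t => h * Cexp (t * h))%C). lra.
  intros t Ht. split. apply dR_Cexp_line.
  rewrite Cmod_mult, Rmult_comm. apply Rmult_le_compat_r. apply Cmod_ge_0.
  rewrite Cmod_Cexp. simpl.
  assert (H := fst_le_Cmod h). assert (H1 := Rabs_le_between (fst h) (Cmod h)). apply H1 in H.
  destruct (Rle_lt_or_eq_dec (t * fst h - 0 * snd h) 1) as [H2|H2]. nra.
  left. apply exp_increasing; auto. rewrite H2. lra.
Qed.

Lemma Cexp_quad (h : C) : Cmod h <= 1 -> Cmod (Cexp h - 1 - h) <= exp 1 * Cmod h * Cmod h.
Proof.
  intros Hh.
  replace (Cexp h - 1 - h)%C with ((Cexp (1 * h) - 1 * h) - (Cexp (0 * h) - 0 * h))%C.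
  2: { replace (0 * h)%C with (RtoC 0) by ring. rewrite Cexp_0. replace (1 * h)%C with h by ring. ring. }
  replace (exp 1 * Cmod h * Cmod h) with (exp 1 * Cmod h * Cmod h * (1 - 0)) by ring.
  apply (dR_lipschitz (fun t => Cexp (t * h) - t * h)%C (fun t => h * (Cexp (t * h) - 1))%C). lra.
  intros t Ht. split.
  - eapply dG_eq. apply dG_minus. apply dR_Cexp_line. apply dG_mult. apply dG_param. apply dG_const. simpl. ring.
  - rewrite Cmod_mult, Rmult_comm. apply Rmult_le_compat_r. apply Cmod_ge_0.
    assert (H0 := Cmod_ge_0 h).
    assert (E : Cmod (t * h) <= Cmod h). { rewrite Cmod_RtoC_mult, Rabs_pos_eq by lra. nra. }
    apply Rle_trans with (1 := Cexp_lin _ (Rle_trans _ _ _ E Hh)).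
    apply Rmult_le_compat_l; auto. left. apply exp_pos.
Qed.

Lemma dC_Cexp (z : C) : dC Cexp z (Cexp z).
Proof.
  intros eps Heps.
  assert (Hz := Cmod_pos _ (Cexp_neq_0 z)).
  assert (He := exp_pos 1).
  assert (Hp : 0 < Cmod (Cexp z) * exp 1) by nra.
  exists (Rmin 1 (eps / (Cmod (Cexp z) * exp 1))). split.
  { apply Rmin_glb_lt. lra. apply Rdiv_lt_0_compat; lra. }
  intros w Hw. assert (H1 := Rlt_le_trans _ _ _ Hw (Rmin_l _ _)). assert (H2 := Rlt_le_trans _ _ _ Hw (Rmin_r _ _)).
  replace (Cexp w - Cexp z - (w - z) * Cexp z)%C with (Cexp z * (Cexp (w - z) - 1 - (w - z)))%C.
  2: { rewrite Cexp_minus. field. apply Cexp_neq_0. }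
  rewrite Cmod_mult.
  apply Rle_trans with (Cmod (Cexp z) * (exp 1 * Cmod (w - z) * Cmod (w - z))).
  - apply Rmult_le_compat_l. lra. apply Cexp_quad. lra.
  - replace (Cmod (Cexp z) * (exp 1 * Cmod (w - z) * Cmod (w - z))) with
      (Cmod (Cexp z) * exp 1 * Cmod (w - z) * Cmod (w - z)) by ring.
    apply Rmult_le_compat_r. apply Cmod_ge_0.
    apply Rlt_le in H2. apply (Rmult_le_compat_l (Cmod (Cexp z) * exp 1)) in H2; [|lra].
    replace (Cmod (Cexp z) * exp 1 * (eps / (Cmod (Cexp z) * exp 1))) with eps in H2 by (field; nra). exact H2.
Qed.

Definition slit (w : C) : Prop := 0 < Cmod w + fst w.

(** The half-angle formula: a single expression for the principal argument on the plane without
    [(-oo, 0]], which is the set [slit]. *)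
Definition Carg (w : C) : R := 2 * atan (snd w / (Cmod w + fst w)).
Definition Clog (w : C) : C := (ln (Cmod w), Carg w).

Lemma slit_neq_0 (w : C) : slit w -> w <> 0.
Proof. intros H H0. subst w. unfold slit in H. rewrite Cmod_0 in H. simpl in H. lra. Qed.

Lemma slit_iff (w : C) : ~ slit w <-> (snd w = 0 /\ fst w <= 0).
Proof.
  unfold slit. assert (H := Cmod_sqr w). assert (H0 := Cmod_ge_0 w). split.
  - intros H1. assert (Cmod w + fst w <= 0) by lra. split; [|lra].
    assert (Cmod w * Cmod w <= fst w * fst w) by nra. nra.
  - intros [H1 H2] H3. rewrite H1 in H. nra.
Qed.

Lemma Carg_bound (w : C) : - PI < Carg w < PI.
Proof. unfold Carg. destruct (atan_bound (snd w / (Cmod w + fst w))). lra. Qed.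

Lemma cos_sin_2atan (t : R) : cos (2 * atan t) = (1 - t * t) / (1 + t * t) /\ sin (2 * atan t) = 2 * t / (1 + t * t).
Proof.
  set (x := atan t).
  assert (Hx : cos x > 0). { destruct (atan_bound t). apply cos_gt_0; unfold x; lra. }
  assert (Ht : t = sin x / cos x). { rewrite <- (tan_atan t) at 1. reflexivity. }
  assert (H1 := sin2_cos2 x). unfold Rsqr in H1.
  assert (E : 1 + t * t = / (cos x * cos x)).
  { rewrite Ht. transitivity ((sin x * sin x + cos x * cos x) / (cos x * cos x)). field. lra. rewrite H1. field. lra. }
  assert (E' : 1 - t * t = (cos x * cos x - sin x * sin x) / (cos x * cos x)).
  { rewrite Ht. field. lra. }
  split.
  - rewrite cos_2a, E, E'. field. lra.
  - rewrite sin_2a, E, Ht. field. lra.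
Qed.

Lemma Cexp_Clog (w : C) : slit w -> Cexp (Clog w) = w.
Proof.
  intros Hw. assert (Hm := Cmod_pos _ (slit_neq_0 _ Hw)). unfold slit in Hw.
  assert (Hs := Cmod_sqr w). unfold Cexp, Clog, Carg. simpl. rewrite exp_ln by auto.
  destruct (cos_sin_2atan (snd w / (Cmod w + fst w))) as [-> ->].
  set (r := Cmod w) in *. set (x := fst w) in *. set (y := snd w) in *.
  assert (Hd : (r + x) * (r + x) + y * y = 2 * r * (r + x)) by nra.
  assert (Hd' : 0 < 2 * r * (r + x)) by nra.
  apply C_ext; simpl; fold x y.
  - replace (r * ((1 - y / (r + x) * (y / (r + x))) / (1 + y / (r + x) * (y / (r + x))))) with
      (r * ((r + x) * (r + x) - y * y) / ((r + x) * (r + x) + y * y)) by (field; split; nra).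
    rewrite Hd. replace (y * y) with (r * r - x * x) by lra. field. nra.
  - replace (r * (2 * (y / (r + x)) / (1 + y / (r + x) * (y / (r + x))))) with
      (r * (2 * y * (r + x)) / ((r + x) * (r + x) + y * y)) by (field; split; nra).
    rewrite Hd. field. nra.
Qed.

Lemma Clog_1 : Clog 1 = 0.
Proof.
  unfold Clog, Carg. rewrite Cmod_1. simpl. rewrite ln_1. replace (0 / (1 + 1)) with 0 by field.
  rewrite atan_0. apply C_ext; simpl; ring.
Qed.

Lemma cC_lip (h : C -> R) (z : C) : (forall w, Rabs (h w - h z) <= Cmod (w - z)) -> cC (fun w => RtoC (h w)) z.
Proof.
  intros H eps Heps. exists eps. split; auto. intros w Hw. rewrite <- RtoC_minus, Cmod_R.
  apply Rle_lt_trans with (2 := Hw). apply H.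
Qed.

Lemma cC_fst z : cC (fun w => RtoC (fst w)) z.
Proof. apply cC_lip. intros w. apply (fst_le_Cmod (w - z)%C). Qed.

Lemma cC_snd z : cC (fun w => RtoC (snd w)) z.
Proof. apply cC_lip. intros w. apply (snd_le_Cmod (w - z)%C). Qed.

Lemma cC_Cmod z : cC (fun w => RtoC (Cmod w)) z.
Proof.
  apply cC_lip. intros w. apply Rabs_le. assert (H := Cmod_triangle_rev w z).
  assert (H1 := Cmod_triangle_rev z w). rewrite Cmod_sub_sym in H1. lra.
Qed.

Lemma cG_real {X} (i : X -> C) (h : R -> R) (g : X -> R) (x : X) : cG i (fun y => RtoC (g y)) x -> continuity_pt h (g x) ->
  cG i (fun y => RtoC (h (g y))) x.
Proof.
  intros Hg Hh eps Heps. destruct (Hh eps Heps) as [d [Hd H]]. destruct (Hg d Hd) as [d' [Hd' H']].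
  exists d'. split; auto. intros y Hy. specialize (H' y Hy). rewrite <- RtoC_minus, Cmod_R in *.
  destruct (Req_dec (g x) (g y)) as [E|E].
  - rewrite E, Rminus_eq_0, Rabs_R0. auto.
  - apply H. split. split; [exact I|auto]. exact H'.
Qed.

Lemma cC_Carg (w : C) : slit w -> cC (fun w => RtoC (Carg w)) w.
Proof.
  intros Hw.
  assert (H : cC (fun w => RtoC (snd w / (Cmod w + fst w))) w).
  { assert (E : cC (fun w => snd w * / (RtoC (Cmod w) + fst w))%C w).
    { apply cG_mult. apply cC_snd. apply cG_inv.
      - unfold slit in Hw. rewrite <- RtoC_plus. intros H. apply RtoC_inj in H. lra.
      - apply cG_plus. apply cC_Cmod. apply cC_fst. }
    intros eps Heps. destruct (E eps Heps) as [d [Hd H1]].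
    destruct (cG_plus (fun z : C => z) _ _ w (cC_Cmod w) (cC_fst w) (Cmod w + fst w) Hw) as [d2 [Hd2 H2]].
    exists (Rmin d d2). split. apply Rmin_glb_lt; auto.
    intros z Hz. specialize (H1 z (Rlt_le_trans _ _ _ Hz (Rmin_l _ _))).
    specialize (H2 z (Rlt_le_trans _ _ _ Hz (Rmin_r _ _))).
    rewrite <- !RtoC_plus, <- RtoC_minus, Cmod_R in H2. apply Rabs_lt_between in H2.
    unfold slit in Hw.
    rewrite <- !RtoC_plus in H1. rewrite <- !RtoC_inv, <- !RtoC_mult in H1 by lra. exact H1. }
  apply (cG_real _ (fun x => 2 * atan x) (fun w => snd w / (Cmod w + fst w))); auto.
  apply continuity_pt_mult. apply continuity_pt_const; intros x y; reflexivity.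
  apply derivable_continuous_pt. eexists. apply derivable_pt_lim_atan.
Qed.

Lemma cC_Clog (w : C) : slit w -> cC Clog w.
Proof.
  intros Hw.
  assert (H : cC (fun w => RtoC (ln (Cmod w)) + Ci * RtoC (Carg w))%C w).
  { apply cG_plus.
    - apply (cG_real _ ln Cmod). apply cC_Cmod. apply derivable_continuous_pt. eexists. apply derivable_pt_lim_ln.
      apply Cmod_pos, slit_neq_0, Hw.
    - apply cG_mult. apply cG_const. apply cC_Carg, Hw. }
  intros eps Heps. destruct (H eps Heps) as [d [Hd H1]]. exists d. split; auto. intros z Hz.
  assert (E : forall u, Clog u = (ln (Cmod u) + Ci * Carg u)%C).
  { intros u. unfold Clog. apply C_ext; simpl; ring. }
  rewrite !E. auto.
Qed.

Lemma dC_inverse (f g : C -> C) (w L : C) (r : R) : 0 < r -> (forall z, Cmod (z - w) < r -> f (g z) = z) ->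
  cC g w -> dC f (g w) L -> L <> 0 -> dC g w (/ L).
Proof.
  intros Hr Hfg Hg Hf HL eps Heps. assert (HLm := Cmod_pos _ HL). set (m := Cmod L) in *.
  set (e := Rmin (m / 2) (eps * m * m / 2)).
  assert (He : 0 < e). { apply Rmin_glb_lt. lra. repeat apply Rmult_lt_0_compat; lra. }
  destruct (Hf e He) as [d [Hd H1]]. destruct (Hg d Hd) as [d2 [Hd2 H2]].
  exists (Rmin r d2). split. apply Rmin_glb_lt; auto. intros z Hz.
  specialize (H2 z (Rlt_le_trans _ _ _ Hz (Rmin_r _ _))). specialize (H1 (g z) H2).
  rewrite (Hfg z), (Hfg w) in H1.
  3: { apply Rlt_le_trans with (1 := Hz), Rmin_l. }
  2: { replace (w - w)%C with (RtoC 0) by ring. rewrite Cmod_0. auto. }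
  set (D := (g z - g w)%C) in *. set (W := (z - w)%C) in *.
  assert (HD0 := Cmod_ge_0 D).
  assert (HD : m / 2 * Cmod D <= Cmod W).
  { assert (E := Cmod_triangle_rev (D * L) W). rewrite Cmod_sub_sym, Cmod_mult in E. fold m in E.
    assert (e <= m / 2) by apply Rmin_l. nra. }
  replace (D - W * / L)%C with (- (W - D * L) / L)%C by (field; auto).
  rewrite Cmod_div, Cmod_opp by auto. fold m. apply Rle_div_l; auto.
  apply Rle_trans with (1 := H1).
  assert (e <= eps * m * m / 2) by apply Rmin_r.
  apply Rle_trans with (eps * m * m / 2 * Cmod D). { apply Rmult_le_compat_r; auto. }
  replace (eps * m * m / 2 * Cmod D) with (eps * m * (m / 2 * Cmod D)) by field.
  replace (eps * Cmod W * m) with (eps * m * Cmod W) by ring. apply Rmult_le_compat_l; nra.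
Qed.

Lemma slit_open (w : C) : slit w -> exists r, 0 < r /\ forall z, Cmod (z - w) < r -> slit z.
Proof.
  intros Hw. destruct (cG_plus (fun z : C => z) _ _ w (cC_Cmod w) (cC_fst w) (Cmod w + fst w) Hw) as [d2 [Hd2 H2]].
  exists d2. split; auto. intros z Hz. specialize (H2 z Hz).
  rewrite <- !RtoC_plus, <- RtoC_minus, Cmod_R in H2. apply Rabs_lt_between in H2. unfold slit. lra.
Qed.

Lemma dC_Clog (w : C) : slit w -> dC Clog w (/ w).
Proof.
  intros Hw. destruct (slit_open w Hw) as [r [Hr H]].
  apply dC_inverse with (f := Cexp) (r := r); auto.
  - intros z Hz. apply Cexp_Clog; auto.
  - apply cC_Clog; auto.
  - rewrite <- (Cexp_Clog w Hw) at 2. apply dC_Cexp.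
  - apply slit_neq_0; auto.
Qed.

(** * Holomorphic functions on the unit disc *)

Definition derivD (f f1 : C -> C) : Prop := forall z, Cmod z < 1 -> dC f z (f1 z).
Definition contD (f : C -> C) : Prop := forall z, Cmod z < 1 -> cC f z.
(** Continuity of the derivative is built in, so that Cauchy's formula follows from differentiation
    under the integral sign and Goursat's theorem is avoided. *)
Definition Hol (f : C -> C) : Prop := exists f1, derivD f f1 /\ contD f1.

Lemma derivD_contD f f1 : derivD f f1 -> contD f.
Proof. intros H z Hz. eapply dG_cG. apply H, Hz. Qed.

Lemma Hol_contD f : Hol f -> contD f.
Proof. intros [f1 [H _]]. eapply derivD_contD; eauto. Qed.

Lemma contD_unif g r eps : contD g -> r < 1 -> 0 < eps ->
  exists m, 0 < m /\ forall z, Cmod z <= r -> forall w, Cmod (w - z) < m -> Cmod (g w - g z) < eps.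
Proof.
  intros Hg Hr Heps.
  (* The second point is a dummy fixed at 0: compactness is used here for one point only. *)
  destruct (compact_uniform (Rmax r 0) (fun p q => Cmod p <= r /\ q = 0)
    (fun p q m => forall w, Cmod (w - p) < m -> Cmod (g w - g p) < eps)) as [m [Hm H]].
  - intros p q [H1 ->]. rewrite Cmod_0. split. apply Rle_trans with (1 := H1), Rmax_l. apply Rmax_r.
  - intros p q H. split.
    + apply Rnot_lt_le. intros Hp. destruct (H (Cmod p - r)) as [p' [q' [[H1 _] [H2 _]]]]. lra.
      assert (H3 := Cmod_triangle_rev p p'). rewrite Cmod_sub_sym in H3. lra.
    + apply Cmod_le_eps_eq. intros e He. destruct (H e He) as [p' [q' [[_ H1] [_ H2]]]]. subst q'.
      rewrite Cmod_sub_sym. lra.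
  - intros p q m m' H0 H1 H2 w Hw. apply H2. lra.
  - intros p q [Hp ->]. destruct (Hg p ltac:(lra) (eps / 2)) as [d [Hd H]]; [lra|].
    exists (d / 2), (d / 2). split; [lra|split; [lra|]]. intros p' q' _ Hp' _ w Hw.
    assert (H1 := H p' ltac:(lra)).
    assert (H2 := H w ltac:(assert (H3 := Cmod_diff_triangle w p' p); lra)).
    assert (H3 := Cmod_diff_triangle (g w) (g p) (g p')). rewrite (Cmod_sub_sym (g p) (g p')) in H3. lra.
  - exists m. split; auto. intros z Hz. apply (H z 0). auto.
Qed.

Lemma contD_bounded g r : contD g -> r < 1 -> exists B, 0 < B /\ forall z, Cmod z <= r -> Cmod (g z) <= B.
Proof.
  intros Hg Hr.
  destruct (compact_uniform (Rmax r 0) (fun p q => Cmod p <= r /\ q = 0)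
    (fun p q m => Cmod (g p) <= / m)) as [m [Hm H]].
  - intros p q [H1 ->]. rewrite Cmod_0. split. apply Rle_trans with (1 := H1), Rmax_l. apply Rmax_r.
  - intros p q H. split.
    + apply Rnot_lt_le. intros Hp. destruct (H (Cmod p - r)) as [p' [q' [[H1 _] [H2 _]]]]. lra.
      assert (H3 := Cmod_triangle_rev p p'). rewrite Cmod_sub_sym in H3. lra.
    + apply Cmod_le_eps_eq. intros e He. destruct (H e He) as [p' [q' [[_ H1] [_ H2]]]]. subst q'.
      rewrite Cmod_sub_sym. lra.
  - intros p q m m' H0 H1 H2. apply Rle_trans with (1 := H2). apply Rinv_le_contravar; auto.
  - intros p q [Hp ->]. destruct (cG_bound _ g p (Hg p ltac:(lra))) as [d [Hd H]].
    assert (H0 := Cmod_ge_0 (g p)).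
    exists d, (/ (Cmod (g p) + 1)). split; auto. split. apply Rinv_0_lt_compat; lra.
    intros p' q' _ Hp' _. rewrite Rinv_inv. auto.
  - exists (/ m). split. apply Rinv_0_lt_compat; auto. intros z Hz. apply (H z 0). auto.
Qed.

Lemma derivD_unif f f1 r eps : derivD f f1 -> contD f1 -> r < 1 -> 0 < eps ->
  exists m, 0 < m /\ forall z, Cmod z <= r -> forall w, Cmod (w - z) < m ->
    Cmod (f w - f z - (w - z) * f1 z) <= eps * Cmod (w - z).
Proof.
  intros Hf Hf1 Hr Heps. destruct (contD_unif f1 r eps Hf1 Hr Heps) as [m [Hm H]].
  exists (Rmin m (1 - r)). split. apply Rmin_glb_lt; lra. intros z Hz w Hw.
  apply dC_lipschitz_segment with f1. intros t Ht.
  assert (H1 := segment_dist z w t Ht). split.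
  - apply Hf. assert (H2 := Cmod_triangle_rev (segment z w t) z).
    assert (H3 := Rmin_r m (1 - r)). lra.
  - left. apply H; auto. assert (H3 := Rmin_l m (1 - r)). lra.
Qed.

Lemma derivD_lipschitz f f1 r : derivD f f1 -> contD f1 -> r < 1 ->
  exists L, 0 < L /\ forall z w, Cmod z <= r -> Cmod w <= r -> Cmod (f w - f z) <= L * Cmod (w - z).
Proof.
  intros Hf Hf1 Hr. destruct (contD_bounded f1 r Hf1 Hr) as [B [HB H]].
  exists B. split; auto. intros z w Hz Hw.
  replace (f w - f z)%C with (f w - f z - (w - z) * 0)%C by ring.
  apply dC_lipschitz_segment with f1. intros t Ht.
  assert (H1 : Cmod (segment z w t) <= r).
  { replace (segment z w t) with (segment z w t - 0)%C by ring.
    apply segment_ball; auto; [replace (z - 0)%C with z by ring|replace (w - 0)%C with w by ring]; auto. }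
  split. apply Hf; lra. replace (f1 (segment z w t) - 0)%C with (f1 (segment z w t)) by ring. auto.
Qed.

Lemma derivD_zero_const f : derivD f (fun _ => 0) -> forall z, Cmod z < 1 -> f z = f 0.
Proof.
  intros Hf z Hz. apply Cmod_le_eps_eq. intros eps Heps.
  replace (f z - f 0)%C with (f z - f 0 - (z - 0) * 0)%C by ring.
  apply Rle_trans with (0 * Cmod (z - 0)); [|lra]. apply dC_lipschitz_segment with (fun _ => 0).
  intros t Ht. split.
  - apply Hf. assert (H := segment_dist 0 z t Ht). replace (segment 0 z t - 0)%C with (segment 0 z t) in H by ring.
    replace (z - 0)%C with z in H by ring. lra.
  - replace (0 - 0)%C with (RtoC 0) by ring. rewrite Cmod_0. lra.
Qed.

Definition cder (f : C -> C) (z : C) : C := epsilon (inhabits (RtoC 0)) (fun L => dC f z L).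

Lemma cder_spec f z L : dC f z L -> dC f z (cder f z).
Proof. intros H. apply (epsilon_spec (inhabits (RtoC 0)) (fun L => dC f z L)). exists L. auto. Qed.

Lemma cder_eq f z L : dC f z L -> cder f z = L.
Proof. intros H. eapply dC_unique. eapply cder_spec; eauto. auto. Qed.

Lemma ball_in_disc (z w : C) (r : R) : Cmod (w - z) < r - Cmod z -> Cmod w < r.
Proof. intros H. assert (H1 := Cmod_triangle_rev w z). lra. Qed.

(** The integral representations below depend on a radius [r], and so do their derivatives.
    Uniqueness of the derivative lets [cder] patch them into one function on the disc. *)
Lemma Hol_local f : (forall r, 0 < r < 1 -> exists g g1, forall z, Cmod z < r ->
    f z = g z /\ dC g z (g1 z) /\ cC g1 z) -> Hol f.
Proof.
  intros H.
  assert (K : forall r, 0 < r < 1 -> exists g1, forall z, Cmod z < r -> dC f z (g1 z) /\ cC g1 z).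
  { intros r Hr. destruct (H r Hr) as [g [g1 Hg]]. exists g1. intros z Hz. split; [|apply Hg, Hz].
    apply dG_ext_loc with (f := g) (d := r - Cmod z). lra.
    - intros y Hy. symmetry. apply Hg. apply ball_in_disc with z. auto.
    - apply Hg, Hz. }
  exists (cder f). split.
  - intros z Hz. assert (Hz0 := Cmod_ge_0 z). destruct (K ((1 + Cmod z) / 2)) as [g1 Hg1]. lra.
    eapply cder_spec. apply Hg1. lra.
  - intros z Hz. assert (Hz0 := Cmod_ge_0 z). destruct (K ((1 + Cmod z) / 2)) as [g1 Hg1]. lra.
    intros eps Heps. destruct (proj2 (Hg1 z ltac:(lra)) eps Heps) as [d [Hd H1]].
    exists (Rmin d ((1 - Cmod z) / 2)). split. apply Rmin_glb_lt; lra. intros y Hy.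
    assert (Hy' : Cmod y < (1 + Cmod z) / 2).
    { apply ball_in_disc with z. apply Rlt_le_trans with (1 := Hy). apply Rle_trans with (1 := Rmin_r _ _). lra. }
    rewrite (cder_eq f z (g1 z)), (cder_eq f y (g1 y)).
    + apply H1. apply Rlt_le_trans with (1 := Hy), Rmin_l.
    + apply Hg1, Hy'.
    + apply Hg1. lra.
Qed.

(** * Cauchy's integral formula on circles, removable singularities and logarithms *)

Definition cir (r : R) (t : R) : C := (r * Cexp (t * Ci))%C.

Lemma Cmod_cir r t : 0 <= r -> Cmod (cir r t) = r.
Proof.
  intros Hr. unfold cir. rewrite Cmod_RtoC_mult, Rabs_pos_eq, Cmod_Cexp; auto. simpl.
  replace (t * 0 - 0 * 1) with 0 by ring. rewrite exp_0. ring.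
Qed.

Lemma cir_comp r t : cir r t = (r * cos t, r * sin t).
Proof.
  unfold cir, Cexp. apply C_ext; simpl;
  replace (t * 0 - 0 * 1) with 0 by ring; replace (t * 1 + 0 * 0) with t by ring; rewrite exp_0; ring.
Qed.

Lemma dR_cir r t : dR (cir r) t (Ci * cir r t).
Proof.
  eapply dG_eq. apply dG_scal. apply dR_Cexp_line. unfold cir. ring.
Qed.

Lemma cir_2PI r : cir r (2 * PI) = cir r 0.
Proof. rewrite !cir_comp, cos_2PI, sin_2PI, cos_0, sin_0. reflexivity. Qed.

(** The integral is taken in the angle. As [d zeta = i zeta dt], a factor [cir r t] inside [phi]
    stands for [d zeta / i], and the normalising constant is [2 pi]. Allowing every exponent [n]
    makes the family stable under differentiation in [z]. *)
Definition cauchy (r : R) (phi : R -> C) (n : nat) (z : C) : C :=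
  CInt (fun t => phi t * (/ (cir r t - z)) ^ n)%C 0 (2 * PI).

Lemma two_PI_pos : 0 <= 2 * PI.
Proof. assert (H := PI_RGT_0). lra. Qed.

Lemma dC_inv_pow (a : C) (n : nat) (z : C) : a <> z ->
  dC (fun z => (/ (a - z)) ^ n)%C z (INR n * (/ (a - z)) ^ (S n))%C.
Proof.
  intros Ha. assert (Haz : (a - z)%C <> 0). { intros H. apply Ha, Cminus_eq0, H. }
  induction n as [|n IH].
  - simpl. eapply dG_eq. apply dG_const. simpl. ring.
  - rewrite S_INR, RtoC_plus. simpl. eapply dG_eq.
    + apply dG_mult. apply dG_inv. exact Haz. apply dG_minus. apply dG_const. apply dG_param. exact IH.
    + simpl. field. auto.
Qed.

Lemma cir_far r (z : C) t : 0 < r -> Cmod z < r -> 0 < r - Cmod z <= Cmod (cir r t - z).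
Proof.
  intros Hr Hz. assert (H := Cmod_triangle_rev (cir r t) z). rewrite Cmod_cir in H by lra. lra.
Qed.

Lemma cir_neq r (z : C) t : 0 < r -> Cmod z < r -> (cir r t - z)%C <> 0.
Proof. intros Hr Hz. apply Cmod_gt_0. destruct (cir_far r z t Hr Hz). lra. Qed.

Lemma cG_pow {X} (i f : X -> C) (x : X) n : cG i f x -> cG i (fun y => (f y) ^ n)%C x.
Proof. intros Hf. induction n. exact (cG_const i (RtoC 1) x). exact (cG_mult i _ _ x Hf IHn). Qed.

Lemma cauchy_cont r phi n z : 0 < r -> Cmod z < r -> (forall t, cR phi t) ->
  cont_on (fun t => phi t * (/ (cir r t - z)) ^ n)%C 0 (2 * PI).
Proof.
  intros Hr Hz Hphi t _. apply cG_mult; auto. apply cG_pow. apply cG_inv. apply cir_neq; auto.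
  eapply dG_cG. apply dG_minus. apply dR_cir. apply dG_const.
Qed.

Lemma phi_bounded (phi : R -> C) : (forall t, cR phi t) -> exists B, 0 < B /\ forall t, 0 <= t <= 2 * PI -> Cmod (phi t) <= B.
Proof.
  intros Hphi.
  destruct (continuity_ab_maj (fun t => Cmod (phi t)) 0 (2 * PI) two_PI_pos) as [m [Hm _]].
  - intros t _.
    intros eps Heps. destruct (Hphi t eps Heps) as [d [Hd H]]. exists d. split; auto.
    intros s [_ Hs]. simpl in *. unfold R_dist in *.
    specialize (H s ltac:(rewrite <- RtoC_minus, Cmod_R; auto)).
    apply Rle_lt_trans with (2 := H). apply Rabs_le. assert (H1 := Cmod_triangle_rev (phi s) (phi t)).
    assert (H2 := Cmod_triangle_rev (phi t) (phi s)). rewrite Cmod_sub_sym in H2. lra.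
  - exists (Cmod (phi m) + 1). split. assert (H := Cmod_ge_0 (phi m)). lra. intros t Ht. specialize (Hm t Ht). simpl in Hm. lra.
Qed.

Lemma Cmod_inv_pow_le (u : C) (n : nat) (m : R) : 0 < m -> m <= Cmod u -> Cmod ((/ u) ^ n) <= (/ m) ^ n.
Proof.
  intros Hm Hu. rewrite Cmod_pow. rewrite Cmod_inv by (apply Cmod_gt_0; lra).
  apply pow_incr. split. left; apply Rinv_0_lt_compat; lra. apply Rinv_le_contravar; auto.
Qed.

Lemma dC_cauchy r phi n z : 0 < r -> Cmod z < r -> (forall t, cR phi t) ->
  dC (cauchy r phi n) z (INR n * cauchy r phi (S n) z)%C.
Proof.
  intros Hr Hz Hphi. unfold cauchy.
  rewrite <- CInt_scal; [|apply two_PI_pos|apply cauchy_cont; auto].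
  destruct (phi_bounded phi Hphi) as [B [HB HB1]].
  (* Half the distance from [z] to the circle: points within [rho] of [z] keep distance [rho] from
     the circle. *)
  set (rho := (r - Cmod z) / 2). assert (Hrho : 0 < rho) by (unfold rho; lra).
  assert (Hfar : forall t w, Cmod (w - z) < rho -> rho <= Cmod (cir r t - w)).
  { intros t w Hw. assert (Hw' : Cmod w < r). { apply ball_in_disc with z. unfold rho in Hw. lra. }
    destruct (cir_far r w t Hr Hw'). assert (H1 := Cmod_triangle_rev w z). unfold rho in *. lra. }
  apply (dG_CInt (fun z : C => z) (fun z t => phi t * (/ (cir r t - z)) ^ n)%C
    (fun z t => INR n * (phi t * (/ (cir r t - z)) ^ S n))%C).
  - apply two_PI_pos.
  - exists rho. split; auto. intros y Hy. apply cauchy_cont; auto. apply ball_in_disc with z. unfold rho in Hy. lra.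
  - intros t Ht. apply cG_mult. apply cG_const. eapply cauchy_cont; eauto.
  - set (A := INR n * (INR (S n) * (/ rho) ^ S (S n)) * B + 1).
    assert (Hir : 0 < / rho) by (apply Rinv_0_lt_compat; auto).
    assert (HA : 0 < A).
    { unfold A. assert (0 <= INR n) by apply pos_INR. assert (0 <= INR (S n)) by apply pos_INR.
      assert (0 < (/ rho) ^ S (S n)) by (apply pow_lt; auto). set (pw := (/ rho) ^ S (S n)) in *.
      assert (0 <= INR n * (INR (S n) * pw) * B) by (apply Rmult_le_pos; [apply Rmult_le_pos; [|apply Rmult_le_pos]|]; lra). lra. }
    intros eps Heps. exists (Rmin rho (eps / A)). split. { apply Rmin_glb_lt; auto. apply Rdiv_lt_0_compat; auto. }
    intros w Hw t Ht. assert (Hw1 := Rlt_le_trans _ _ _ Hw (Rmin_l _ _)). assert (Hw2 := Rlt_le_trans _ _ _ Hw (Rmin_r _ _)).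
    replace (phi t * (/ (cir r t - w)) ^ n - phi t * (/ (cir r t - z)) ^ n - (w - z) * (INR n * (phi t * (/ (cir r t - z)) ^ S n)))%C
      with (phi t * ((/ (cir r t - w)) ^ n - (/ (cir r t - z)) ^ n - (w - z) * (INR n * (/ (cir r t - z)) ^ S n)))%C by ring.
    rewrite Cmod_mult.
    assert (Hneq : forall v, Cmod (v - z) < rho -> cir r t <> v).
    { intros v Hv Hv'. specialize (Hfar t v Hv). rewrite Hv' in Hfar. replace (v - v)%C with (RtoC 0) in Hfar by ring.
      rewrite Cmod_0 in Hfar. lra. }
    assert (E1 : forall v, Cmod (v - z) < rho -> Cmod (v - z) <= Cmod (w - z) ->
       Cmod ((/ (cir r t - v)) ^ S n - (/ (cir r t - z)) ^ S n) <= INR (S n) * (/ rho) ^ S (S n) * Cmod (w - z)).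
    { intros v Hv Hvw.
      replace ((/ (cir r t - v)) ^ S n - (/ (cir r t - z)) ^ S n)%C with
        ((/ (cir r t - v)) ^ S n - (/ (cir r t - z)) ^ S n - (v - z) * 0)%C by ring.
      apply Rle_trans with (INR (S n) * (/ rho) ^ S (S n) * Cmod (v - z)).
      - apply (dC_lipschitz_segment (fun v => (/ (cir r t - v)) ^ S n)%C (fun v => INR (S n) * (/ (cir r t - v)) ^ S (S n))%C).
        intros s Hs. assert (Hseg := Rle_lt_trans _ _ _ (segment_dist z v s Hs) Hv). split.
        + apply dC_inv_pow; auto.
        + replace (INR (S n) * (/ (cir r t - segment z v s)) ^ S (S n) - 0)%C with
            (INR (S n) * (/ (cir r t - segment z v s)) ^ S (S n))%C by ring.
          rewrite Cmod_RtoC_mult, Rabs_pos_eq by apply pos_INR. apply Rmult_le_compat_l. apply pos_INR.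
          apply Cmod_inv_pow_le; auto.
      - apply Rmult_le_compat_l; auto. apply Rmult_le_pos. apply pos_INR. left; apply pow_lt; auto. }
    assert (E2 : Cmod ((/ (cir r t - w)) ^ n - (/ (cir r t - z)) ^ n - (w - z) * (INR n * (/ (cir r t - z)) ^ S n)) <=
       INR n * (INR (S n) * (/ rho) ^ S (S n) * Cmod (w - z)) * Cmod (w - z)).
    { apply (dC_lipschitz_segment (fun v => (/ (cir r t - v)) ^ n)%C (fun v => INR n * (/ (cir r t - v)) ^ S n)%C).
      intros s Hs. assert (Hs1 := segment_dist z w s Hs). split.
      - apply dC_inv_pow. apply Hneq; lra.
      - replace (INR n * (/ (cir r t - segment z w s)) ^ S n - INR n * (/ (cir r t - z)) ^ S n)%C with
          (INR n * ((/ (cir r t - segment z w s)) ^ S n - (/ (cir r t - z)) ^ S n))%C by ring.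
        rewrite Cmod_RtoC_mult, Rabs_pos_eq by apply pos_INR. apply Rmult_le_compat_l. apply pos_INR.
        apply E1; lra. }
    apply Rle_trans with (B * (INR n * (INR (S n) * (/ rho) ^ S (S n) * Cmod (w - z)) * Cmod (w - z))).
    { apply Rmult_le_compat; auto using Cmod_ge_0. }
    replace (B * (INR n * (INR (S n) * (/ rho) ^ S (S n) * Cmod (w - z)) * Cmod (w - z))) with
      ((A - 1) * Cmod (w - z) * Cmod (w - z)) by (unfold A; ring).
    apply Rmult_le_compat_r. apply Cmod_ge_0.
    apply Rle_trans with (A * (eps / A)). 2: { right; field; lra. }
    assert (H0 := Cmod_ge_0 (w - z)). nra.
Qed.

Lemma CInt_cir_zero r : CInt (cir r) 0 (2 * PI) = 0.
Proof.
  rewrite (CInt_FTC (fun t => - Ci * cir r t)%C).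
  - rewrite cir_2PI. ring.
  - apply two_PI_pos.
  - intros t _. eapply dG_cG, dR_cir.
  - intros t _. eapply dG_eq. apply dG_scal. apply dR_cir.
    replace (- Ci * (Ci * cir r t))%C with (- (Ci * Ci) * cir r t)%C by ring.
    replace (Ci * Ci)%C with (RtoC (-1)) by (apply C_ext; simpl; ring).
    apply C_ext; simpl; ring.
Qed.

Lemma Ci_sqr : (Ci * Ci)%C = RtoC (-1).
Proof. apply C_ext; simpl; ring. Qed.

(** At the centre the integrand is 1. Away from it nothing changes, because the derivative in [z]
    integrates the exact differential of [i / (zeta - v)] over a closed curve. *)
Lemma cauchy_one r z : 0 < r -> Cmod z < r -> cauchy r (cir r) 1 z = RtoC (2 * PI).
Proof.
  intros Hr Hz.
  assert (Hcir : forall t, cR (cir r) t) by (intros t; eapply dG_cG, dR_cir).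
  assert (H0 : cauchy r (cir r) 1 0 = RtoC (2 * PI)).
  { unfold cauchy. rewrite (CInt_ext _ (fun t => RtoC 1)).
    - rewrite (CInt_FTC RtoC (fun _ => RtoC 1)). rewrite <- RtoC_minus. f_equal. ring.
      apply two_PI_pos. intros t _. apply cG_const. intros t _. apply dG_param.
    - apply two_PI_pos.
    - intros t _. assert (H := cir_neq r 0 t Hr ltac:(rewrite Cmod_0; auto)).
      simpl. replace (cir r t - 0)%C with (cir r t) in * by ring. field. auto. }
  rewrite <- H0. apply Cmod_le_eps_eq. intros eps Heps.
  replace (cauchy r (cir r) 1 z - cauchy r (cir r) 1 0)%C with
    (cauchy r (cir r) 1 z - cauchy r (cir r) 1 0 - (z - 0) * 0)%C by ring.
  apply Rle_trans with (0 * Cmod (z - 0)); [|lra].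
  apply dC_lipschitz_segment with (fun z => INR 1 * cauchy r (cir r) 2 z)%C. intros s Hs.
  assert (Hs' : Cmod (segment 0 z s) < r).
  { assert (H := segment_dist 0 z s Hs). replace (segment 0 z s - 0)%C with (segment 0 z s) in H by ring.
    replace (z - 0)%C with z in H by ring. lra. }
  split. apply dC_cauchy; auto. set (v := segment 0 z s) in *.
  assert (E : cauchy r (cir r) 2 v = 0).
  { unfold cauchy. rewrite (CInt_FTC (fun t => Ci * (/ (cir r t - v)))%C).
    - rewrite cir_2PI. ring.
    - apply two_PI_pos.
    - apply cauchy_cont; auto.
    - intros t _. assert (Hn := cir_neq r v t Hr Hs'). eapply dG_eq. apply dG_scal. apply dG_inv. exact Hn.
      apply dG_minus. apply dR_cir. apply dG_const. simpl.
      transitivity (- (Ci * Ci) * cir r t / ((cir r t - v) * (cir r t - v)))%C. field. auto.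
      rewrite Ci_sqr. replace (- RtoC (-1))%C with (RtoC 1) by (apply C_ext; simpl; ring). field. auto. }
  rewrite E. replace (INR 1 * 0 - 0)%C with (RtoC 0) by ring. rewrite Cmod_0. lra.
Qed.

Lemma contD_on_cir f r : contD f -> 0 < r < 1 -> forall t, cR (fun t => f (cir r t)) t.
Proof.
  intros Hf Hr t. apply (cG_comp RtoC f (cir r)). eapply dG_cG, dR_cir. apply Hf. rewrite Cmod_cir; lra.
Qed.

(** The circle is contracted to [z] along [P l t = z + l (cir r t - z)]. The derivative in [l] of
    the integral is [A1 l], the integral of an exact differential over a closed curve, hence 0. The
    contracted integral [A 0] is [f z] times [cauchy_one]. *)
Lemma cauchy_formula f f1 r z : derivD f f1 -> contD f1 -> 0 < r < 1 -> Cmod z < r ->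
  cauchy r (fun t => f (cir r t) * cir r t)%C 1 z = (2 * PI * f z)%C.
Proof.
  intros Hf Hf1 Hr Hz. assert (Hcf := derivD_contD f f1 Hf).
  assert (Hzr : forall t, (cir r t - z)%C <> 0) by (intros t; apply cir_neq; lra).
  set (P := fun (l t : R) => (z + l * (cir r t - z))%C).
  assert (HP : forall l t, 0 <= l <= 1 -> Cmod (P l t) <= r).
  { intros l t Hl. replace (P l t) with (segment z (cir r t) l - 0)%C by (unfold P, segment; ring).
    apply segment_ball; auto. replace (z - 0)%C with z by ring; lra.
    replace (cir r t - 0)%C with (cir r t) by ring. rewrite Cmod_cir; lra. }
  assert (HPd : forall l l' t, (P l' t - P l t)%C = ((l' - l) * (cir r t - z))%C) by (intros; unfold P; ring).
  assert (Hdist : forall t, Cmod (cir r t - z) <= 2).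
  { intros t. assert (H := Cmod_minus_le (cir r t) z). rewrite Cmod_cir in H; lra. }
  assert (HPc : forall l t, cR (P l) t).
  { intros l t. eapply dG_cG. unfold P. apply dG_plus. apply dG_const. apply dG_scal. apply dG_minus. apply dR_cir. apply dG_const. }
  set (A := fun l => CInt (fun t => f (P l t) * (cir r t * / (cir r t - z)))%C 0 (2 * PI)).
  set (A1 := fun l => CInt (fun t => f1 (P l t) * cir r t)%C 0 (2 * PI)).
  assert (Hkc : forall t, cR (fun t => cir r t * / (cir r t - z))%C t).
  { intros t. apply cG_mult. eapply dG_cG, dR_cir. apply cG_inv; auto.
    eapply dG_cG. apply dG_minus. apply dR_cir. apply dG_const. }
  assert (HA : forall l, 0 <= l <= 1 -> dR A l (A1 l)).
  { intros l Hl. apply (dG_CInt RtoC (fun l t => f (P l t) * (cir r t * / (cir r t - z)))%C (fun l t => f1 (P l t) * cir r t)%C).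
    - apply two_PI_pos.
    - exists ((1 - r) / 4). split. lra. intros l' Hl' t _. apply cG_mult; auto.
      apply (cG_comp RtoC f (P l')); auto. apply Hcf.
      assert (H := Cmod_triangle_rev (P l' t) (P l t)). rewrite HPd, Cmod_mult in H.
      specialize (HP l t Hl). specialize (Hdist t). assert (H0 := Cmod_ge_0 (l' - l)).
      assert (H1 := Cmod_ge_0 (cir r t - z)). nra.
    - intros t _. apply cG_mult. 2: eapply dG_cG, dR_cir.
      apply (cG_comp RtoC f1 (P l)); auto. apply Hf1. specialize (HP l t Hl). lra.
    - intros eps Heps. destruct (derivD_unif f f1 r eps Hf Hf1) as [m [Hm H]]; try lra.
      exists (m / 2). split. lra. intros l' Hl' t _.
      replace (f (P l' t) * (cir r t * / (cir r t - z)) - f (P l t) * (cir r t * / (cir r t - z)) - (l' - l) * (f1 (P l t) * cir r t))%C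
        with ((f (P l' t) - f (P l t) - (P l' t - P l t) * f1 (P l t)) * (cir r t * / (cir r t - z)))%C.
      2: { rewrite HPd. field. auto. }
      assert (Hc0 := Cmod_gt_0 (cir r t - z)). assert (Hc1 := proj1 Hc0 (Hzr t)). clear Hc0.
      rewrite !Cmod_mult, Cmod_inv, Cmod_cir by (auto; lra).
      assert (E := H (P l t) (HP l t Hl) (P l' t)). rewrite HPd, Cmod_mult in E.
      assert (H0 := Cmod_ge_0 (l' - l)). specialize (Hdist t).
      specialize (E ltac:(nra)). rewrite <- HPd in E.
      apply Rle_trans with (eps * (Cmod (l' - l) * Cmod (cir r t - z)) * (r * / Cmod (cir r t - z))).
      + apply Rmult_le_compat_r; auto. left. apply Rmult_lt_0_compat. lra. apply Rinv_0_lt_compat; auto.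
      + replace (eps * (Cmod (l' - l) * Cmod (cir r t - z)) * (r * / Cmod (cir r t - z))) with (eps * Cmod (l' - l) * r) by (field; lra).
        assert (0 <= eps * Cmod (l' - l)) by (apply Rmult_le_pos; lra). nra. }
  assert (HA1 : forall l, 0 <= l <= 1 -> A1 l = 0).
  { intros l Hl. unfold A1. destruct (Req_dec l 0) as [->|Hl0].
    - rewrite (CInt_ext _ (fun t => f1 z * cir r t)%C).
      + rewrite CInt_scal. rewrite CInt_cir_zero. ring. apply two_PI_pos. intros t _. eapply dG_cG, dR_cir.
      + apply two_PI_pos.
      + intros t _. unfold P. do 2 f_equal. ring.
    - assert (Hl0' : RtoC l <> 0) by (intros E; apply RtoC_inj in E; auto).
      rewrite (CInt_FTC (fun t => (- Ci * / l) * f (P l t))%C).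
      + unfold P. rewrite cir_2PI. ring.
      + apply two_PI_pos.
      + intros t _. apply cG_mult. 2: eapply dG_cG, dR_cir.
        apply (cG_comp RtoC f1 (P l)); auto. apply Hf1. specialize (HP l t Hl). lra.
      + intros t _. eapply dG_eq. apply dG_scal. apply (dG_comp RtoC f (P l)).
        * unfold P. apply dG_plus. apply dG_const. apply dG_scal. apply dG_minus. apply dR_cir. apply dG_const.
        * apply Hf. specialize (HP l t Hl). lra.
        * simpl. transitivity (- (Ci * Ci) * (f1 (P l t) * cir r t))%C. field. auto. rewrite Ci_sqr.
          apply C_ext; simpl; ring. }
  assert (E : A 1 = A 0).
  { apply Cmod_le_eps_eq. intros eps Heps. apply Rle_trans with (0 * (1 - 0)); [|lra].
    apply (dR_lipschitz A A1). lra. intros l Hl. split; auto. rewrite HA1, Cmod_0; lra. }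
  transitivity (A 1).
  { unfold A, cauchy. apply CInt_ext. apply two_PI_pos. intros t _. unfold P.
    replace (z + 1 * (cir r t - z))%C with (cir r t) by ring. simpl. ring. }
  rewrite E. rewrite <- RtoC_mult. rewrite <- (cauchy_one r z) by lra. unfold cauchy. rewrite Cmult_comm, <- CInt_scal.
  - apply CInt_ext. apply two_PI_pos. intros t _. unfold P. replace (z + 0 * (cir r t - z))%C with z by ring. simpl. ring.
  - apply two_PI_pos.
  - apply cauchy_cont; try lra. intros t. eapply dG_cG, dR_cir.
Qed.

Lemma CPI_neq_0 : RtoC PI <> 0.
Proof. intros H. apply RtoC_inj in H. assert (H0 := PI_RGT_0). lra. Qed.

Lemma dC_cauchy_int f f1 r z : derivD f f1 -> contD f1 -> 0 < r < 1 -> Cmod z < r ->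
  f1 z = (/ (2 * PI) * cauchy r (fun t => f (cir r t) * cir r t)%C 2 z)%C.
Proof.
  intros Hf Hf1 Hr Hz.
  assert (Hphi : forall t, cR (fun t => f (cir r t) * cir r t)%C t).
  { intros t. apply cG_mult. apply contD_on_cir; auto. eapply derivD_contD; eauto. eapply dG_cG, dR_cir. }
  apply (dC_unique f z). apply Hf; lra.
  apply dG_ext_loc with (f := fun z => (/ (2 * PI) * cauchy r (fun t => f (cir r t) * cir r t)%C 1 z)%C) (d := r - Cmod z). lra.
  - intros y Hy. rewrite (cauchy_formula f f1); auto. field. apply CPI_neq_0. apply ball_in_disc with z; auto.
  - eapply dG_eq. apply dG_scal. apply dC_cauchy; auto. lra. simpl. ring.
Qed.

Lemma Hol_deriv f f1 : derivD f f1 -> contD f1 -> Hol f1.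
Proof.
  intros Hf Hf1. apply Hol_local. intros r Hr.
  set (phi := fun t => (f (cir r t) * cir r t)%C).
  assert (Hphi : forall t, cR phi t).
  { intros t. apply cG_mult. apply contD_on_cir; auto. eapply derivD_contD; eauto. eapply dG_cG, dR_cir. }
  exists (fun z => / (2 * PI) * cauchy r phi 2 z)%C, (fun z => / (2 * PI) * (INR 2 * cauchy r phi 3 z))%C.
  intros z Hz. split; [|split].
  - apply (dC_cauchy_int f f1 r z); auto.
  - apply dG_scal. apply dC_cauchy; auto. lra.
  - apply cG_mult. apply cG_const. apply cG_mult. apply cG_const. eapply dG_cG. apply dC_cauchy; auto. lra.
Qed.

Lemma Hol_const c : Hol (fun _ => c).
Proof. exists (fun _ => 0). split. intros z _. apply dG_const. intros z _. apply cG_const. Qed.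

Lemma Hol_id : Hol (fun z => z).
Proof. exists (fun _ => 1). split. intros z _. apply dG_param. intros z _. apply cG_const. Qed.

Lemma Hol_plus f g : Hol f -> Hol g -> Hol (fun z => f z + g z)%C.
Proof.
  intros [f1 [Hf Hf1]] [g1 [Hg Hg1]]. exists (fun z => f1 z + g1 z)%C. split; intros z Hz.
  apply dG_plus; auto. apply cG_plus; auto.
Qed.

Lemma Hol_mult f g : Hol f -> Hol g -> Hol (fun z => f z * g z)%C.
Proof.
  intros [f1 [Hf Hf1]] [g1 [Hg Hg1]]. exists (fun z => f1 z * g z + f z * g1 z)%C. split; intros z Hz.
  - apply dG_mult; auto.
  - apply cG_plus; apply cG_mult; auto; eapply derivD_contD; eauto.
Qed.

Lemma Hol_inv f : Hol f -> (forall z, Cmod z < 1 -> f z <> 0) -> Hol (fun z => / f z)%C.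
Proof.
  intros [f1 [Hf Hf1]] H0. exists (fun z => - f1 z * / (f z * f z))%C. assert (Hc := derivD_contD _ _ Hf). split; intros z Hz.
  - apply dG_inv; auto.
  - apply cG_mult. replace (fun y => (- f1 y)%C) with (fun y => (-1) * f1 y)%C.
    apply cG_mult; auto. apply cG_const.
    apply FunctionalExtensionality.functional_extensionality. intros y. apply C_ext; simpl; ring.
    apply cG_inv. apply Cmult_neq_0; auto. apply cG_mult; auto.
Qed.

Lemma Hol_div f g : Hol f -> Hol g -> (forall z, Cmod z < 1 -> g z <> 0) -> Hol (fun z => f z / g z)%C.
Proof. intros. apply Hol_mult; auto. apply Hol_inv; auto. Qed.

Lemma Hol_derivative f f1 : Hol f -> derivD f f1 -> Hol f1.
Proof.
  intros [g [Hg Hg1]] Hf. apply Hol_deriv with f; auto. intros z Hz eps Heps.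
  destruct (Hg1 z Hz eps Heps) as [d [Hd H]]. exists (Rmin d (1 - Cmod z)). split. apply Rmin_glb_lt; lra.
  intros y Hy. rewrite (dC_unique f y (f1 y) (g y)), (dC_unique f z (f1 z) (g z)); auto.
  - apply H. apply Rlt_le_trans with (1 := Hy), Rmin_l.
  - apply Hf. apply ball_in_disc with z. apply Rlt_le_trans with (1 := Hy), Rmin_r.
  - apply Hg. apply ball_in_disc with z. apply Rlt_le_trans with (1 := Hy), Rmin_r.
Qed.

(** From [zeta / (zeta - z) = 1 + z / (zeta - z)]: in Cauchy's formula the first summand integrates
    to [2 pi f(0) = 0], and the second exhibits [f z / z] as a Cauchy integral, holomorphic also at
    0. *)
Lemma Hol_divide_z (f : C -> C) : Hol f -> f 0 = 0 -> exists e : C -> C, Hol e /\ forall z, Cmod z < 1 -> f z = (z * e z)%C.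
Proof.
  intros [f1 [Hf Hf1]] Hf0. assert (Hc := derivD_contD _ _ Hf).
  assert (Hz : forall r z, 0 < r < 1 -> Cmod z < r -> f z = (z * (/ (2 * PI) * cauchy r (fun t => f (cir r t)) 1 z))%C).
  { intros r z Hr Hz. assert (Hcc := contD_on_cir f r Hc Hr).
    assert (Hci : forall t, cR (cir r) t) by (intros t; eapply dG_cG, dR_cir).
    assert (Hn := CPI_neq_0).
    assert (E : (2 * PI * f z)%C = (CInt (fun t => f (cir r t)) 0 (2 * PI) + z * cauchy r (fun t => f (cir r t)) 1 z)%C).
    { rewrite <- (cauchy_formula f f1 r z); auto. unfold cauchy. rewrite <- CInt_scal, <- CInt_plus.
      - apply CInt_ext. apply two_PI_pos. intros t _. assert (H := cir_neq r z t (proj1 Hr) Hz). simpl. field. auto.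
      - apply two_PI_pos.
      - intros t _. auto.
      - intros t Ht. apply cG_mult. apply cG_const. apply (cauchy_cont r (fun t => f (cir r t)) 1 z); auto. lra.
      - apply two_PI_pos.
      - apply (cauchy_cont r (fun t => f (cir r t)) 1 z); auto. lra. }
    assert (E0 : CInt (fun t => f (cir r t)) 0 (2 * PI) = 0).
    { transitivity (2 * PI * f 0)%C. 2: rewrite Hf0; ring.
      rewrite <- (cauchy_formula f f1 r 0); auto. unfold cauchy. apply CInt_ext. apply two_PI_pos.
      intros t _. assert (H := cir_neq r 0 t (proj1 Hr) ltac:(rewrite Cmod_0; lra)).
      simpl. replace (cir r t - 0)%C with (cir r t) in * by ring. field. auto. rewrite Cmod_0; lra. }
    rewrite E0 in E. replace (f z) with (/ (2 * PI) * (2 * PI * f z))%C by (field; auto). rewrite E. ring. }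
  exists (fun z => if Ceq_dec z 0 then f1 0 else f z / z)%C. split.
  - apply Hol_local. intros r Hr. assert (Hcc := contD_on_cir f r Hc Hr).
    exists (fun z => / (2 * PI) * cauchy r (fun t => f (cir r t)) 1 z)%C,
      (fun z => / (2 * PI) * (INR 1 * cauchy r (fun t => f (cir r t)) 2 z))%C.
    assert (Hd : forall z, Cmod z < r -> dC (fun z => / (2 * PI) * cauchy r (fun t => f (cir r t)) 1 z)%C z
       (/ (2 * PI) * (INR 1 * cauchy r (fun t => f (cir r t)) 2 z))%C).
    { intros z Hzr. apply dG_scal. apply dC_cauchy; auto. lra. }
    intros z Hzr. split; [|split; auto].
    + destruct (Ceq_dec z 0) as [->|Hz0].
      * apply (dC_unique f 0). apply Hf. rewrite Cmod_0; lra.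
        apply dG_ext_loc with (f := fun z => (z * (/ (2 * PI) * cauchy r (fun t => f (cir r t)) 1 z))%C) (d := r). lra.
        { intros y Hy. symmetry. apply Hz; auto. replace y with (y - 0)%C by ring. auto. }
        eapply dG_eq. apply dG_mult. apply dG_param. apply Hd. rewrite Cmod_0; lra. simpl. ring.
      * rewrite (Hz r z) at 1; auto. field. split; auto. apply CPI_neq_0.
    + apply cG_mult. apply cG_const. apply cG_mult. apply cG_const. eapply dG_cG. apply dC_cauchy; auto. lra.
  - intros z Hz1. destruct (Ceq_dec z 0) as [->|Hz0]. rewrite Hf0. ring. field. auto.
Qed.

Lemma Hol_primitive m : Hol m -> exists l : C -> C, l 0 = 0 /\ derivD l m.
Proof.
  intros [m1 [Hm Hm1]]. assert (Hc := derivD_contD _ _ Hm).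
  exists (fun z => z * CInt (fun t => m (t * z)) 0 1)%C. split. ring.
  intros z Hz.
  assert (Hlin : forall (y : C) t, cR (fun t => t * y)%C t).
  { intros y t. eapply dG_cG. apply dG_mult. apply dG_param. apply dG_const. }
  assert (Htz : forall (y : C) t, 0 <= t <= 1 -> Cmod (t * y) <= Cmod y).
  { intros y t Ht. rewrite Cmod_RtoC_mult, Rabs_pos_eq by lra. assert (H := Cmod_ge_0 y). nra. }
  assert (Hcm : forall y, Cmod y < 1 -> cont_on (fun t => m (t * y)%C) 0 1).
  { intros y Hy t Ht. apply (cG_comp RtoC m (fun t => t * y)%C); auto. apply Hc. specialize (Htz y t Ht). lra. }
  assert (Hcm1 : cont_on (fun t => t * m1 (t * z))%C 0 1).
  { intros t Ht. apply cG_mult. eapply dG_cG, dG_param. apply (cG_comp RtoC m1 (fun t => t * z)%C); auto.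
    apply Hm1. specialize (Htz z t Ht). lra. }
  eapply dG_eq.
  - apply dG_mult. apply dG_param.
    apply (dG_CInt (fun z : C => z) (fun z t => m (t * z)%C) (fun z t => t * m1 (t * z))%C z 0 1). lra.
    + exists (1 - Cmod z). split. lra. intros y Hy. apply Hcm. apply ball_in_disc with z. auto.
    + exact Hcm1.
    + intros eps Heps. destruct (derivD_unif m m1 (Cmod z) eps Hm Hm1 Hz Heps) as [d [Hd H]].
      exists d. split; auto. intros y Hy t Ht.
      assert (E := H (t * z)%C (Htz z t Ht) (t * y)%C). replace (t * y - t * z)%C with (t * (y - z))%C in E by ring.
      assert (E0 := Htz (y - z)%C t Ht).
      specialize (E ltac:(lra)).
      replace (m (t * y) - m (t * z) - (y - z) * (t * m1 (t * z)))%C with (m (t * y) - m (t * z) - t * (y - z) * m1 (t * z))%C by ring.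
      apply Rle_trans with (1 := E). apply Rmult_le_compat_l; lra.
  (* The derivative is the integral of [m(tz) + t z m'(tz)], which is the derivative in [t] of
     [t m(tz)]. *)
  - cbv beta. rewrite Cmult_1_l. rewrite <- CInt_scal, <- CInt_plus; try lra; auto.
    + rewrite (CInt_FTC (fun t => t * m (t * z))%C).
      * replace (1 * z)%C with z by ring. ring.
      * lra.
      * intros t Ht. apply cG_plus. apply Hcm; auto. apply cG_mult. apply cG_const. apply Hcm1; auto.
      * intros t Ht. eapply dG_eq. apply dG_mult. apply dG_param. apply (dG_comp RtoC m (fun t => t * z)%C).
        apply dG_mult. apply dG_param. apply dG_const. apply Hm. specialize (Htz z t Ht). lra. simpl. ring.
    + intros t Ht. apply cG_mult. apply cG_const. apply Hcm1; auto.
Qed.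

Lemma Hol_log (e e1 : C -> C) : Hol e -> derivD e e1 -> (forall z, Cmod z < 1 -> e z <> 0) -> e 0 = 1 ->
  exists l : C -> C, l 0 = 0 /\ derivD l (fun z => e1 z / e z)%C /\ forall z, Cmod z < 1 -> Cexp (l z) = e z.
Proof.
  intros He He1 Hne H0.
  destruct (Hol_primitive (fun z => e1 z / e z)%C) as [l [Hl0 Hl]].
  { apply Hol_div; auto. apply Hol_derivative with e; auto. }
  exists l. split; auto. split; auto. intros z Hz.
  assert (Hn := Cexp_neq_0 (l z)).
  assert (E := derivD_zero_const (fun z => e z * Cexp (- l z))%C).
  assert (E1 : (e z * Cexp (- l z))%C = (e 0 * Cexp (- l 0))%C).
  { apply E; auto. intros w Hw. eapply dG_eq. apply dG_mult. apply He1; auto.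
    apply (dG_comp _ Cexp (fun z => - l z)%C). apply dG_opp. apply Hl; auto. apply dC_Cexp. simpl. field. apply Hne; auto. }
  rewrite H0, Hl0 in E1. replace (- 0)%C with (RtoC 0) in E1 by ring. rewrite Cexp_0, Cexp_opp in E1.
  replace (e z) with (e z * / Cexp (l z) * Cexp (l z))%C by (field; auto). rewrite E1. ring.
Qed.

(** * The hypotheses in terms of holomorphic data *)

Lemma has_cderiv_dC (f : C -> C) (z L : C) : has_cderiv f z L -> dC f z L.
Proof.
  intros H eps Heps. destruct (H eps Heps) as [d [Hd H1]]. exists d. split; auto. intros w Hw.
  destruct (Ceq_dec w z) as [->|Hwz].
  - replace (f z - f z - (z - z) * L)%C with (RtoC 0) by ring. rewrite Cmod_0.
    apply Rmult_le_pos. lra. apply Cmod_ge_0.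
  - assert (Hh : (w - z)%C <> 0) by (intros E; apply Hwz, Cminus_eq0, E).
    assert (E := H1 (w - z)%C Hh Hw).
    change (Cmod ((f (z + (w - z))%C - f z) / (w - z) - L) < eps) in E.
    replace (z + (w - z))%C with w in E by ring.
    replace (f w - f z - (w - z) * L)%C with (((f w - f z) / (w - z) - L) * (w - z))%C by (field; auto).
    rewrite Cmod_mult. apply Rmult_le_compat_r. apply Cmod_ge_0. lra.
Qed.

(** Were [d] too large, the boundary behaviour of [s z eta'(z)] would force the imaginary part of a
    rotation of [s eta] to increase strictly along a whole circle. *)
Lemma boundary_value_bound (a M : R) (s d : C) (eta eta1 : C -> C) : 0 < a -> derivD eta eta1 ->
  (forall z, Cmod z < 1 ->
     Cmod ((Cmod z ^ 2)%R * d + (1 - Cmod z ^ 2)%R * (s - a * (1 + s * z * eta1 z)))%C <= M) ->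
  Cmod d <= M.
Proof.
  intros Ha He HX. apply Rnot_lt_le. intros Hd.
  assert (HM : 0 <= M). { apply Rle_trans with (2 := HX 0 ltac:(rewrite Cmod_0; lra)). apply Cmod_ge_0. }
  set (S := Cmod (s - a)). assert (HS : 0 <= S) by apply Cmod_ge_0.
  (* [x0] is the value of [|z|^2] at which [x |d| - (1 - x) S] equals [M]. Half-way from there to 1
     the excess over [M] is a positive [m]. *)
  set (x0 := (S + M) / (Cmod d + S)). assert (Hx0 : 0 <= x0 < 1).
  { unfold x0. split. apply Rdiv_le_0_compat; lra. apply Rlt_div_l; lra. }
  set (x := (1 + x0) / 2). set (m := x * Cmod d - (1 - x) * S - M).
  assert (Hm : 0 < m).
  { unfold m, x. assert (E : x0 * (Cmod d + S) = S + M) by (unfold x0; field; lra). nra. }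
  assert (Hx : 1 / 2 <= x < 1) by (unfold x; lra).
  set (r := sqrt x). assert (Hr2 : r * r = x) by (apply sqrt_sqrt; lra).
  assert (Hr : 0 < r < 1). { assert (0 < r) by (apply sqrt_lt_R0; lra). nra. }
  destruct (unit_dir d) as [e [He1 He2]].
  set (m0 := m / ((1 - x) * a)). assert (Hm0 : 0 < m0) by (apply Rdiv_lt_0_compat; nra).
  set (phi := fun t => fst e * snd (s * eta (cir r t))%C - snd e * fst (s * eta (cir r t))%C).
  assert (Hder : forall t, dR (fun t => s * eta (cir r t))%C t (s * (Ci * cir r t * eta1 (cir r t)))%C).
  { intros t. apply dG_scal. eapply dG_eq. apply (dG_comp RtoC eta (cir r)). apply dR_cir. apply He. rewrite Cmod_cir; lra. reflexivity. }
  set (phi1 := fun t => fst e * snd (s * (Ci * cir r t * eta1 (cir r t)))%C - snd e * fst (s * (Ci * cir r t * eta1 (cir r t)))%C).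
  assert (Hphi : forall t, is_derive phi t (phi1 t)).
  { intros t. destruct (dR_components _ _ _ (Hder t)) as [D1 D2]. unfold phi, phi1.
    apply (is_derive_minus (V := R_NormedModule)).
    apply is_derive_scal with (f := fun t => snd (s * eta (cir r t))%C); auto.
    apply is_derive_scal with (f := fun t => fst (s * eta (cir r t))%C); auto. }
  assert (Hpos : forall t, m0 <= phi1 t).
  { intros t. set (z := cir r t). assert (Hz : Cmod z = r) by (apply Cmod_cir; lra).
    assert (E := HX z ltac:(lra)). replace (Cmod z ^ 2) with x in E by (rewrite Hz; simpl; lra).
    set (Y := (s * z * eta1 z)%C) in *.
    assert (E1 : phi1 t = fst e * fst Y + snd e * snd Y). { unfold phi1. fold z. unfold Y. simpl. ring. }
    assert (E3 := Rle_trans _ _ _ (dot_le_Cmod e _ He1) E).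
    replace (x * d + (1 - x)%R * (s - a * (1 + Y)))%C with (x * d + (1 - x)%R * (s - a) - ((1 - x) * a)%R * Y)%C in E3.
    2: { rewrite RtoC_mult. ring. }
    assert (E4 := dot_le_Cmod e (- (s - a)) He1). rewrite Cmod_opp in E4. fold S in E4.
    set (q := fst e * fst (s - a)%C + snd e * snd (s - a)%C) in *.
    assert (E5 : x * Cmod d + (1 - x) * q - (1 - x) * a * (fst e * fst Y + snd e * snd Y) <= M).
    { eapply Rle_trans; [right|exact E3]. rewrite <- He2. unfold q. simpl. ring. }
    assert (E6 : - q <= S). { eapply Rle_trans; [right|exact E4]. unfold q. simpl. ring. }
    rewrite E1. apply Rle_div_l. nra. unfold m. nra. }
  assert (E : phi 0 - m0 * 0 <= phi (2 * PI) - m0 * (2 * PI)).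
  { apply (nondecreasing_of_derive (fun t => phi t - m0 * t) (fun t => phi1 t - m0)). apply two_PI_pos.
    - intros t _. split. apply (is_derive_minus (V := R_NormedModule)); auto.
      apply is_derive_linear.
      specialize (Hpos t). lra.
    - intros t _. apply continuity_pt_minus. apply derivable_continuous_pt. exists (phi1 t). apply is_derive_Reals; auto.
      apply derivable_continuous_pt, derivable_pt_scal, derivable_pt_id. }
  assert (E' : phi (2 * PI) = phi 0) by (unfold phi; rewrite cir_2PI; reflexivity).
  assert (H := PI_RGT_0). nra.
Qed.

(** Bernoulli's inequality for exponents at most 1. In [level_bound] it yields [a * th <= 1]. *)
Lemma Rpower_le_affine (y a : R) : 0 < y -> 0 < a <= 1 -> Rpower y a <= 1 + a * (y - 1).
Proof.
  intros Hy Ha. unfold Rpower. set (u := a * ln y).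
  assert (Ey : y = exp u * exp (u / a - u)).
  { rewrite <- exp_plus. replace (u + (u / a - u)) with (ln y) by (unfold u; field; lra). rewrite exp_ln; auto. }
  assert (H1 := exp_ineq1_le (u / a - u)). assert (H2 := exp_ineq1_le (- u)). assert (H3 := exp_pos u).
  assert (H4 : exp u * exp (- u) = 1). { rewrite <- exp_plus, Rplus_opp_r. apply exp_0. }
  assert (H5 : exp u * (1 - u) <= 1) by nra.
  assert (H6 : a * y >= exp u * (a + u - a * u)).
  { rewrite Ey. apply Rle_ge. apply Rle_trans with (a * (exp u * (1 + (u / a - u)))).
    - right. field. lra.
    - apply Rmult_le_compat_l. lra. apply Rmult_le_compat_l; lra. }
  nra.
Qed.

(** The counterpart for exponents at least 1; in [level_bound] it yields [th <= 1]. *)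
Lemma Rpower_le_self (y a : R) : 0 < y <= 1 -> 1 <= a -> Rpower y a <= y.
Proof.
  intros Hy Ha. unfold Rpower. rewrite <- (exp_ln y) at 2 by lra.
  assert (H : ln y <= 0). { rewrite <- ln_1. destruct (Req_dec y 1) as [->|Hy1]. lra. left. apply ln_increasing; lra. }
  destruct (Req_dec (a * ln y) (ln y)) as [->|Hne]. lra. left. apply exp_increasing. nra.
Qed.

(** The bound is transferred from [|z|^2] to the level [1/(1+T)] of the Loewner chain: with
    [theta = T / ((1 + T) (1 - |w|^2))] the quantity below is, up to the factor [-(1 + T)], equal to
    [theta * X + (1 - theta) * (s + c)]. *)
Lemma level_bound (a k : R) (s c X E : C) (x T : R) : 0 < a -> 0 <= k < 1 -> 0 <= T -> 0 <= x < 1 ->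
  x <= Rpower (1 + T) (- a) ->
  X = (x * (s + c) + (1 - x)%R * (s - a * E))%C ->
  Cmod X <= bound_M a k s c -> Cmod (s + c) <= bound_M a k s c ->
  Cmod (a * T * E - c - s * (1 + T)) <= k * Cmod s * (1 + T).
Proof.
  intros Ha Hk HT Hx HxT HXe HX Hd. set (d := (s + c)%C) in *.
  assert (Hd0 := Cmod_ge_0 d). assert (Hs0 := Cmod_ge_0 s).
  set (th := T / ((1 + T) * (1 - x))).
  assert (Hth0 : 0 <= th) by (apply Rdiv_le_0_compat; nra).
  assert (E0 : (a * T * E - c - s * (1 + T))%C = (- (1 + T)%R * (th * X + (1 - th)%R * d))%C).
  { rewrite HXe. unfold th, d. rewrite !RtoC_minus, RtoC_div, RtoC_mult, !RtoC_minus, !RtoC_plus. field. split.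
    - change (RtoC 1 - x <> 0)%C. rewrite <- RtoC_minus. intros H. apply RtoC_inj in H. lra.
    - change (RtoC 1 + T <> 0)%C. rewrite <- RtoC_plus. intros H. apply RtoC_inj in H. lra.
    - nra. }
  rewrite E0, Cmod_mult, Cmod_opp, Cmod_R, Rabs_pos_eq by lra.
  rewrite Rmult_comm. apply Rmult_le_compat_r. lra.
  set (y := / (1 + T)). assert (Hy : 0 < y <= 1).
  { unfold y. split. apply Rinv_0_lt_compat; lra. rewrite <- Rinv_1. apply Rinv_le_contravar; lra. }
  assert (Hxy : x <= Rpower y a).
  { replace (Rpower y a) with (Rpower (1 + T) (- a)); auto. unfold Rpower, y. rewrite ln_Rinv by lra. f_equal. ring. }
  assert (Hth : th * (1 - x) = 1 - y). { unfold th, y. field. lra. }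
  apply Rle_trans with (1 := Cmod_triangle _ _). rewrite !Cmod_RtoC_mult, (Rabs_pos_eq th) by auto.
  unfold bound_M in HX, Hd. change (Cnorm s) with (Cmod s) in *. change (Cnorm (Cadd s c)) with (Cmod d) in *.
  destruct (Rle_dec a 1) as [Ha1|Ha1].
  - assert (Hth2 : a * th <= 1). { assert (H := Rpower_le_affine y a (proj1 Hy) (conj Ha Ha1)). nra. }
    assert (Hks : Cmod X <= a * k * Cmod s - (1 - a) * Cmod d) by (eapply Rle_trans; [exact HX|lra]).
    destruct (Rle_dec th 1) as [H1|H1].
    + rewrite Rabs_pos_eq by lra.
      assert (a * k * Cmod s <= k * Cmod s) by (apply Rmult_le_compat_r; nra).
      assert (0 <= k * Cmod s) by nra. assert (0 <= (1 - a) * Cmod d) by nra. nra.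
    (* With [th > 1] the sum is at most [th |X| + (th - 1) |d| <= a th k |s| + (a th - 1) |d|],
       hence at most [k |s|]. The term [(a - 1) |s + c|] of the bound [M] pays exactly for the
       negative weight [1 - th]. *)
    + rewrite Rabs_left by lra. assert (0 <= k * Cmod s) by nra. nra.
  - assert (H := Rpower_le_self y a Hy ltac:(lra)).
    assert (Hth1 : th <= 1) by nra. rewrite Rabs_pos_eq by lra.
    nra.
Qed.

(** [p = z f' / f], [E = s (1 + z f'' / f') + (1 - s) p], [lam = log (f / z)], [nu = log f'] and
    [eta = nu + (1 / s - 1) lam]. *)
Record chain (a b k : R) (c : C) (f : C -> C) : Type := Chain {
  ch_a : 0 < a;
  ch_k : 0 <= k < 1;
  cf1 : C -> C; cp : C -> C; cp1 : C -> C; cE : C -> C; cE1 : C -> C;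
  clam : C -> C; clam1 : C -> C; cnu : C -> C; ceta : C -> C; ceta1 : C -> C;
  f_deriv : derivD f cf1;
  f1_cont : contD cf1;
  p_deriv : derivD cp cp1;
  p1_cont : contD cp1;
  E_deriv : derivD cE cE1;
  E1_cont : contD cE1;
  lam_deriv : derivD clam clam1;
  eta_deriv : derivD ceta ceta1;
  eta1_cont : contD ceta1;
  lam_0 : clam 0 = 0;
  p_0 : cp 0 = 1;
  E_0 : cE 0 = 1;
  f_lam : forall z, Cmod z < 1 -> f z = (z * Cexp (clam z))%C;
  f1_nu : forall z, Cmod z < 1 -> cf1 z = Cexp (cnu z);
  f1_p : forall z, Cmod z < 1 -> cf1 z = (cp z * Cexp (clam z))%C;
  lam1_p : forall z, Cmod z < 1 -> (z * clam1 z)%C = (cp z - 1)%C;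
  p1_E : forall z, Cmod z < 1 -> ((a, b) * (z * cp1 z))%C = (cp z * (cE z - cp z))%C;
  eta_nu : forall z, Cmod z < 1 -> cnu z = (ceta z - (1 / (a, b) - 1) * clam z)%C;
  E_eta : forall z, Cmod z < 1 -> cE z = (1 + (a, b) * z * ceta1 z)%C;
  E_level : forall z T, Cmod z < 1 -> 0 <= T -> Cmod z ^ 2 <= Rpower (1 + T) (- a) ->
    Cmod (a * T * cE z - c - (a, b) * (1 + T)) <= k * Cmod (a, b) * (1 + T)
}.

Arguments cf1 {a b k c f}.
Arguments cp {a b k c f}.
Arguments cp1 {a b k c f}.
Arguments cE {a b k c f}.
Arguments cE1 {a b k c f}.
Arguments clam {a b k c f}.
Arguments clam1 {a b k c f}.
Arguments cnu {a b k c f}.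
Arguments ceta {a b k c f}.
Arguments ceta1 {a b k c f}.

Arguments ch_a {a b k c f}.
Arguments ch_k {a b k c f}.
Arguments f_deriv {a b k c f}.
Arguments f1_cont {a b k c f}.
Arguments p_deriv {a b k c f}.
Arguments p1_cont {a b k c f}.
Arguments E_deriv {a b k c f}.
Arguments E1_cont {a b k c f}.
Arguments lam_deriv {a b k c f}.
Arguments eta_deriv {a b k c f}.
Arguments eta1_cont {a b k c f}.
Arguments lam_0 {a b k c f}.
Arguments p_0 {a b k c f}.
Arguments E_0 {a b k c f}.
Arguments f_lam {a b k c f}.
Arguments f1_nu {a b k c f}.
Arguments f1_p {a b k c f}.
Arguments lam1_p {a b k c f}.
Arguments p1_E {a b k c f}.
Arguments eta_nu {a b k c f}.
Arguments E_eta {a b k c f}.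
Arguments E_level {a b k c f}.

Lemma s_neq_0 (a b : R) : 0 < a -> ((a, b) : C) <> 0.
Proof. intros Ha H. apply (f_equal fst) in H. simpl in H. lra. Qed.

Lemma chain_of_hypotheses (a b k : R) (c : C) (f f1 f2 : C -> C) :
  0 < a -> 0 <= k < 1 -> classA f ->
  (forall z, inD z -> has_cderiv f z (f1 z)) ->
  (forall z, inD z -> has_cderiv f1 z (f2 z)) ->
  (forall z, inD z -> f1 z <> C0 /\ (z <> C0 -> f z <> C0) /\
     Cnorm (the_expr a (a, b) c f f1 f2 z) <= bound_M a k (a, b) c) ->
  inhabited (chain a b k c f).
Proof.
  intros Ha Hk [_ [Hf0 Hf10]] Hf Hf1 HM.
  set (s := (a, b) : C) in *. assert (Hs : s <> 0) by (apply s_neq_0; auto).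
  assert (Df : derivD f f1) by (intros z Hz; apply has_cderiv_dC, Hf, Hz).
  assert (Df1 : derivD f1 f2) by (intros z Hz; apply has_cderiv_dC, Hf1, Hz).
  assert (Cf1 : contD f1) by (eapply derivD_contD; eauto).
  assert (Hol_f : Hol f) by (exists f1; auto).
  assert (Hol_f1 : Hol f1) by (eapply Hol_deriv; eauto).
  assert (Hol_f2 : Hol f2) by (eapply Hol_derivative; eauto).
  assert (H0D : Cmod 0 < 1) by (rewrite Cmod_0; lra).
  assert (Hf1n : forall z, Cmod z < 1 -> f1 z <> 0) by (intros z Hz; apply (HM z Hz)).
  destruct (Hol_divide_z f Hol_f Hf0) as [e [Hol_e He]].
  assert (Hol_e' := Hol_e). destruct Hol_e' as [e1 [De Ce1]].
  assert (Hol_e1 : Hol e1) by (eapply Hol_derivative; eauto).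
  assert (Hf1e : forall z, Cmod z < 1 -> f1 z = (e z + z * e1 z)%C).
  { intros z Hz. apply (dC_unique f z); auto. apply dG_ext_loc with (f := fun z => (z * e z)%C) (d := 1 - Cmod z). lra.
    - intros y Hy. symmetry. apply He. apply ball_in_disc with z; auto.
    - eapply dG_eq. apply dG_mult. apply dG_param. apply De; auto. simpl. ring. }
  assert (Hf1_0 : f1 0 = 1).
  { apply (dC_unique f 0). apply Df; auto. apply has_cderiv_dC, Hf10. }
  assert (He0 : e 0 = 1). { rewrite <- Hf1_0, Hf1e by auto. ring. }
  assert (Hen : forall z, Cmod z < 1 -> e z <> 0).
  { intros z Hz. destruct (Ceq_dec z 0) as [->|Hz0].
    - rewrite He0. intros H. apply RtoC_inj in H. lra.
    - intros H. apply (proj1 (proj2 (HM z Hz)) Hz0). rewrite He, H by auto. apply C_ext; simpl; ring. }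
  destruct (Hol_log e e1 Hol_e De Hen He0) as [lm [Hl0 [Dl Hl]]].
  destruct (Hol_log f1 f2 Hol_f1 Df1 Hf1n Hf1_0) as [n [Hn0 [Dn Hn]]].
  set (q := fun z => (f1 z / e z)%C).
  set (q1 := fun z => ((f2 z * e z - f1 z * e1 z) / (e z * e z))%C).
  assert (Hol_q : Hol q) by (apply Hol_div; auto).
  assert (Dq : derivD q q1). { intros z Hz. apply dG_div; auto. }
  set (et1 := fun z => (f2 z / f1 z + (1 / s - 1) * (e1 z / e z))%C).
  assert (Hol_et1 : Hol et1).
  { apply Hol_plus. apply Hol_div; auto. apply Hol_mult. apply Hol_const. apply Hol_div; auto. }
  set (et := fun z => (n z + (1 / s - 1) * lm z)%C).
  assert (Det : derivD et et1).
  { intros z Hz. apply dG_plus. apply Dn; auto. apply dG_scal. apply Dl; auto. }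
  (* This is [E], written so that no quotient by [z] or [f] occurs and in the form required by
     [boundary_value_bound]. *)
  set (G := fun z => (1 + s * z * et1 z)%C).
  assert (Hol_G : Hol G).
  { apply Hol_plus. apply Hol_const. apply (Hol_mult (fun z => s * z)%C); auto. apply Hol_mult. apply Hol_const. apply Hol_id. }
  assert (HG : forall z, Cmod z < 1 -> G z = (s * (1 + z * f2 z / f1 z) + (1 - s) * q z)%C).
  { intros z Hz. unfold G, et1, q. assert (H1 := Hf1n z Hz). assert (H2 := Hen z Hz).
    assert (H3 : (z * e1 z)%C = (f1 z - e z)%C) by (rewrite (Hf1e z Hz); ring).
    transitivity (1 + s * z * (f2 z / f1 z) + (1 - s) * ((z * e1 z) / e z))%C. field; auto. rewrite H3. field; auto. }
  assert (Hq1 : forall z, Cmod z < 1 -> (s * (z * q1 z))%C = (q z * (G z - q z))%C).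
  { intros z Hz. assert (H1 := Hf1n z Hz). assert (H2 := Hen z Hz). rewrite HG by auto. unfold q1, q.
    assert (H3 : (z * e1 z)%C = (f1 z - e z)%C) by (rewrite (Hf1e z Hz); ring).
    transitivity (s * (z * f2 z * e z - f1 z * (z * e1 z)) / (e z * e z))%C. field; auto. rewrite H3. field. auto. }
  (* The expression of the hypothesis, regrouped as an average of [s + c] and [s - a E] with weights
     [|z|^2] and [1 - |z|^2]. *)
  assert (HX : forall z, Cmod z < 1 -> Cmod ((Cmod z ^ 2)%R * (s + c) + (1 - Cmod z ^ 2)%R * (s - a * G z)) <= bound_M a k s c).
  { intros z Hz. destruct (HM z Hz) as [_ [_ H]].
    assert (Hpq : zf'_over_f f f1 z = q z).
    { unfold zf'_over_f, q. destruct (Defs.Ceq_dec z C0) as [->|Hz0].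
      - change (C1 = f1 0 / e 0)%C. rewrite Hf1_0, He0. apply C_ext; simpl; field.
      - change (z * f1 z / f z = f1 z / e z)%C. rewrite He by auto. field. split; auto. }
    unfold the_expr in H. rewrite Hpq in H.
    change (Cmod (c * (Cmod z ^ 2)%R + s - (a * (1 - Cmod z ^ 2))%R * (s * (1 + z * f2 z / f1 z) + (1 - s) * q z)) <= bound_M a k s c) in H.
    rewrite <- HG in H by auto.
    eapply Rle_trans; [right|exact H]. f_equal. rewrite RtoC_mult, !RtoC_minus. ring. }
  assert (Hd : Cmod (s + c) <= bound_M a k s c).
  { apply (boundary_value_bound a (bound_M a k s c) s (s + c) et et1); auto. }
  destruct Hol_G as [G1 [DG CG1]].
  assert (Cq1 : contD q1) by (apply Hol_contD, Hol_derivative with q; auto).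
  constructor.
  refine (Chain a b k c f Ha Hk f1 q q1 G G1 lm (fun z => e1 z / e z)%C n et et1
    Df Cf1 Dq Cq1 DG CG1 Dl Det (Hol_contD _ Hol_et1) Hl0 _ _ _ _ _ _ _ _ _ _).
  - unfold q. rewrite Hf1_0, He0. apply C_ext; simpl; field.
  - unfold G. ring.
  - intros z Hz. rewrite Hl, He; auto.
  - intros z Hz. rewrite Hn; auto.
  - intros z Hz. rewrite Hl by auto. unfold q. field. auto.
  - intros z Hz. assert (H2 := Hen z Hz). unfold q. rewrite (Hf1e z Hz). field. auto.
  - exact Hq1.
  - intros z Hz. unfold et. fold s. ring.
  - intros z Hz. reflexivity.
  - intros z T Hz HT HzT. fold s. assert (H0 := Cmod_ge_0 z).
    apply (level_bound a k s c ((Cmod z ^ 2)%R * (s + c) + (1 - Cmod z ^ 2)%R * (s - a * G z))%C (G z) (Cmod z ^ 2) T); auto.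
    split. nra. nra.
Qed.

(** * Approximate trajectories *)

(** Convergent sequences with their limits, as functions on [option nat] continuous at [None]. *)
Definition seqidx (n : option nat) : C := match n with None => 0 | Some n => RtoC (/ (INR n + 1)) end.
Definition seqc (u : option nat -> C) : Prop := cG seqidx u None.

Lemma seqidx_small del : 0 < del -> exists N : nat, forall n, (N <= n)%nat -> Cmod (seqidx (Some n) - seqidx None) < del.
Proof.
  intros Hdel. destruct (archimed_cor1 del Hdel) as [N [H1 H2]]. exists N. intros n Hn. simpl.
  rewrite <- RtoC_minus, Rminus_0_r, Cmod_R. apply le_INR in Hn. assert (H := lt_0_INR N H2).
  rewrite Rabs_pos_eq. 2: { left. apply Rinv_0_lt_compat. lra. }
  apply Rle_lt_trans with (2 := H1). apply Rinv_le_contravar; lra.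
Qed.

Lemma seqc_of_ccv (u : nat -> C) (l : C) : ccv u l -> seqc (fun n => match n with None => l | Some n => u n end).
Proof.
  intros H eps Heps. destruct (H eps Heps) as [N HN].
  exists (/ (INR N + 1)). assert (HN0 := pos_INR N). split. apply Rinv_0_lt_compat; lra.
  intros [n|] Hn. 2: { replace (l - l)%C with (RtoC 0) by ring. rewrite Cmod_0. auto. }
  apply HN. simpl in Hn. rewrite <- RtoC_minus, Rminus_0_r, Cmod_R in Hn. assert (Hn0 := pos_INR n).
  rewrite Rabs_pos_eq in Hn. 2: { left. apply Rinv_0_lt_compat. lra. }
  apply Rinv_lt_cancel in Hn. 2: lra. apply INR_le. lra.
Qed.

Lemma seqc_le (u v : option nat -> R) : seqc (fun n => RtoC (u n)) -> seqc (fun n => RtoC (v n)) ->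
  (forall n, u (Some n) <= v (Some n)) -> u None <= v None.
Proof.
  intros Hu Hv H. apply Rnot_lt_le. intros Hlt.
  destruct (Hu ((u None - v None) / 2)) as [d1 [Hd1 H1]]; [lra|].
  destruct (Hv ((u None - v None) / 2)) as [d2 [Hd2 H2]]; [lra|].
  destruct (seqidx_small (Rmin d1 d2)) as [N HN]. apply Rmin_glb_lt; auto.
  specialize (HN N (Nat.le_refl N)).
  specialize (H1 (Some N) (Rlt_le_trans _ _ _ HN (Rmin_l _ _))).
  specialize (H2 (Some N) (Rlt_le_trans _ _ _ HN (Rmin_r _ _))).
  rewrite <- RtoC_minus, Cmod_R in H1, H2. apply Rabs_lt_between in H1. apply Rabs_lt_between in H2.
  specialize (H N). lra.
Qed.

Lemma cG_Cmod {X} (i g : X -> C) x : cG i g x -> cG i (fun y => RtoC (Cmod (g y))) x.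
Proof. intros Hg. apply (cG_comp i (fun w => RtoC (Cmod w)) g); auto. apply cC_Cmod. Qed.

Lemma cG_realmult {X} (i : X -> C) (g h : X -> R) x : cG i (fun y => RtoC (g y)) x -> cG i (fun y => RtoC (h y)) x ->
  cG i (fun y => RtoC (g y * h y)) x.
Proof.
  intros Hg Hh eps Heps. destruct (cG_mult i _ _ x Hg Hh eps Heps) as [d [Hd H]]. exists d. split; auto.
  intros y Hy. rewrite !RtoC_mult. auto.
Qed.

Lemma cG_realplus {X} (i : X -> C) (g h : X -> R) x : cG i (fun y => RtoC (g y)) x -> cG i (fun y => RtoC (h y)) x ->
  cG i (fun y => RtoC (g y + h y)) x.
Proof.
  intros Hg Hh eps Heps. destruct (cG_plus i _ _ x Hg Hh eps Heps) as [d [Hd H]]. exists d. split; auto.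
  intros y Hy. rewrite !RtoC_plus. auto.
Qed.

(** Induction along an interval by the supremum principle; both the flow and the homotopy arguments
    rest on it. *)
Lemma real_induction (T0 T1 : R) (S : R -> Prop) : T0 <= T1 -> S T0 ->
  (forall t, T0 <= t <= T1 -> (forall del, 0 < del -> exists t', T0 <= t' <= t /\ t - del < t' /\ S t') -> S t) ->
  (forall t, T0 <= t < T1 -> S t -> exists t', t < t' <= T1 /\ S t') -> S T1.
Proof.
  intros HT H0 Hcl Hst.
  destruct (completeness (fun t => T0 <= t <= T1 /\ S t)) as [m [Hm1 Hm2]].
  - exists T1. intros t [Ht _]. lra.
  - exists T0. split. lra. auto.
  - assert (Hm : T0 <= m <= T1).
    { split. apply Hm1. split; auto; lra. apply Hm2. intros t [Ht _]. lra. }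
    assert (Sm : S m).
    { apply Hcl; auto. intros del Hdel. apply NNPP. intros Hn.
      assert (m <= m - del); [|lra]. apply Hm2. intros t [Ht1 Ht2]. apply Rnot_lt_le. intros Ht3.
      apply Hn. assert (t <= m) by (apply Hm1; split; auto). exists t. split; [lra|split; [lra|auto]]. }
    destruct (Rlt_or_le m T1) as [Hlt|Hge].
    + destruct (Hst m ltac:(lra) Sm) as [t' [Ht' St']]. assert (t' <= m); [|lra].
      apply Hm1. split; auto. lra.
    + replace T1 with m by lra. auto.
Qed.

(** Replaces the solution of a differential equation. [Good] is a closed relation between time and
    states that can always be continued a little to the right; boundedness of the states supplies a
    limit state at the supremum of the times reached. Two states are carried because pairs of
    trajectories have to be compared; the second one may be a dummy or an auxiliary quantity. *)
Lemma flow_induction (T0 T1 B : R) (Good : R -> C -> C -> Prop) (z0 w0 : C) : T0 <= T1 -> Good T0 z0 w0 ->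
  (forall t z w, T0 <= t <= T1 -> Good t z w -> Cmod z <= B /\ Cmod w <= B) ->
  (forall (t : option nat -> R) (z w : option nat -> C), seqc (fun n => RtoC (t n)) -> seqc z -> seqc w ->
     (forall n, T0 <= t n <= T1) -> (forall n, Good (t (Some n)) (z (Some n)) (w (Some n))) -> Good (t None) (z None) (w None)) ->
  (forall t z w, T0 <= t < T1 -> Good t z w -> exists d, 0 < d /\ forall h, 0 < h < d -> exists z' w', Good (t + h) z' w') ->
  exists z w, Good T1 z w.
Proof.
  intros HT H0 Hb Hcl Hst.
  apply (real_induction T0 T1 (fun t => exists z w, Good t z w)); auto.
  - exists z0, w0. auto.
  - intros t Ht Hap.
    assert (Hs : forall n : nat, exists x : R * (C * C), T0 <= fst x <= t /\ t - / (INR n + 1) < fst x /\ Good (fst x) (fst (snd x)) (snd (snd x))).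
    { intros n. destruct (Hap (/ (INR n + 1))) as [t' [H1 [H2 [z [w H3]]]]].
      apply Rinv_0_lt_compat. assert (H := pos_INR n). lra. exists (t', (z, w)). auto. }
    destruct (choice _ Hs) as [x Hx]. clear Hs.
    destruct (CC_subseq (fun n => fst (snd (x n))) (fun n => snd (snd (x n))) B) as [phi [lz [lw [Hphi [Hz Hw]]]]].
    { intros n. destruct (Hx n) as [H1 [_ H2]]. apply (Hb (fst (x n)) _ (snd (snd (x n)))); auto. lra. }
    { intros n. destruct (Hx n) as [H1 [_ H2]]. apply (Hb (fst (x n)) (fst (snd (x n)))); auto. lra. }
    exists lz, lw.
    apply (Hcl (fun n => match n with None => t | Some n => fst (x (phi n)) end)
      (fun n => match n with None => lz | Some n => fst (snd (x (phi n))) end)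
      (fun n => match n with None => lw | Some n => snd (snd (x (phi n))) end)).
    + assert (Hc : ccv (fun n => RtoC (fst (x (phi n)))) t).
      { intros eps Heps. destruct (archimed_cor1 eps Heps) as [N [HN1 HN2]]. exists N. intros n Hn.
        destruct (Hx (phi n)) as [H1 [H2 _]]. rewrite <- RtoC_minus, Cmod_R, Rabs_left1 by lra.
        assert (Hn' := incr_ge phi Hphi n). assert (HN3 := lt_0_INR N HN2).
        assert (HNn : INR N <= INR (phi n)) by (apply le_INR; lia).
        assert (/ (INR (phi n) + 1) <= / INR N) by (apply Rinv_le_contravar; lra). lra. }
      intros eps Heps. destruct (seqc_of_ccv _ _ Hc eps Heps) as [d [Hd H1]]. exists d. split; auto.
      intros [n|] Hn. apply (H1 (Some n)); auto. apply (H1 None); auto.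
    + apply seqc_of_ccv. exact Hz.
    + apply seqc_of_ccv. exact Hw.
    + intros [n|]; [|lra]. destruct (Hx (phi n)) as [H1 _]. lra.
    + intros n. apply Hx.
  - intros t Ht [z [w Hg]]. destruct (Hst t z w Ht Hg) as [d [Hd H1]].
    set (h := Rmin (d / 2) (T1 - t)). assert (Hh : 0 < h) by (apply Rmin_glb_lt; lra).
    assert (Hh1 : h <= d / 2) by apply Rmin_l. assert (Hh2 : h <= T1 - t) by apply Rmin_r.
    destruct (H1 h) as [z' [w' H2]]. lra. exists (t + h). split. lra. exists z', w'. auto.
Qed.

Definition ev (P : R -> Prop) : Prop := exists d, 0 < d /\ forall h, 0 < h < d -> P h.

Lemma ev_and P Q : ev P -> ev Q -> ev (fun h => P h /\ Q h).
Proof.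
  intros [d1 [Hd1 H1]] [d2 [Hd2 H2]]. exists (Rmin d1 d2). split. apply Rmin_glb_lt; auto.
  intros h [Hh1 Hh2]. split. apply H1. split; auto. apply Rlt_le_trans with (1 := Hh2), Rmin_l.
  apply H2. split; auto. apply Rlt_le_trans with (1 := Hh2), Rmin_r.
Qed.

Lemma ev_impl (P Q : R -> Prop) : (forall h, 0 < h -> P h -> Q h) -> ev P -> ev Q.
Proof. intros H [d [Hd H1]]. exists d. split; auto. intros h Hh. apply H. lra. apply H1, Hh. Qed.

Lemma ev_small d : 0 < d -> ev (fun h => h < d).
Proof. intros Hd. exists d. split; auto. intros; lra. Qed.

Lemma ev_decrease (phi : R -> R) l : is_derive phi 0 l -> l < 0 -> ev (fun h => phi h < phi 0).
Proof.
  intros Hd Hl. apply is_derive_Reals in Hd. destruct (Hd (- l)) as [[d Hdp] H]. lra. exists d. split; auto.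
  intros h Hh. specialize (H h ltac:(lra) ltac:(simpl; rewrite Rabs_pos_eq; lra)).
  apply Rabs_lt_between in H. rewrite Rplus_0_l in H.
  assert (E : (phi h - phi 0) / h < 0) by lra.
  assert (phi h - phi 0 = (phi h - phi 0) / h * h) by (field; lra). nra.
Qed.

Lemma ev_deriv (g : R -> C) v eps : dR g 0 v -> 0 < eps -> ev (fun h => Cmod (g h - g 0 - h * v) <= eps * h).
Proof.
  intros Hd Heps. destruct (Hd eps Heps) as [d [Hd0 H]]. exists d. split; auto. intros h Hh.
  assert (E : (h - 0)%C = RtoC h) by ring.
  specialize (H h). cbv beta in H. rewrite E, Cmod_R, Rabs_pos_eq in H by lra. apply H. lra.
Qed.

Lemma dR_shift (T x : R) : dR (fun h => RtoC (T + h)) x 1.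
Proof.
  apply dR_of_components; simpl; auto_derive; auto.
Qed.

(** * The Loewner chain *)

Section Chain.
Context {a b k : R} {c : C} {f : C -> C} (H : chain a b k c f).

Local Notation s := ((a, b) : C).
Let Ha : 0 < a := ch_a H.
Let Hk : 0 <= k < 1 := ch_k H.

(** At [T = 0] the power condition alone would admit the whole closed disc, where [f] is not under
    control; hence the separate strict bound. *)
Definition region (T : R) (z : C) : Prop := 0 <= T /\ Cmod z < 1 /\ Cmod z ^ 2 <= Rpower (1 + T) (- a).
Definition chainG (T : R) (z : C) : C := (a * T * cE H z - c)%C.
Definition chainq (T : R) (z : C) : C := (1 - a * T / c * cp H z)%C.
(** A relative speed: with the factor [z] split off, 0 is a fixed point and an Euler step is
    multiplication by a complex number. *)
Definition chain_speed (T : R) (z : C) : C := (- (a * s) / chainG T z)%C.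
Local Notation vhat := chain_speed.

Lemma s_pos : 0 < Cmod s.
Proof. apply Cmod_pos, s_neq_0, Ha. Qed.

Lemma region_0 z : Cmod z < 1 -> region 0 z.
Proof.
  intros Hz. split; [lra|split; auto]. assert (H0 := Cmod_ge_0 z).
  rewrite Rplus_0_r. unfold Rpower. rewrite ln_1, Rmult_0_r, exp_0. nra.
Qed.

Lemma Rpower_anti x y m : 0 < x <= y -> 0 <= m -> Rpower y (- m) <= Rpower x (- m).
Proof.
  intros Hxy Hm. rewrite !Rpower_Ropp. apply Rinv_le_contravar. apply exp_pos. apply Rle_Rpower_l; auto.
Qed.

Lemma region_mono T T' z : region T z -> 0 <= T' <= T -> region T' z.
Proof.
  intros [H1 [H2 H3]] HT. split; [lra|split; auto]. apply Rle_trans with (1 := H3).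
  apply Rpower_anti; lra.
Qed.

Lemma G_level T z : region T z -> Cmod (chainG T z - s * (1 + T)) <= k * Cmod s * (1 + T).
Proof. intros [H1 [H2 H3]]. apply (E_level H); auto. Qed.

Lemma G_lower T z : region T z -> (1 - k) * Cmod s * (1 + T) <= Cmod (chainG T z).
Proof.
  intros Hr. assert (H1 := G_level T z Hr). assert (H2 := Cmod_triangle_rev (s * (1 + T)) (chainG T z)).
  rewrite Cmod_sub_sym in H2. rewrite <- RtoC_plus, Cmod_mult, Cmod_R, Rabs_pos_eq in H2.
  2: { destruct Hr; lra. } rewrite <- RtoC_plus in H1. nra.
Qed.

Lemma G_neq_0 T z : region T z -> chainG T z <> 0.
Proof.
  intros Hr. apply Cmod_gt_0. assert (H1 := G_lower T z Hr). assert (H2 := s_pos). destruct Hr as [H3 _].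
  assert (0 < (1 - k) * Cmod s * (1 + T)) by (repeat apply Rmult_lt_0_compat; lra). lra.
Qed.

(** At [T = 0] the function [chainG] is the constant [-c], and the level bound keeps it away from
    0. *)
Lemma c_neq_0 : c <> 0.
Proof.
  intros E. assert (Hr := region_0 0 ltac:(rewrite Cmod_0; lra)). apply (G_neq_0 _ _ Hr).
  unfold chainG. transitivity (- c)%C. ring. rewrite <- (Copp_0 : (- 0)%C = 0). f_equal. exact E.
Qed.

Lemma vhat_bound T z : region T z -> Cmod (vhat T z) <= a / (1 - k).
Proof.
  intros Hr. assert (H1 := G_lower T z Hr). assert (H2 := s_pos). destruct Hr as [H3 _].
  assert (Hks : 0 < (1 - k) * Cmod s) by (apply Rmult_lt_0_compat; lra).
  assert (HG : (1 - k) * Cmod s <= Cmod (chainG T z)) by nra.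
  unfold chain_speed. rewrite Cmod_div, Cmod_opp, Cmod_RtoC_mult, Rabs_pos_eq by (try lra; apply Cmod_gt_0; nra).
  apply Rle_div_l. nra. replace (a * Cmod s) with (a / (1 - k) * ((1 - k) * Cmod s)) by (field; lra).
  apply Rmult_le_compat_l; auto. apply Rdiv_le_0_compat; lra.
Qed.

(** Inversion maps the disc of centre [t] and radius [k t] to a disc whose leftmost point is the
    image of [(1 + k) t]. *)
Lemma re_inv_lower (w : C) (t : R) : 0 < t -> Cmod (w - t) <= k * t -> / ((1 + k) * t) <= fst (/ w)%C.
Proof.
  intros Ht Hw. assert (Hs := Cmod_sqr (w - t)). simpl in Hs. assert (H0 := Cmod_ge_0 (w - t)).
  set (x := fst w) in *. set (y := snd w) in *.
  assert (E1 : (x - t) * (x - t) + y * y <= k * t * (k * t)) by (unfold Rminus in *; nra).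
  assert (Hx : (1 - k) * t <= x <= (1 + k) * t).
  { assert (Hf := Rle_trans _ _ _ (fst_le_Cmod (w - t)) Hw). simpl in Hf. apply Rabs_le_between in Hf. fold x in Hf. lra. }
  assert (Hkt : 0 < (1 - k) * t) by (apply Rmult_lt_0_compat; lra).
  assert (Hkt' : 0 < (1 + k) * t) by (apply Rmult_lt_0_compat; lra).
  simpl. fold x y. apply Rle_div_r. nra.
  replace (/ ((1 + k) * t) * (x * (x * 1) + y * (y * 1))) with ((x * x + y * y) / ((1 + k) * t)) by (field; lra).
  apply Rle_div_l; auto.
  assert (Hp : (1 - k) * t * x <= (1 - k) * t * ((1 + k) * t)) by (apply Rmult_le_compat_l; lra). nra.
Qed.

Lemma vhat_re T z : region T z -> fst (vhat T z) <= - (a / ((1 + k) * (1 + T))).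
Proof.
  intros Hr. assert (H1 := G_level T z Hr). assert (H2 := G_neq_0 T z Hr). assert (Hsn := s_neq_0 a b Ha).
  assert (H3 := re_inv_lower (chainG T z / s)%C (1 + T)). destruct Hr as [HT _].
  assert (H4 : Cmod (chainG T z / s - (1 + T)%R) <= k * (1 + T)).
  { replace (chainG T z / s - (1 + T)%R)%C with ((chainG T z - s * (1 + T)) / s)%C by (rewrite RtoC_plus; field; auto).
    rewrite Cmod_div by auto. apply Rle_div_l. apply s_pos. lra. }
  specialize (H3 ltac:(lra) H4).
  replace (vhat T z) with ((- a)%R * / (chainG T z / s))%C by (unfold chain_speed; rewrite RtoC_opp; field; auto).
  rewrite <- Rmult_1_l with (r := / _) in H3.
  replace (fst ((- a)%R * / (chainG T z / s))%C) with (- a * fst (/ (chainG T z / s))%C) by (simpl; ring).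
  replace (- (a / ((1 + k) * (1 + T)))) with (- a * (1 * / ((1 + k) * (1 + T)))) by (field; lra).
  nra.
Qed.

(** The rate at which trajectories contract; only [a < mexp < 2 a / (1 + k)] matters: the first
    bound keeps them in the region, the second leaves room for the error of an Euler step. *)
Definition mexp : R := a / 2 + a / (1 + k).

Lemma mexp_bounds : a < mexp /\ mexp < 2 * (a / (1 + k)).
Proof.
  unfold mexp. assert (a / 2 < a / (1 + k)). { apply Rmult_lt_compat_l; auto. apply Rinv_lt_contravar; lra. } lra.
Qed.

(** A shrinking disc that holds the trajectory started from [z0] at time [T0]. Its squared radius
    decays like [(1 + T)^(-mexp)], faster than that of the region. *)
Definition chain_disc (T0 : R) (z0 : C) (T : R) (z : C) : Prop :=
  Cmod z ^ 2 * Rpower (1 + T) mexp <= Cmod z0 ^ 2 * Rpower (1 + T0) mexp.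
Local Notation inner := chain_disc.

Lemma inner_le T0 z0 T z : 0 <= T0 <= T -> inner T0 z0 T z -> Cmod z <= Cmod z0.
Proof.
  unfold chain_disc. intros HT Hi. assert (H1 := mexp_bounds).
  assert (H2 : Rpower (1 + T0) mexp <= Rpower (1 + T) mexp) by (apply Rle_Rpower_l; lra).
  assert (H3 : 0 < Rpower (1 + T0) mexp) by apply exp_pos.
  assert (H4 := Cmod_ge_0 z). assert (H5 := Cmod_ge_0 z0). simpl in Hi.
  apply Rnot_lt_le. intros Hlt.
  assert (H6 : Cmod z0 * Cmod z0 < Cmod z * Cmod z) by nra.
  assert (H7 : Cmod z0 * Cmod z0 * Rpower (1 + T0) mexp < Cmod z * Cmod z * Rpower (1 + T0) mexp) by (apply Rmult_lt_compat_r; auto).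
  assert (H8 : Cmod z * Cmod z * Rpower (1 + T0) mexp <= Cmod z * Cmod z * Rpower (1 + T) mexp) by (apply Rmult_le_compat_l; nra).
  rewrite !Rmult_1_r in Hi. lra.
Qed.

(** The second factor measures how far inside the region a trajectory has moved; [cross_separation]
    lives on it. *)
Lemma inner_sq T0 z0 T z : region T0 z0 -> T0 <= T -> inner T0 z0 T z ->
  Cmod z ^ 2 <= Rpower (1 + T) (- a) * Rpower ((1 + T0) / (1 + T)) (mexp - a).
Proof.
  unfold chain_disc. intros [H0 [H1 H2]] HT Hi.
  assert (H3 : 0 < Rpower (1 + T) mexp) by apply exp_pos.
  apply Rmult_le_reg_r with (1 := H3). apply Rle_trans with (1 := Hi).
  apply Rle_trans with (Rpower (1 + T0) (- a) * Rpower (1 + T0) mexp).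
  { apply Rmult_le_compat_r; auto. left; apply exp_pos. }
  right. unfold Rpower, Rdiv. rewrite ln_mult, ln_Rinv by (try apply Rinv_0_lt_compat; lra).
  rewrite <- !exp_plus. f_equal. ring.
Qed.

Lemma inner_region T0 z0 T z : region T0 z0 -> T0 <= T -> inner T0 z0 T z -> region T z.
Proof.
  intros Hr HT Hi. assert (Hr' := Hr). destruct Hr' as [H0 [H1 H2]]. split; [lra|split].
  - apply Rle_lt_trans with (2 := H1). apply (inner_le T0 z0 T); auto.
  - apply Rle_trans with (1 := inner_sq T0 z0 T z Hr HT Hi).
    apply Rle_trans with (Rpower (1 + T) (- a) * 1); [|lra]. apply Rmult_le_compat_l. left; apply exp_pos.
    unfold Rpower. apply Rle_trans with (exp 0); [|rewrite exp_0; lra]. destruct (Req_dec T T0) as [->|Hne].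
    + unfold Rdiv. rewrite Rinv_r by lra. rewrite ln_1, Rmult_0_r. lra.
    + left. apply exp_increasing. assert (Hm := mexp_bounds).
      assert (ln ((1 + T0) / (1 + T)) < 0).
      { apply Rlt_le_trans with (ln 1); [|rewrite ln_1; lra]. apply ln_increasing. apply Rdiv_lt_0_compat; lra. apply Rlt_div_l; lra. }
      nra.
Qed.

Lemma inner_refl T z : inner T z T z.
Proof. unfold chain_disc. lra. Qed.

Definition chain_step (T : R) (z : C) (h : R) : C := (z * (1 + h * vhat T z))%C.
Local Notation euler := chain_step.

Lemma dR_euler T z : dR (euler T z) 0 (z * vhat T z).
Proof.
  unfold chain_step. eapply dG_eq. apply dG_scal. apply dG_plus. apply dG_const. apply dG_mult. apply dG_param. apply dG_const.
  simpl. ring.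
Qed.

Lemma euler_0 T z : euler T z 0 = z.
Proof. unfold chain_step. ring. Qed.

Lemma inner_step T0 z0 T z : region T0 z0 -> T0 <= T -> inner T0 z0 T z ->
  ev (fun h => inner T0 z0 (T + h) (euler T z h)).
Proof.
  intros Hr HT Hi. assert (Hreg := inner_region T0 z0 T z Hr HT Hi). assert (Hv := vhat_re T z Hreg).
  unfold chain_step. revert Hv. generalize (vhat T z) as v. intros v Hv. assert (HT0 : 0 <= T0) by apply Hr.
  (* After division by [|z|^2] this is the quantity that [chain_disc] bounds. Its logarithmic
     derivative at [h = 0] is [2 Re v + mexp / (1 + T)], negative because [mexp < 2 a / (1 + k)]. *)
  set (phi := fun h => ((1 + h * fst v) * (1 + h * fst v) + h * snd v * (h * snd v)) * exp (mexp * ln (1 + T + h))).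
  assert (Hphi : is_derive phi 0 (exp (mexp * ln (1 + T)) * (2 * fst v + mexp / (1 + T)))).
  { unfold phi. auto_derive. lra. rewrite !Rplus_0_r, !Rmult_0_l, Rplus_0_r. field. lra. }
  apply ev_decrease in Hphi.
  - apply ev_impl with (2 := Hphi). intros h Hh Hd. unfold chain_disc. apply Rle_trans with (2 := Hi).
    assert (E : Cmod (z * (1 + h * v)) ^ 2 = Cmod z ^ 2 * ((1 + h * fst v) * (1 + h * fst v) + h * snd v * (h * snd v))).
    { simpl (_ ^ 2). rewrite !Rmult_1_r, Cmod_mult.
      replace (Cmod z * Cmod (1 + h * v) * (Cmod z * Cmod (1 + h * v))) with (Cmod z * Cmod z * (Cmod (1 + h * v) * Cmod (1 + h * v))) by ring.
      rewrite (Cmod_sqr (1 + h * v)). simpl. ring. }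
    rewrite E, Rmult_assoc. apply Rmult_le_compat_l. nra.
    unfold phi in Hd. rewrite <- Rplus_assoc. unfold Rpower. rewrite !Rplus_0_r, !Rmult_0_l, Rplus_0_r in Hd. lra.
  - assert (Hm := mexp_bounds). assert (He := exp_pos (mexp * ln (1 + T))).
    assert (2 * fst v + mexp / (1 + T) < 0); [|nra].
    assert (mexp / (1 + T) < 2 * (a / (1 + k)) / (1 + T)).
    { apply Rmult_lt_compat_r. apply Rinv_0_lt_compat; lra. lra. }
    replace (2 * (a / (1 + k)) / (1 + T)) with (2 * (a / ((1 + k) * (1 + T)))) in H0 by (field; lra). lra.
Qed.

Lemma seqc_Rpower (t : option nat -> R) m : (forall n, 0 <= t n) -> seqc (fun n => RtoC (t n)) ->
  seqc (fun n => RtoC (Rpower (1 + t n) m)).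
Proof.
  intros Ht Hc. apply (cG_real _ (fun x => Rpower (1 + x) m) t); auto.
  apply derivable_continuous_pt. exists (m * Rpower (1 + t None) (m - 1)). apply is_derive_Reals.
  specialize (Ht None). unfold Rpower. auto_derive. lra.
  replace ((m - 1) * ln (1 + t None)) with (m * ln (1 + t None) + - ln (1 + t None)) by ring.
  rewrite exp_plus, exp_Ropp, exp_ln by lra. field. lra.
Qed.

Lemma inner_closed T0 z0 (t : option nat -> R) (z : option nat -> C) : (forall n, 0 <= t n) ->
  seqc (fun n => RtoC (t n)) -> seqc z -> (forall n, inner T0 z0 (t (Some n)) (z (Some n))) ->
  inner T0 z0 (t None) (z None).
Proof.
  intros H0 Ht Hz Hi. unfold chain_disc in *.
  apply (seqc_le (fun n => Cmod (z n) ^ 2 * Rpower (1 + t n) mexp) (fun _ => Cmod z0 ^ 2 * Rpower (1 + T0) mexp)); auto.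
  - apply cG_realmult. simpl. apply cG_realmult. apply cG_Cmod, Hz. apply cG_realmult. apply cG_Cmod, Hz. apply cG_const.
    apply seqc_Rpower; auto.
  - apply cG_const.
Qed.

Lemma dG_chainq {X} (i : X -> C) (t : X -> R) (w : X -> C) x (T1 w1 : C) : Cmod (w x) < 1 ->
  dG i (fun y => RtoC (t y)) x T1 -> dG i w x w1 ->
  dG i (fun y => chainq (t y) (w y)) x
    (- (a / c) * (T1 * cp H (w x) + t x * (w1 * cp1 H (w x))))%C.
Proof.
  intros Hw Ht Hwd. assert (Hc := c_neq_0).
  eapply dG_eq.
  - unfold chainq. apply dG_minus. apply dG_const. apply dG_mult.
    + apply (dG_mult i (fun y => a * t y)%C (fun y => / c)%C). apply dG_scal. exact Ht. apply dG_const.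
    + apply (dG_comp i (cp H) w). exact Hwd. apply (p_deriv H); auto.
  - simpl. field. auto.
Qed.

Lemma cG_chainq {X} (i : X -> C) (t : X -> R) (w : X -> C) x : Cmod (w x) < 1 ->
  cG i (fun y => RtoC (t y)) x -> cG i w x -> cG i (fun y => chainq (t y) (w y)) x.
Proof.
  intros Hw Ht Hwc. unfold chainq. apply cG_plus. apply cG_const.
  apply (cG_comp i Copp (fun y => a * t y / c * cp H (w y))%C).
  - apply cG_mult. apply (cG_mult i (fun y => a * t y)%C (fun y => / c)%C). apply cG_mult. apply cG_const. exact Ht. apply cG_const.
    apply (cG_comp i (cp H) w); auto. eapply dG_cG, (p_deriv H); auto.
  - eapply dG_cG. apply dG_opp, dG_param.
Qed.

(** Along the characteristics [dz/dT = z vhat] one has [dq/dT = (a p / G) q]. *)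
Lemma dR_chainq_euler T z : region T z ->
  dR (fun h => chainq (T + h) (euler T z h)) 0 (a * cp H z / chainG T z * chainq T z).
Proof.
  intros Hr. assert (HG := G_neq_0 T z Hr). assert (Hc := c_neq_0). assert (Hs := s_neq_0 a b Ha).
  assert (Hz : Cmod z < 1) by apply Hr.
  eapply dG_eq.
  - apply (dG_chainq RtoC (fun h => T + h) (euler T z) 0 1 (z * vhat T z)).
    + rewrite euler_0. auto.
    + apply dR_shift.
    + apply dR_euler.
  - rewrite euler_0, Rplus_0_r. set (P := cp H z). set (P1 := cp1 H z).
    assert (E1 : (z * P1)%C = (P * (cE H z - P) / s)%C).
    { unfold P, P1. rewrite <- (p1_E H z Hz). field. auto. }
    transitivity (- (a / c) * (P + T * (z * P1 * vhat T z)))%C. ring. rewrite E1. unfold chain_speed, chainq. fold P.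
    unfold chainG in *. field. auto.
Qed.

End Chain.

(** * Zero-freeness of [q], the chain [Psi], and approximate trajectories *)

Section Flow.
Context {a b k : R} {c : C} {f : C -> C} (H : chain a b k c f).

Local Notation s := ((a, b) : C).
Local Notation G := (chainG H).
Local Notation q := (chainq H).
Local Notation region := (@region a).
Local Notation inner := (@chain_disc a k).
Local Notation vhat := (chain_speed H).
Local Notation euler := (chain_step H).
Let Ha : 0 < a := ch_a H.
Let Hk : 0 <= k < 1 := ch_k H.

Lemma region_small del : 0 < del -> exists T1, 0 < T1 /\ forall T z, T1 <= T -> region T z -> Cmod z < del.
Proof.
  intros Hdel. set (B := / (del * del)). assert (HB : 0 < B) by (apply Rinv_0_lt_compat; nra).
  exists (Rpower B (/ a)). split. apply exp_pos. intros T z HT [H0 [H1 H2]].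
  assert (Hz := Cmod_ge_0 z). apply Rnot_le_lt. intros Hle.
  assert (E1 : B < Rpower (1 + T) a).
  { replace B with (Rpower (Rpower B (/ a)) a). 2: { rewrite Rpower_mult, Rinv_l by lra. apply Rpower_1; auto. }
    apply Rlt_Rpower_l; auto. split. apply exp_pos. lra. }
  assert (E2 : Rpower (1 + T) (- a) < del * del).
  { rewrite Rpower_Ropp. replace (del * del) with (/ B) by (unfold B; apply Rinv_inv). apply Rinv_lt_contravar; auto.
    apply Rmult_lt_0_compat; lra. }
  simpl in H2. nra.
Qed.

Lemma q_large : exists T1, 0 < T1 /\ forall T z, T1 <= T -> region T z -> 1 <= Cmod (q T z).
Proof.
  assert (Hp : cC (cp H) 0). { eapply dG_cG. apply (p_deriv H). rewrite Cmod_0. lra. }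
  destruct (Hp (1 / 2)) as [d [Hd Hp1]]; [lra|].
  destruct (region_small d Hd) as [T2 [HT2 HT2']].
  assert (Hc := Cmod_pos c (c_neq_0 H)).
  exists (T2 + 4 * Cmod c / a). assert (0 < 4 * Cmod c / a) by (apply Rdiv_lt_0_compat; lra). split. lra.
  intros T z HT Hr. specialize (HT2' T z ltac:(lra) Hr).
  assert (Hpz : 1 / 2 <= Cmod (cp H z)).
  { specialize (Hp1 z). replace (z - 0)%C with z in Hp1 by ring. specialize (Hp1 HT2'). rewrite (p_0 H) in Hp1.
    assert (E := Cmod_triangle_rev 1 (cp H z)). rewrite Cmod_sub_sym, Cmod_1 in E. lra. }
  unfold chainq. assert (E := Cmod_triangle_rev (a * T / c * cp H z) 1). rewrite Cmod_sub_sym, Cmod_1 in E.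
  assert (E2 : 2 <= Cmod (a * T / c * cp H z)); [|lra].
  rewrite <- RtoC_mult, Cmod_mult, Cmod_div, Cmod_R, Rabs_pos_eq by (try apply (c_neq_0 H); nra).
  apply Rle_trans with (4 * (1 / 2)). lra. apply Rmult_le_compat; try lra.
  apply (proj1 (Rle_div_r 4 (a * T) (Cmod c) Hc)). assert (4 * Cmod c / a * a = 4 * Cmod c) by (field; lra). nra.
Qed.

Lemma q_at_0 z : q 0 z = 1.
Proof. unfold chainq. unfold Cdiv. ring. Qed.

Lemma p_over_G_bound rho : rho < 1 -> exists L, 0 < L /\ forall T z, region T z -> Cmod z <= rho ->
  Cmod (a * cp H z / G T z) <= L.
Proof.
  intros Hr. destruct (contD_bounded (cp H) rho) as [B [HB HB1]]; auto.
  { eapply derivD_contD, (p_deriv H). }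
  assert (Hs := s_pos H). assert (Hks : 0 < (1 - k) * Cmod s) by (apply Rmult_lt_0_compat; lra).
  exists (a * B / ((1 - k) * Cmod s)). split. { apply Rdiv_lt_0_compat; nra. }
  intros T z Hreg Hz. assert (HG := G_lower H T z Hreg). assert (HT : 0 <= T) by apply Hreg.
  rewrite Cmod_div, Cmod_RtoC_mult, Rabs_pos_eq by (try apply (G_neq_0 H); auto; lra).
  unfold Rdiv. apply Rmult_le_compat.
  - apply Rmult_le_pos. lra. apply Cmod_ge_0.
  - left. apply Rinv_0_lt_compat. nra.
  - apply Rmult_le_compat_l; auto. lra.
  - apply Rinv_le_contravar; nra.
Qed.

(** Along trajectories [q] satisfies a linear equation with bounded coefficient. By a Gronwall
    argument a zero of [q] would keep [q] small up to a late time, where [|q| >= 1] by [q_large]. *)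
Lemma q_neq_0 T0 z0 : region T0 z0 -> q T0 z0 <> 0.
Proof.
  intros Hr0 Hq0. destruct q_large as [T1 [HT1 Hlarge]].
  assert (HT0 : 0 <= T0) by apply Hr0. assert (Hz0 : Cmod z0 < 1) by apply Hr0.
  destruct (Rle_or_lt T1 T0) as [Hle|Hlt].
  { specialize (Hlarge T0 z0 Hle Hr0). rewrite Hq0, Cmod_0 in Hlarge. lra. }
  destruct (p_over_G_bound (Cmod z0) Hz0) as [L [HL HLb]].
  (* Chosen so that the bound reached at [T1] equals [1/2]. The rate [L + 1] instead of [L] leaves
     room for the Euler error, at most [y * h] in a step of length [h] where the current bound is
     [y]. *)
  set (eps := exp (- ((L + 1) * (T1 - T0))) / 2). assert (Heps : 0 < eps) by (apply Rdiv_lt_0_compat; [apply exp_pos|lra]).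
  destruct (flow_induction T0 T1 1 (fun T z w => inner T0 z0 T z /\ w = 0 /\ Cmod (q T z) <= eps * exp ((L + 1) * (T - T0))) z0 0)
    as [z [w [Hi [_ Hq]]]]; try lra.
  - split; [|split; auto]. apply inner_refl. rewrite Hq0, Cmod_0. left. apply Rmult_lt_0_compat; auto. apply exp_pos.
  - intros t z w Ht [Hi [-> _]]. rewrite Cmod_0. split; [|lra].
    apply Rle_trans with (Cmod z0); [|lra]. apply (inner_le H T0 z0 t); auto. lra.
  - intros t z w Hct Hcz Hcw Ht Hg.
    assert (Hin : inner T0 z0 (t None) (z None)).
    { apply inner_closed; auto. intros n. specialize (Ht n). lra. intros n; apply Hg. }
    split; [auto|split].
    + apply Cmod_le_eps_eq. intros e He. destruct (Hcw e He) as [d [Hd Hw]]. destruct (seqidx_small d Hd) as [N HN].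
      specialize (Hw (Some N) (HN N (Nat.le_refl N))). destruct (Hg N) as [_ [-> _]] in Hw.
      rewrite Cmod_sub_sym. lra.
    + apply (seqc_le (fun n => Cmod (q (t n) (z n))) (fun n => eps * exp ((L + 1) * (t n - T0)))).
      * apply cG_Cmod. apply (cG_chainq H); auto. apply (inner_region H T0 z0 (t None)) in Hin; auto. apply Hin. apply Ht.
      * apply (cG_real seqidx (fun x => eps * exp ((L + 1) * (x - T0))) t). exact Hct.
        apply ex_derive_continuity_pt. auto_derive. auto.
      * intros n. destruct (Hg n) as [_ [_ K]]. exact K.
  - intros t z w Ht [Hi [-> Hq]].
    assert (Hreg := inner_region H T0 z0 t z Hr0 (proj1 Ht) Hi).
    assert (Hzz : Cmod z <= Cmod z0) by (apply (inner_le H T0 z0 t); auto; lra).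
    assert (Hy : 0 < eps * exp ((L + 1) * (t - T0))) by (apply Rmult_lt_0_compat; auto; apply exp_pos).
    set (y := eps * exp ((L + 1) * (t - T0))) in *.
    assert (E1 := inner_step H T0 z0 t z Hr0 (proj1 Ht) Hi).
    assert (E2 := ev_deriv _ _ y (dR_chainq_euler H t z Hreg) Hy).
    destruct (ev_and _ _ E1 E2) as [d [Hd E]]. exists d. split; auto. intros h Hh.
    destruct (E h Hh) as [E3 E4]. exists (euler t z h), (RtoC 0). split; [auto|split; auto].
    rewrite euler_0, Rplus_0_r in E4. specialize (HLb t z Hreg Hzz).
    set (A := (a * cp H z / G t z)%C) in *.
    assert (E5 := Cmod_triangle_rev (q (t + h) (euler t z h)) (q t z + h * (A * q t z))).
    replace (q (t + h) (euler t z h) - (q t z + h * (A * q t z)))%C with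
      (q (t + h) (euler t z h) - q t z - h * (A * q t z))%C in E5 by ring.
    assert (E6 := Cmod_triangle (q t z) (h * (A * q t z))). rewrite Cmod_RtoC_mult, Cmod_mult, Rabs_pos_eq in E6 by lra.
    assert (E7 : Cmod A * Cmod (q t z) <= L * y) by (apply Rmult_le_compat; auto using Cmod_ge_0).
    assert (E8 : y * (1 + (L + 1) * h) <= eps * exp ((L + 1) * (t + h - T0))).
    { replace ((L + 1) * (t + h - T0)) with ((L + 1) * (t - T0) + (L + 1) * h) by ring. rewrite exp_plus, <- Rmult_assoc.
      apply Rmult_le_compat_l. apply Rlt_le, Hy. apply exp_ineq1_le. }
    assert (E9 : h * (Cmod A * Cmod (q t z)) <= h * (L * y)) by (apply Rmult_le_compat_l; lra). lra.
  - assert (Hreg := inner_region H T0 z0 T1 z Hr0 ltac:(lra) Hi).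
    specialize (Hlarge T1 z ltac:(lra) Hreg). unfold eps in Hq.
    replace (exp (- ((L + 1) * (T1 - T0))) / 2 * exp ((L + 1) * (T1 - T0))) with
      (exp (- ((L + 1) * (T1 - T0))) * exp ((L + 1) * (T1 - T0)) / 2) in Hq by field.
    rewrite <- exp_plus, Rplus_opp_l, exp_0 in Hq. lra.
Qed.

(** The zero-freeness at all earlier levels keeps [q] off the whole ray [(-oo, 0]]. *)
Lemma q_slit T z : region T z -> slit (q T z).
Proof.
  intros Hr. apply NNPP. intros Hn. apply slit_iff in Hn. destruct Hn as [Hn1 Hn2].
  set (r := - fst (q T z)). assert (Hr0 : 0 <= r) by (unfold r; lra).
  assert (Hq : q T z = RtoC (- r)). { apply C_ext; [|exact Hn1]. change (fst (q T z) = - r). unfold r. ring. }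
  (* As [1 - q] is proportional to [T] and equals [1 + r] here, it equals 1 at time [T / (1 + r)],
     where [q] would vanish. *)
  assert (HT : 0 <= T) by apply Hr. assert (Hc := c_neq_0 H).
  assert (HT' : 0 <= T / (1 + r) <= T).
  { split. apply Rdiv_le_0_compat; lra. apply Rle_div_l; nra. }
  apply (q_neq_0 (T / (1 + r)) z). { apply (region_mono H T); auto. }
  unfold chainq in *.
  assert (E1 : (a * T / c * cp H z)%C = (1 + r)%R).
  { rewrite RtoC_plus. transitivity (1 - RtoC (- r))%C. rewrite <- Hq. ring. rewrite RtoC_opp. ring. }
  assert (Hr1 : RtoC (1 + r) <> 0) by (intros E; apply RtoC_inj in E; lra).
  replace (a * (T / (1 + r))%R / c * cp H z)%C with (a * T / c * cp H z / (1 + r)%R)%C.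
  2: { rewrite RtoC_div by lra. field. auto. }
  rewrite E1. field. auto.
Qed.

(** The Loewner chain at time [T]; [z * vhat T z] is its characteristic field. *)
Definition chain_map (T : R) (z : C) : C := (f z * Cexp (s * Clog (q T z)))%C.
Local Notation Psi := chain_map.

Lemma Psi_at_0 z : Psi 0 z = f z.
Proof.
  unfold chain_map. rewrite q_at_0, Clog_1. replace (s * 0)%C with (RtoC 0) by ring. rewrite Cexp_0. ring.
Qed.

Lemma cG_logq {X} (i : X -> C) (t : X -> R) (w : X -> C) x : region (t x) (w x) ->
  cG i (fun y => RtoC (t y)) x -> cG i w x -> cG i (fun y => Clog (q (t y) (w y))) x.
Proof.
  intros Hr Ht Hw. apply (cG_comp i Clog (fun y => q (t y) (w y))). apply (cG_chainq H); auto. apply Hr.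
  apply cC_Clog, q_slit, Hr.
Qed.

Lemma cG_Psi {X} (i : X -> C) (t : X -> R) (w : X -> C) x : region (t x) (w x) ->
  cG i (fun y => RtoC (t y)) x -> cG i w x -> cG i (fun y => Psi (t y) (w y)) x.
Proof.
  intros Hr Ht Hw. apply cG_mult.
  - apply (cG_comp i f w); auto. eapply dG_cG. apply (f_deriv H). apply Hr.
  - apply (cG_comp i Cexp (fun y => s * Clog (q (t y) (w y)))%C).
    + apply cG_mult. apply cG_const. apply cG_logq; auto.
    + eapply dG_cG, dC_Cexp.
Qed.

Lemma dG_Psi {X} (i : X -> C) (t : X -> R) (w : X -> C) x (T1 w1 q1 : C) : region (t x) (w x) ->
  dG i w x w1 -> dG i (fun y => q (t y) (w y)) x q1 ->
  dG i (fun y => Psi (t y) (w y)) x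
    (Cexp (s * Clog (q (t x) (w x))) * (w1 * cf1 H (w x) + f (w x) * s * q1 / q (t x) (w x)))%C.
Proof.
  intros Hr Hw Hq. eapply dG_eq.
  - apply dG_mult.
    + apply (dG_comp i f w); eauto. apply (f_deriv H). apply Hr.
    + apply (dG_comp i Cexp (fun y => s * Clog (q (t y) (w y)))%C).
      * apply dG_scal. apply (dG_comp i Clog (fun y => q (t y) (w y))); eauto. apply dC_Clog, q_slit, Hr.
      * apply dC_Cexp.
  - cbv beta. unfold Cdiv. ring.
Qed.

(** The logarithmic derivative of [f] along the step is [p * vhat = - s a p / G], that of [q^s] is
    [s * (a p / G)], and the two cancel. *)
Lemma dR_Psi_euler T z : region T z -> dR (fun h => Psi (T + h) (euler T z h)) 0 0.
Proof.
  intros Hr. eapply dG_eq.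
  - apply (dG_Psi RtoC (fun h => T + h) (euler T z) 0 0 (z * vhat T z) (a * cp H z / G T z * q T z)).
    + rewrite euler_0, Rplus_0_r. auto.
    + apply dR_euler.
    + apply dR_chainq_euler; auto.
  - rewrite euler_0, Rplus_0_r. assert (Hz : Cmod z < 1) by apply Hr.
    rewrite (f1_p H z Hz), (f_lam H z Hz). unfold chain_speed. assert (HG := G_neq_0 H T z Hr). assert (Hq := q_neq_0 T z Hr).
    field. auto.
Qed.

Lemma v_lipschitz rho T1 : rho < 1 -> 0 <= T1 -> exists L, 0 < L /\ forall T z w, T <= T1 -> region T z -> region T w ->
  Cmod z <= rho -> Cmod w <= rho -> Cmod (z * vhat T z - w * vhat T w) <= L * Cmod (z - w).
Proof.
  intros Hrho HT1. destruct (derivD_lipschitz (cE H) (cE1 H) rho (E_deriv H) (E1_cont H) Hrho) as [M [HM HE]].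
  assert (Hs := s_pos H). set (g := (1 - k) * Cmod s). assert (Hg : 0 < g) by (apply Rmult_lt_0_compat; lra).
  exists (a * Cmod s * (/ g + a * T1 * M / (g * g))). split.
  { apply Rmult_lt_0_compat. nra. apply Rplus_lt_le_0_compat. apply Rinv_0_lt_compat; auto.
    apply Rdiv_le_0_compat; try nra. apply Rmult_le_pos; nra. }
  intros T z w HT Hz Hw Hzr Hwr. assert (HT0 : 0 <= T) by apply Hz.
  assert (HGz := G_neq_0 H T z Hz). assert (HGw := G_neq_0 H T w Hw).
  assert (Lz := G_lower H T z Hz). assert (Lw := G_lower H T w Hw). fold g in Lz, Lw.
  assert (Lz' : g <= Cmod (G T z)) by nra. assert (Lw' : g <= Cmod (G T w)) by nra.
  replace (z * vhat T z - w * vhat T w)%C with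
    ((- a)%R * s * ((z - w) / G T z + w * ((a * T)%R * (cE H w - cE H z)) / (G T z * G T w)))%C.
  2: { unfold chain_speed. rewrite RtoC_opp, RtoC_mult. unfold chainG in *. field. auto. }
  rewrite !Cmod_mult, Cmod_R, Rabs_Ropp, Rabs_pos_eq by lra.
  rewrite !Rmult_assoc. do 2 (apply Rmult_le_compat_l; [lra|]).
  apply Rle_trans with (1 := Cmod_triangle _ _).
  rewrite !Cmod_div, !Cmod_mult, Cmod_R by (auto; apply Cmult_neq_0; auto). rewrite (Rabs_pos_eq (a * T)) by nra.
  specialize (HE z w Hzr Hwr). rewrite (Cmod_sub_sym w z) in HE.
  assert (Hgg : 0 < g * g) by nra.
  assert (HGG : g * g <= Cmod (G T z) * Cmod (G T w)) by (apply Rmult_le_compat; lra).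
  set (D := Cmod (z - w)) in *. assert (HD : 0 <= D) by apply Cmod_ge_0.
  rewrite Rmult_plus_distr_r. apply Rplus_le_compat.
  - unfold Rdiv. rewrite Rmult_comm. apply Rmult_le_compat_r; auto. apply Rinv_le_contravar; auto.
  - apply Rle_trans with (1 * (a * T1 * (M * D)) / (g * g)).
    2: { right. field. lra. }
    unfold Rdiv. apply Rmult_le_compat.
    + apply Rmult_le_pos. apply Cmod_ge_0. apply Rmult_le_pos. nra. apply Cmod_ge_0.
    + left. apply Rinv_0_lt_compat. lra.
    + apply Rmult_le_compat. apply Cmod_ge_0. apply Rmult_le_pos. nra. apply Cmod_ge_0. lra.
      apply Rmult_le_compat; auto using Cmod_ge_0. nra. nra.
    + apply Rinv_le_contravar; lra.
Qed.

Lemma euler_displacement T z h : region T z -> 0 <= h -> Cmod (euler T z h - z) <= a / (1 - k) * h.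
Proof.
  intros Hr Hh. replace (euler T z h - z)%C with (h * (z * vhat T z))%C by (unfold chain_step; ring).
  rewrite Cmod_RtoC_mult, Cmod_mult, Rabs_pos_eq by auto.
  assert (H1 := vhat_bound H T z Hr). assert (H2 : Cmod z < 1) by apply Hr. assert (H3 := Cmod_ge_0 (vhat T z)).
  assert (H4 := Cmod_ge_0 z).
  assert (H5 : Cmod z * Cmod (vhat T z) <= 1 * (a / (1 - k))) by (apply Rmult_le_compat; lra).
  rewrite Rmult_1_l in H5. rewrite Rmult_comm. apply Rmult_le_compat_r; auto.
Qed.

(** The last inequality is Gronwall's estimate backwards in time: two trajectories cannot merge.
    Since [L] is fixed before [eps], the distance kept between them survives when the error tends to
    0. *)
Lemma flow_pair rho T1 : rho < 1 -> 0 <= T1 -> exists L, 0 < L /\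
  forall T0 z0 w0 eps, T0 <= T1 -> region T0 z0 -> region T0 w0 -> Cmod z0 <= rho -> Cmod w0 <= rho -> 0 < eps ->
  exists z w, inner T0 z0 T1 z /\ inner T0 w0 T1 w /\
    Cmod (Psi T1 z - Psi T0 z0) <= eps * (T1 - T0) /\ Cmod (Psi T1 w - Psi T0 w0) <= eps * (T1 - T0) /\
    Cmod (z - z0) <= a / (1 - k) * (T1 - T0) /\ Cmod (w - w0) <= a / (1 - k) * (T1 - T0) /\
    Cmod (z0 - w0) * exp (L * T0) <= Cmod (z - w) * exp (L * T1).
Proof.
  intros Hrho HT1. destruct (v_lipschitz rho T1 Hrho HT1) as [L [HL HLip]].
  exists (L + 1). split. lra. intros T0 z0 w0 eps HT01 Hz0 Hw0 Hz0r Hw0r Heps.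
  assert (HT0 : 0 <= T0) by apply Hz0. assert (HV : 0 < a / (1 - k)) by (apply Rdiv_lt_0_compat; lra).
  set (V := a / (1 - k)) in *.
  apply (flow_induction T0 T1 1 (fun T z w => inner T0 z0 T z /\ inner T0 w0 T w /\
    Cmod (Psi T z - Psi T0 z0) <= eps * (T - T0) /\ Cmod (Psi T w - Psi T0 w0) <= eps * (T - T0) /\
    Cmod (z - z0) <= V * (T - T0) /\ Cmod (w - w0) <= V * (T - T0) /\
    Cmod (z0 - w0) * exp ((L + 1) * T0) <= Cmod (z - w) * exp ((L + 1) * T)) z0 w0); auto.
  - assert (E : forall x : C, (x - x)%C = 0) by (intros; ring).
    rewrite !E, !Cmod_0. split; [|split]. apply inner_refl. apply inner_refl. repeat split; lra.
  - intros t z w Ht [Hz [Hw _]]. apply (inner_le H) in Hz; [|lra]. apply (inner_le H) in Hw; [|lra]. lra.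
  - intros t z w Hct Hcz Hcw Ht Hg.
    assert (Hin1 : inner T0 z0 (t None) (z None)).
    { apply inner_closed; auto. intros n. specialize (Ht n). lra. intros n; apply Hg. }
    assert (Hin2 : inner T0 w0 (t None) (w None)).
    { apply inner_closed; auto. intros n. specialize (Ht n). lra. intros n; apply Hg. }
    assert (Hr1 := inner_region H T0 z0 _ _ Hz0 (proj1 (Ht None)) Hin1).
    assert (Hr2 := inner_region H T0 w0 _ _ Hw0 (proj1 (Ht None)) Hin2).
    assert (Hlin : forall e : R, seqc (fun n => RtoC (e * (t n - T0)))).
    { intros e. apply (cG_real seqidx (fun x => e * (x - T0)) t). exact Hct.
      apply ex_derive_continuity_pt. auto_derive. auto. }
    assert (Hminus : forall (u : option nat -> C) v, seqc u -> seqc (fun n => u n - v)%C).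
    { intros u v Hu. apply cG_plus; auto. apply cG_const. }
    split; [auto|split; [auto|split; [|split; [|split; [|split]]]]].
    + apply (seqc_le (fun n => Cmod (Psi (t n) (z n) - Psi T0 z0)) (fun n => eps * (t n - T0))); auto.
      * apply cG_Cmod. apply (Hminus (fun n => Psi (t n) (z n))). apply cG_Psi; auto.
      * intros n; destruct (Hg n) as (?&?&?&?&?&?&?); assumption.
    + apply (seqc_le (fun n => Cmod (Psi (t n) (w n) - Psi T0 w0)) (fun n => eps * (t n - T0))); auto.
      * apply cG_Cmod. apply (Hminus (fun n => Psi (t n) (w n))). apply cG_Psi; auto.
      * intros n; destruct (Hg n) as (?&?&?&?&?&?&?); assumption.
    + apply (seqc_le (fun n => Cmod (z n - z0)) (fun n => V * (t n - T0))); auto.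
      * apply cG_Cmod. apply (Hminus z); auto.
      * intros n; destruct (Hg n) as (?&?&?&?&?&?&?); assumption.
    + apply (seqc_le (fun n => Cmod (w n - w0)) (fun n => V * (t n - T0))); auto.
      * apply cG_Cmod. apply (Hminus w); auto.
      * intros n; destruct (Hg n) as (?&?&?&?&?&?&?); assumption.
    + apply (seqc_le (fun _ => Cmod (z0 - w0) * exp ((L + 1) * T0)) (fun n => Cmod (z n - w n) * exp ((L + 1) * t n))).
      * apply cG_const.
      * apply cG_realmult. apply cG_Cmod. apply cG_plus; auto. apply (cG_comp _ Copp w); auto.
        eapply dG_cG. apply dG_opp, dG_param.
        apply (cG_real seqidx (fun x => exp ((L + 1) * x)) t). exact Hct.
        apply ex_derive_continuity_pt. auto_derive. auto.
      * intros n; destruct (Hg n) as (?&?&?&?&?&?&?); assumption.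
  - intros t z w Ht [Hz [Hw [G1 [G2 [G3 [G4 G5]]]]]].
    assert (Hr1 := inner_region H T0 z0 _ _ Hz0 (proj1 Ht) Hz).
    assert (Hr2 := inner_region H T0 w0 _ _ Hw0 (proj1 Ht) Hw).
    assert (Hzz : Cmod z <= Cmod z0) by (apply (inner_le H T0 z0 t); auto; lra).
    assert (Hww : Cmod w <= Cmod w0) by (apply (inner_le H T0 w0 t); auto; lra).
    assert (E1 := inner_step H T0 z0 t z Hz0 (proj1 Ht) Hz).
    assert (E2 := inner_step H T0 w0 t w Hw0 (proj1 Ht) Hw).
    assert (E3 := ev_deriv _ _ eps (dR_Psi_euler t z Hr1) Heps).
    assert (E4 := ev_deriv _ _ eps (dR_Psi_euler t w Hr2) Heps).
    (* This smallness gives both [h L < 1] and [(1 - h L) (1 + (L + 1) h) >= 1], so the possible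
       contraction of one step is outweighed by the factor [exp ((L + 1) h)]. *)
    assert (E5 := ev_small (/ (L * (L + 1) + L)) ltac:(apply Rinv_0_lt_compat; nra)).
    destruct (ev_and _ _ (ev_and _ _ E1 E2) (ev_and _ _ (ev_and _ _ E3 E4) E5)) as [d [Hd E]].
    exists d. split; auto. intros h Hh. destruct (E h Hh) as [[K1 K2] [[K3 K4] K5]].
    exists (euler t z h), (euler t w h). rewrite !euler_0, !Rplus_0_r in *.
    replace (Psi (t + h) (euler t z h) - Psi t z - h * 0)%C with (Psi (t + h) (euler t z h) - Psi t z)%C in K3 by ring.
    replace (Psi (t + h) (euler t w h) - Psi t w - h * 0)%C with (Psi (t + h) (euler t w h) - Psi t w)%C in K4 by ring.
    assert (D1 := euler_displacement t z h Hr1 ltac:(lra)). assert (D2 := euler_displacement t w h Hr2 ltac:(lra)). fold V in D1, D2.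
    split; [auto|split; [auto|split; [|split; [|split; [|split]]]]].
    + assert (K := Cmod_diff_triangle (Psi (t + h) (euler t z h)) (Psi t z) (Psi T0 z0)). lra.
    + assert (K := Cmod_diff_triangle (Psi (t + h) (euler t w h)) (Psi t w) (Psi T0 w0)). lra.
    + assert (K := Cmod_diff_triangle (euler t z h) z z0). lra.
    + assert (K := Cmod_diff_triangle (euler t w h) w w0). lra.
    + apply Rle_trans with (1 := G5).
      specialize (HLip t z w ltac:(lra) Hr1 Hr2 ltac:(lra) ltac:(lra)).
      assert (K := Cmod_triangle_rev (z - w) (- (h * (z * vhat t z - w * vhat t w)))).
      rewrite Cmod_opp, Cmod_RtoC_mult, Rabs_pos_eq in K by lra.
      replace (z - w - - (h * (z * vhat t z - w * vhat t w)))%C with (euler t z h - euler t w h)%C in K by (unfold chain_step; ring).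
      replace ((L + 1) * (t + h)) with ((L + 1) * t + (L + 1) * h) by ring. rewrite exp_plus.
      assert (X1 := exp_ineq1_le ((L + 1) * h)). assert (X2 := exp_pos ((L + 1) * t)).
      set (D := Cmod (z - w)) in *. assert (HD : 0 <= D) by apply Cmod_ge_0.
      assert (X3 : h * (L * (L + 1) + L) < 1).
      { apply Rmult_lt_compat_r with (r := L * (L + 1) + L) in K5; [|nra]. rewrite Rinv_l in K5; nra. }
      assert (X4 : D * (1 - h * L) <= Cmod (euler t z h - euler t w h)) by nra.
      assert (X5 : 1 <= (1 - h * L) * exp ((L + 1) * h)).
      { apply Rle_trans with ((1 - h * L) * (1 + (L + 1) * h)). nra. apply Rmult_le_compat_l; nra. }
      apply Rle_trans with (D * (1 - h * L) * (exp ((L + 1) * t) * exp ((L + 1) * h))).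
      * replace (D * (1 - h * L) * (exp ((L + 1) * t) * exp ((L + 1) * h))) with
          (D * exp ((L + 1) * t) * ((1 - h * L) * exp ((L + 1) * h))) by ring.
        rewrite <- (Rmult_1_r (D * exp ((L + 1) * t))) at 1. apply Rmult_le_compat_l; auto. nra.
      * apply Rmult_le_compat_r; auto. left. apply Rmult_lt_0_compat; auto. apply exp_pos.
Qed.

(** [log z + lam z + s log q] is conserved; the auxiliary point [W] follows the increments of [log z]. *)
Lemma lam_bounded : exists B, 0 < B /\ forall z, Cmod z < 1 -> Cmod (clam H z) <= B.
Proof.
  assert (Hm := mexp_bounds H). set (rho := Rpower 2 (- (a / 2))).
  assert (Hln2 : 0 < ln 2). { rewrite <- ln_1. apply ln_increasing; lra. }
  assert (Hlt1 : forall x, x < 0 -> Rpower 2 x < 1).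
  { intros x Hx. unfold Rpower. apply Rlt_le_trans with (exp 0); [|rewrite exp_0; lra]. apply exp_increasing. nra. }
  assert (Hrho : 0 < rho < 1) by (split; [apply exp_pos|apply Hlt1; lra]).
  assert (Hrho2 : rho * rho = Rpower 2 (- a)). { unfold rho. rewrite <- Rpower_plus. f_equal. field. }
  (* [rho] is the radius of the region at [T = 1], and [rho * r1 = 2^(-mexp/2)]: every trajectory
     started in the unit disc at time 0 ends in this fixed smaller disc, whatever its starting
     point. *)
  set (r1 := Rpower 2 ((a - mexp (a := a) (k := k)) / 2)).
  assert (Hr1 : 0 < r1 < 1) by (split; [apply exp_pos|apply Hlt1; lra]).
  assert (Hr2 : rho * r1 * (rho * r1) * Rpower 2 (mexp (a := a) (k := k)) = 1).
  { unfold rho, r1. rewrite <- !Rpower_plus. replace (- (a / 2) + (a - mexp (a := a) (k := k)) / 2 + (- (a / 2) + (a - mexp (a := a) (k := k)) / 2) + mexp (a := a) (k := k)) with 0 by field.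
    apply Rpower_O. lra. }
  assert (Hreg1 : forall z, Cmod z < 1 -> region 1 (rho * z)).
  { intros z Hz. assert (H0 := Cmod_ge_0 z). split; [lra|]. rewrite Cmod_RtoC_mult, Rabs_pos_eq by lra. split. nra.
    replace (1 + 1) with 2 by ring. rewrite <- Hrho2. simpl.
    apply Rle_trans with (rho * rho * (Cmod z * Cmod z)). right; ring.
    rewrite <- (Rmult_1_r (rho * rho)) at 2. apply Rmult_le_compat_l; nra. }
  (* Scaling by [rho] carries the region at [T = 1] to the unit disc, where boundedness on compact
     subsets is available. *)
  destruct (contD_bounded (fun z => Clog (q 1 (rho * z)%C)) r1) as [B1 [HB1 HB1']]; [|lra|].
  { intros z Hz. apply (cG_logq _ (fun _ => 1) (fun z => rho * z)%C); auto. apply cG_const.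
    eapply dG_cG, dG_scal, dG_param. }
  destruct (contD_bounded (clam H) (rho * r1)) as [B2 [HB2 HB2']]; [|nra|].
  { eapply derivD_contD, (lam_deriv H). }
  set (V := a / (1 - k)). assert (HV : 0 < V) by (apply Rdiv_lt_0_compat; lra).
  assert (Hs := s_pos H).
  exists (V + B2 + Cmod s * B1 + 1). split. nra.
  intros z0 Hz0. assert (Hr0 := region_0 (a := a) z0 Hz0).
  destruct (flow_induction 0 1 (1 + V) (fun T z W => inner 0 z0 T z /\ Cmod W <= V * T /\
    Cmod (W + clam H z + s * Clog (q T z) - clam H z0) <= 1 * T) z0 0) as [z [W [Hi [HW Hc]]]]; try lra.
  - split; [apply inner_refl|]. rewrite Cmod_0, q_at_0, Clog_1. split. lra.
    replace (0 + clam H z0 + s * 0 - clam H z0)%C with (RtoC 0) by ring. rewrite Cmod_0. lra.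
  - intros t z W Ht [Hi [HW _]]. assert (Cmod z <= Cmod z0) by (apply (inner_le H 0 z0 t); auto; lra). nra.
  - intros t z W Hct Hcz HcW Ht Hg.
    assert (Hin : inner 0 z0 (t None) (z None)).
    { apply inner_closed; auto. intros n. specialize (Ht n). lra. intros n; apply Hg. }
    assert (Hr := inner_region H 0 z0 _ _ Hr0 (proj1 (Ht None)) Hin).
    assert (Hlin : forall e : R, seqc (fun n => RtoC (e * t n))).
    { intros e. apply (cG_real seqidx (fun x => e * x) t). exact Hct. apply ex_derive_continuity_pt. auto_derive. auto. }
    split; [auto|split].
    + apply (seqc_le (fun n => Cmod (W n)) (fun n => V * t n)); auto.
      * apply cG_Cmod; auto.
      * intros n. destruct (Hg n) as (?&?&?); assumption.
    + apply (seqc_le (fun n => Cmod (W n + clam H (z n) + s * Clog (q (t n) (z n)) - clam H z0)) (fun n => 1 * t n)); auto.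
      * apply cG_Cmod. apply cG_plus; [|apply cG_const]. apply cG_plus. apply cG_plus; auto.
        apply (cG_comp _ (clam H) z); auto. eapply dG_cG, (lam_deriv H). apply Hr.
        apply cG_mult. apply cG_const. apply cG_logq; auto.
      * intros n. destruct (Hg n) as (?&?&?); assumption.
  - intros t z W Ht [Hz [HW HC]].
    assert (Hr := inner_region H 0 z0 _ _ Hr0 (proj1 Ht) Hz). assert (Hz1 : Cmod z < 1) by apply Hr.
    assert (E1 := inner_step H 0 z0 t z Hr0 (proj1 Ht) Hz).
    set (g := fun h : R => (W + h * vhat t z + clam H (euler t z h) + s * Clog (q (t + h) (euler t z h)) - clam H z0)%C).
    assert (Hg : dR g 0 0).
    { eapply dG_eq.
      - unfold g. apply dG_minus; [|apply dG_const]. apply dG_plus. apply dG_plus. apply dG_plus. apply dG_const.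
        apply dG_mult. apply dG_param. apply dG_const.
        apply (dG_comp RtoC (clam H) (euler t z)). apply dR_euler. rewrite euler_0. apply (lam_deriv H); auto.
        apply dG_scal. apply (dG_comp RtoC Clog (fun h => q (t + h) (euler t z h))). apply dR_chainq_euler; auto.
        rewrite euler_0, Rplus_0_r. apply dC_Clog, q_slit, Hr.
      - rewrite ?euler_0, ?Rplus_0_r. assert (Hq := q_neq_0 t z Hr). assert (HG := G_neq_0 H t z Hr).
        transitivity (vhat t z + vhat t z * (z * clam1 H z) + s * (a * cp H z / G t z))%C. field. auto.
        rewrite (lam1_p H) by auto. unfold chain_speed. field. auto. }
    destruct (ev_and _ _ E1 (ev_deriv g 0 1 Hg ltac:(lra))) as [d [Hd E]]. exists d. split; auto.
    intros h Hh. destruct (E h Hh) as [K1 K2]. exists (euler t z h), (W + h * vhat t z)%C.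
    split; [auto|split].
    + apply Rle_trans with (1 := Cmod_triangle _ _). rewrite Cmod_RtoC_mult, Rabs_pos_eq by lra.
      assert (Hv := vhat_bound H t z Hr). fold V in Hv. nra.
    + unfold g in K2. rewrite euler_0, Rplus_0_r in K2.
      set (A := (W + h * vhat t z + clam H (euler t z h) + s * Clog (q (t + h) (euler t z h)) - clam H z0)%C) in *.
      replace (W + 0 * vhat t z + clam H z + s * Clog (q t z) - clam H z0)%C with (W + clam H z + s * Clog (q t z) - clam H z0)%C in K2 by ring.
      set (D := (W + clam H z + s * Clog (q t z) - clam H z0)%C) in *.
      replace (A - D - h * 0)%C with (A - D)%C in K2 by ring.
      assert (K3 := Cmod_triangle_rev A D). lra.
  - assert (Hzr : Cmod z <= rho * r1).
    { unfold chain_disc in Hi. rewrite Rplus_0_r in Hi. replace (1 + 1) with 2 in Hi by ring.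
      assert (E1 : Rpower 1 (mexp (a := a) (k := k)) = 1) by (unfold Rpower; rewrite ln_1, Rmult_0_r; apply exp_0).
      rewrite E1 in Hi. assert (E2 := Cmod_ge_0 z). assert (E3 := Cmod_ge_0 z0). simpl in Hi.
      assert (E4 : 0 < Rpower 2 (mexp (a := a) (k := k))) by apply exp_pos.
      apply Rnot_lt_le. intros Hlt. assert (0 < rho * r1) by nra.
      assert (E5 : rho * r1 * (rho * r1) < Cmod z * Cmod z) by nra.
      apply (Rmult_lt_compat_r _ _ _ E4) in E5. rewrite Hr2 in E5. nra. }
    assert (Hz' : Cmod (z / rho) <= r1).
    { assert (RtoC rho <> 0) by (intros E; apply RtoC_inj in E; lra).
      rewrite Cmod_div, Cmod_R, Rabs_pos_eq by (auto; lra). apply Rle_div_l; lra. }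
    specialize (HB1' _ Hz'). cbv beta in HB1'. replace (rho * (z / rho))%C with z in HB1'.
    2: { field. intros E; apply RtoC_inj in E; lra. }
    specialize (HB2' z Hzr).
    replace (clam H z0) with (W + clam H z + s * Clog (q 1 z) - (W + clam H z + s * Clog (q 1 z) - clam H z0))%C by ring.
    apply Rle_trans with (1 := Cmod_minus_le _ _).
    apply Rle_trans with (1 := Rplus_le_compat_r _ _ _ (Cmod_triangle _ _)).
    apply Rle_trans with (1 := Rplus_le_compat_r _ _ _ (Rplus_le_compat_r _ _ _ (Cmod_triangle _ _))).
    rewrite Cmod_mult. assert (Cmod s * Cmod (Clog (q 1 z)) <= Cmod s * B1) by (apply Rmult_le_compat_l; lra). lra.
Qed.

End Flow.

(** * Growth of [f'] and [p] towards the circle *)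

Lemma ln_le_sub1 x : 0 < x -> ln x <= x - 1.
Proof. intros Hx. assert (H := exp_ineq1_le (ln x)). rewrite exp_ln in H; lra. Qed.

Section Growth.
Context {a b k : R} {c : C} {f : C -> C} (H : chain a b k c f).

Local Notation s := ((a, b) : C).
Local Notation G := (chainG H).
Local Notation q := (chainq H).
Local Notation region := (@region a).
Let Ha : 0 < a := ch_a H.
Let Hk : 0 <= k < 1 := ch_k H.

(** The solution [T] of [r ^ 2 = (1 + T) ^ (- a)]. *)
Definition front_time (r : R) : R := Rpower r (- (2 / a)) - 1.
Local Notation level := front_time.

Lemma level_region z : 0 < Cmod z < 1 -> region (level (Cmod z)) z.
Proof.
  intros Hz. set (r := Cmod z) in *. unfold front_time.
  assert (E : 1 + (Rpower r (- (2 / a)) - 1) = Rpower r (- (2 / a))) by ring.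
  split; [|split].
  - assert (1 <= Rpower r (- (2 / a))); [|lra]. unfold Rpower. rewrite <- exp_0.
    assert (Hln : ln r < 0) by (rewrite <- ln_1; apply ln_increasing; lra).
    assert (0 < 2 / a) by (apply Rdiv_lt_0_compat; lra). left. apply exp_increasing. nra.
  - fold r. lra.
  - fold r. rewrite E, Rpower_mult. replace (- (2 / a) * - a) with (INR 2) by (simpl; field; lra).
    rewrite Rpower_pow by lra. lra.
Qed.

Lemma level_lower r : 0 < r < 1 -> 2 * (1 - r) <= a * level r.
Proof.
  intros Hr. unfold front_time, Rpower. assert (E := exp_ineq1_le (- (2 / a) * ln r)). assert (E2 := ln_le_sub1 r ltac:(lra)).
  apply Rle_trans with (a * (- (2 / a) * ln r)). replace (a * (- (2 / a) * ln r)) with (- 2 * ln r) by (field; lra). lra.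
  apply Rmult_le_compat_l; lra.
Qed.

Lemma d_bound : Cmod (s + c) <= k * Cmod s.
Proof.
  assert (E := G_level H 0 0 (region_0 _ ltac:(rewrite Cmod_0; lra))). unfold chainG in E.
  rewrite <- Cmod_opp. replace (- (s + c))%C with (a * 0 * cE H 0 - c - s * (1 + 0))%C by ring. lra.
Qed.

(** The coefficient [k] comes from the level bound at the front time [T] of [|z|]: there [a T |E| <=
    k |s| (1 + T) + |s + c| + |s| T], the part free of [T] is at most [2 k |s|], and
    [a T >= 2 (1 - |z|)]. *)
Lemma E_bound z : 0 < Cmod z < 1 -> Cmod (cE H z) <= k * Cmod s / (1 - Cmod z) + 2 * Cmod s / a.
Proof.
  intros Hz. assert (Hr := level_region z Hz). assert (HT := level_lower _ Hz). set (r := Cmod z) in *. set (T := level r) in *.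
  assert (HT0 : 0 < a * T) by lra.
  assert (HTp : 0 <= T) by apply Hr.
  assert (E := G_level H T z Hr). assert (E2 := d_bound). assert (Hs := s_pos H). unfold chainG in E.
  assert (E3 : a * T * Cmod (cE H z) <= 2 * k * Cmod s + 2 * Cmod s * T).
  { replace (a * T * Cmod (cE H z)) with (Cmod ((a * T)%R * cE H z)).
    2: { rewrite Cmod_RtoC_mult, Rabs_pos_eq by lra. reflexivity. }
    replace ((a * T)%R * cE H z)%C with ((a * T * cE H z - c - s * (1 + T)) + (s + c) + T * s)%C by (rewrite RtoC_mult; ring).
    apply Rle_trans with (1 := Cmod_triangle _ _).
    apply Rle_trans with (1 := Rplus_le_compat_r _ _ _ (Cmod_triangle _ _)).
    rewrite Cmod_RtoC_mult, Rabs_pos_eq by auto.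
    assert (k * Cmod s * T <= Cmod s * T) by (apply Rmult_le_compat_r; nra). nra. }
  apply Rmult_le_reg_l with (1 := HT0). apply Rle_trans with (1 := E3).
  assert (E4 : 2 * k * Cmod s <= a * T * (k * Cmod s / (1 - r))).
  { apply Rle_trans with (2 * (1 - r) * (k * Cmod s / (1 - r))). right; field; lra.
    apply Rmult_le_compat_r; auto. apply Rdiv_le_0_compat; nra. }
  replace (a * T * (k * Cmod s / (1 - r) + 2 * Cmod s / a)) with (a * T * (k * Cmod s / (1 - r)) + 2 * Cmod s * T) by (field; lra).
  lra.
Qed.

Lemma eta1_bound : exists B, 0 < B /\ forall z, Cmod z < 1 -> Cmod (ceta1 H z) <= k / (1 - Cmod z) + B.
Proof.
  destruct (contD_bounded (ceta1 H) (1 / 2)) as [B1 [HB1 HB1']]; [apply (eta1_cont H)|lra|].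
  assert (Hs := s_pos H). set (K := 2 / a + / Cmod s). assert (HK : 0 < K).
  { apply Rplus_lt_0_compat. apply Rdiv_lt_0_compat; lra. apply Rinv_0_lt_compat; auto. }
  exists (B1 + 2 + 2 * K). split. lra. intros z Hz.
  (* Recovering [eta'] from [E = 1 + s z eta'] costs a division by [z], so small [|z|] are left to
     compactness. *)
  destruct (Rle_or_lt (Cmod z) (1 / 2)) as [Hle|Hlt].
  - specialize (HB1' z Hle). assert (0 <= k / (1 - Cmod z)) by (apply Rdiv_le_0_compat; lra). lra.
  - assert (E := E_bound z ltac:(lra)). set (r := Cmod z) in *.
    assert (Hz0 : z <> 0) by (apply Cmod_gt_0; fold r; lra).
    replace (ceta1 H z) with ((cE H z - 1) / (s * z))%C.
    2: { rewrite (E_eta H) by auto. field. split; auto. apply s_neq_0, Ha. }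
    rewrite Cmod_div by (apply Cmult_neq_0; auto; apply s_neq_0, Ha). rewrite Cmod_mult. fold r.
    apply Rle_div_l. nra.
    assert (E1 := Cmod_minus_le (cE H z) 1). rewrite Cmod_1 in E1.
    apply Rle_trans with (1 := E1).
    apply Rle_trans with (Cmod s * (k / (1 - r) + K)).
    { unfold K. replace (Cmod s * (k / (1 - r) + (2 / a + / Cmod s))) with (k * Cmod s / (1 - r) + 2 * Cmod s / a + 1) by (field; lra). lra. }
    replace ((k / (1 - r) + (B1 + 2 + 2 * K)) * (Cmod s * r)) with (Cmod s * ((k / (1 - r) + (B1 + 2 + 2 * K)) * r)) by ring.
    apply Rmult_le_compat_l. lra.
    replace ((k / (1 - r) + (B1 + 2 + 2 * K)) * r) with (k / (1 - r) - k + (B1 + 2 + 2 * K) * r) by (field; lra). nra.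
Qed.

Lemma eta_growth : exists B, 0 < B /\ forall z, Cmod z < 1 -> Cmod (ceta H z) <= - k * ln (1 - Cmod z) + B.
Proof.
  destruct eta1_bound as [B [HB HB1]]. exists (Cmod (ceta H 0) + B). split. assert (H0 := Cmod_ge_0 (ceta H 0)). lra.
  intros z Hz. assert (Hz0 := Cmod_ge_0 z). set (r := Cmod z) in *.
  assert (Htz : forall t, 0 <= t <= 1 -> Cmod (t * z) = t * r).
  { intros t Ht. rewrite Cmod_RtoC_mult, Rabs_pos_eq by lra. reflexivity. }
  assert (Hd : forall t, 0 <= t <= 1 -> dR (fun t => ceta H (t * z)%C) t (z * ceta1 H (t * z))%C).
  { intros t Ht. apply (dG_comp RtoC (ceta H) (fun t => t * z)%C). eapply dG_eq. apply dG_mult. apply dG_param. apply dG_const. cbv beta; ring.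
    apply (eta_deriv H). rewrite Htz; nra. }
  assert (HG : forall t, 0 <= t <= 1 -> is_derive (fun t => - k * ln (1 - t * r) + B * r * t) t (r * (k / (1 - t * r) + B))).
  { intros t Ht. auto_derive. nra. field. nra. }
  assert (E := dR_mvt (fun t => ceta H (t * z)%C) (fun t => z * ceta1 H (t * z))%C (fun t => - k * ln (1 - t * r) + B * r * t)
    (fun t => r * (k / (1 - t * r) + B)) 0 1 ltac:(lra)).
  cbv beta in E. replace (0 * z)%C with (RtoC 0) in E by ring. replace (1 * z)%C with z in E by ring.
  rewrite Rmult_0_l, Rminus_0_r, ln_1, Rmult_1_l in E.
  assert (E1 := Cmod_triangle_rev (ceta H z) (ceta H 0)).
  assert (E2 : Cmod (ceta H z - ceta H 0) <= - k * ln (1 - r) + B * r * 1 - (- k * 0 + B * r * 0)).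
  { apply E.
    - intros t Ht. split; [|split]. apply Hd; lra. apply HG; lra.
      rewrite Cmod_mult. fold r. apply Rmult_le_compat_l; auto. rewrite <- Htz by lra. apply HB1. rewrite Htz; nra.
    - intros t Ht. split. eapply dG_cG, Hd; lra. apply ex_derive_continuity_pt. eexists. apply HG; auto. }
  nra.
Qed.

Lemma growth : exists B, 0 < B /\ forall z, Cmod z < 1 ->
  Cmod (cf1 H z) <= B * Rpower (1 - Cmod z) (- k) /\ Cmod (cp H z) <= B * Rpower (1 - Cmod z) (- k) /\ Cmod (f z) <= B.
Proof.
  destruct eta_growth as [B1 [HB1 He]]. destruct (lam_bounded H) as [B2 [HB2 Hl]].
  set (K := B1 + Cmod (1 / s - 1) * B2). assert (HK : 0 < K) by (unfold K; assert (H0 := Cmod_ge_0 (1 / s - 1)); nra).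
  exists (exp K * exp B2). assert (HeK := exp_pos K). assert (HeB := exp_pos B2). split. nra.
  assert (He1 : forall x, 0 < x -> 1 <= exp x) by (intros x Hx; assert (E := exp_ineq1_le x); lra).
  assert (H1 := He1 K HK). assert (H2 := He1 B2 HB2).
  intros z Hz. specialize (He z Hz). specialize (Hl z Hz).
  assert (HR : 0 < Rpower (1 - Cmod z) (- k)) by apply exp_pos.
  assert (Hexp : forall u v, fst u <= v -> Cmod (Cexp u) <= exp v).
  { intros u v Huv. rewrite Cmod_Cexp. destruct (Req_dec (fst u) v) as [->|]. lra. left. apply exp_increasing. lra. }
  assert (E1 : Cmod (cf1 H z) <= exp K * Rpower (1 - Cmod z) (- k)).
  { rewrite (f1_nu H) by auto. unfold Rpower. rewrite <- exp_plus. apply Hexp.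
    apply Rle_trans with (Cmod (cnu H z)). { apply Rle_trans with (1 := Rle_abs _). apply fst_le_Cmod. }
    rewrite (eta_nu H) by auto. apply Rle_trans with (1 := Cmod_minus_le _ _). rewrite Cmod_mult.
    assert (Cmod (1 / s - 1) * Cmod (clam H z) <= Cmod (1 / s - 1) * B2) by (apply Rmult_le_compat_l; [apply Cmod_ge_0|auto]).
    unfold K. lra. }
  split; [|split].
  - apply Rle_trans with (1 := E1). apply Rmult_le_compat_r. lra. nra.
  - replace (cp H z) with (cf1 H z * Cexp (- clam H z))%C.
    2: { rewrite (f1_p H) by auto. rewrite Cexp_opp. field. apply Cexp_neq_0. }
    rewrite Cmod_mult. replace (exp K * exp B2 * Rpower (1 - Cmod z) (- k)) with (exp K * Rpower (1 - Cmod z) (- k) * exp B2) by ring.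
    apply Rmult_le_compat; auto using Cmod_ge_0. apply Hexp.
    apply Rle_trans with (Cmod (- clam H z)). { apply Rle_trans with (1 := Rle_abs _). apply fst_le_Cmod. }
    rewrite Cmod_opp. auto.
  - rewrite (f_lam H) by auto. rewrite Cmod_mult.
    assert (E2 : Cmod (Cexp (clam H z)) <= exp B2).
    { apply Hexp. apply Rle_trans with (Cmod (clam H z)); auto. apply Rle_trans with (1 := Rle_abs _). apply fst_le_Cmod. }
    assert (E3 := Cmod_ge_0 (Cexp (clam H z))). assert (E4 := Cmod_ge_0 z). nra.
Qed.

End Growth.

Lemma Rpower_small (e m : R) : 0 < e -> 0 < m -> exists d, 0 < d /\ forall x, 0 < x <= d -> Rpower x m <= e.
Proof.
  intros He Hm. exists (Rpower e (/ m)). split. apply exp_pos. intros x Hx.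
  replace e with (Rpower (Rpower e (/ m)) m). 2: { rewrite Rpower_mult, Rinv_l by lra. apply Rpower_1; auto. }
  apply Rle_Rpower_l; lra.
Qed.

Lemma Rpower_mono_base (x y m : R) : 0 < x <= y -> 0 <= m -> Rpower x m <= Rpower y m.
Proof. intros Hxy Hm. apply Rle_Rpower_l; auto. Qed.

(** * The extension *)

Section Extension.
Context {a b k : R} {c : C} {f : C -> C} (H : chain a b k c f).

Local Notation s := ((a, b) : C).
Local Notation G := (chainG H).
Local Notation q := (chainq H).
Local Notation Psi := (chain_map H).
Local Notation region := (@region a).
Local Notation level := (@front_time a).
Let Ha : 0 < a := ch_a H.
Let Hk : 0 <= k < 1 := ch_k H.

(** Integration of the bound for [f'] along a radius; [k < 1] makes [(1 - t)^(-k)] integrable up to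
    the circle. *)
Lemma radial_bound : exists B, 0 < B /\ forall u r r', Cmod u = 1 -> 0 <= r <= r' -> r' < 1 ->
  Cmod (f (r' * u)%C - f (r * u)%C) <= B * Rpower (1 - r) (1 - k).
Proof.
  destruct (growth H) as [B [HB HB1]]. exists (B / (1 - k)). split. apply Rdiv_lt_0_compat; lra.
  intros u r r' Hu Hr Hr'.
  assert (Hm : forall t, 0 <= t -> Cmod (t * u) = t).
  { intros t Ht. rewrite Cmod_RtoC_mult, Rabs_pos_eq, Hu by lra. ring. }
  assert (Hd : forall t, 0 <= t < 1 -> dR (fun t => f (t * u)%C) t (u * cf1 H (t * u))%C).
  { intros t Ht. apply (dG_comp RtoC f (fun t => t * u)%C). eapply dG_eq. apply dG_mult. apply dG_param. apply dG_const. cbv beta; ring.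
    apply (f_deriv H). rewrite Hm; lra. }
  assert (HG : forall t, 0 <= t < 1 -> is_derive (fun t => - (B / (1 - k)) * Rpower (1 - t) (1 - k)) t (B * Rpower (1 - t) (- k))).
  { intros t Ht. unfold Rpower. auto_derive. lra.
    replace ((1 - k) * ln (1 + - t)) with (- k * ln (1 - t) + ln (1 - t)) by (unfold Rminus; ring).
    rewrite exp_plus, exp_ln by lra. field. lra. }
  assert (E := dR_mvt (fun t => f (t * u)%C) (fun t => u * cf1 H (t * u))%C (fun t => - (B / (1 - k)) * Rpower (1 - t) (1 - k))
    (fun t => B * Rpower (1 - t) (- k)) r r' ltac:(lra)). cbv beta in E.
  apply Rle_trans with (- (B / (1 - k)) * Rpower (1 - r') (1 - k) - - (B / (1 - k)) * Rpower (1 - r) (1 - k)).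
  - apply E.
    + intros t Ht. split; [apply Hd; lra|split; [apply HG; lra|]]. rewrite Cmod_mult, Hu, Rmult_1_l.
      rewrite <- (Hm t) at 2 by lra. apply HB1. rewrite Hm; lra.
    + intros t Ht. split. eapply dG_cG, Hd; lra. apply ex_derive_continuity_pt. eexists. apply HG; lra.
  - assert (0 < B / (1 - k) * Rpower (1 - r') (1 - k)). { apply Rmult_lt_0_compat. apply Rdiv_lt_0_compat; lra. apply exp_pos. } lra.
Qed.

(** The radial limit of [f] at [u]; the universally quantified [B] lets the limit inherit whatever
    constant the radial estimate holds with. *)
Definition bdry (u : C) : C := epsilon (inhabits (RtoC 0)) (fun L => forall B,
  (forall u r r', Cmod u = 1 -> 0 <= r <= r' -> r' < 1 -> Cmod (f (r' * u)%C - f (r * u)%C) <= B * Rpower (1 - r) (1 - k)) ->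
  forall r, 0 <= r < 1 -> Cmod (L - f (r * u)%C) <= B * Rpower (1 - r) (1 - k)).

Lemma bdry_spec B u r : (forall u r r', Cmod u = 1 -> 0 <= r <= r' -> r' < 1 -> Cmod (f (r' * u)%C - f (r * u)%C) <= B * Rpower (1 - r) (1 - k)) ->
  Cmod u = 1 -> 0 <= r < 1 -> Cmod (bdry u - f (r * u)%C) <= B * Rpower (1 - r) (1 - k).
Proof.
  intros HB Hu Hr. revert B HB r Hr. unfold bdry.
  apply (epsilon_spec (inhabits (RtoC 0)) (fun L => forall B,
  (forall u r r', Cmod u = 1 -> 0 <= r <= r' -> r' < 1 -> Cmod (f (r' * u)%C - f (r * u)%C) <= B * Rpower (1 - r) (1 - k)) ->
  forall r, 0 <= r < 1 -> Cmod (L - f (r * u)%C) <= B * Rpower (1 - r) (1 - k))).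
  destruct (growth H) as [M [HM HM1]].
  assert (Hrn : forall n : nat, 0 <= 1 - / (INR n + 1) < 1).
  { intros n. assert (H0 := pos_INR n). assert (0 < / (INR n + 1)) by (apply Rinv_0_lt_compat; lra).
    assert (/ (INR n + 1) <= / 1) by (apply Rinv_le_contravar; lra). lra. }
  destruct (C_subseq (fun n : nat => f ((1 - / (INR n + 1))%R * u)%C) M) as [phi [L [Hphi HL]]].
  { intros n. apply HM1. rewrite Cmod_RtoC_mult, Hu, Rabs_pos_eq; specialize (Hrn n); lra. }
  exists L. intros B HB r Hr. apply Rle_plus_epsilon. intros eps Heps.
  destruct (HL eps Heps) as [N1 HN1]. destruct (archimed_cor1 (1 - r)) as [N2 [HN2 HN2']]. lra.
  set (n := max N1 N2). specialize (HN1 n ltac:(lia)). assert (Hn := incr_ge phi Hphi n).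
  assert (Hrr : r <= 1 - / (INR (phi n) + 1)).
  { assert (/ (INR (phi n) + 1) <= / INR N2); [|lra]. apply Rinv_le_contravar. apply lt_0_INR; auto.
    assert (INR N2 <= INR (phi n)) by (apply le_INR; lia). lra. }
  specialize (HB u r (1 - / (INR (phi n) + 1)) Hu ltac:(lra) (proj2 (Hrn (phi n)))).
  assert (E := Cmod_diff_triangle L (f ((1 - / (INR (phi n) + 1))%R * u)%C) (f (r * u)%C)).
  cbv beta in HN1. rewrite (Cmod_sub_sym _ L) in HN1. lra.
Qed.

(** Outside the disc the extension follows the chain from the reflected point [outw z], at the time
    [outT z] when that point is on the boundary of the region. *)
Definition outer_time (z : C) : R := level (/ Cmod z).
Local Notation outT := outer_time.
Definition outw (z : C) : C := (/ Cconj z)%C.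

Lemma Cmod_outw (z : C) : z <> 0 -> Cmod (outw z) = / Cmod z.
Proof.
  intros Hz. unfold outw. rewrite Cmod_inv, Cmod_conj; auto.
  apply Cmod_nz. rewrite Cmod_conj. apply Cmod_pos; auto.
Qed.

Lemma out_bounds (z : C) : 1 < Cmod z -> 0 < Cmod (outw z) < 1.
Proof.
  intros Hz. rewrite Cmod_outw by (apply Cmod_gt_0; lra). split. apply Rinv_0_lt_compat; lra.
  rewrite <- Rinv_1. apply Rinv_lt_contravar; lra.
Qed.

Lemma outT_level (z : C) : 1 < Cmod z -> outT z = level (Cmod (outw z)).
Proof. intros Hz. rewrite Cmod_outw by (apply Cmod_gt_0; lra). reflexivity. Qed.

Lemma out_region (z : C) : 1 < Cmod z -> region (outT z) (outw z).
Proof. intros Hz. rewrite outT_level by auto. apply (level_region H), out_bounds, Hz. Qed.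

Definition ext (z : C) : C :=
  if Rlt_dec (Cmod z) 1 then f z else if Rlt_dec 1 (Cmod z) then Psi (outT z) (outw z) else bdry z.

Lemma ext_in (z : C) : Cmod z < 1 -> ext z = f z.
Proof. intros Hz. unfold ext. destruct (Rlt_dec (Cmod z) 1); tauto. Qed.

Lemma ext_out (z : C) : 1 < Cmod z -> ext z = Psi (outT z) (outw z).
Proof.
  intros Hz. unfold ext. destruct (Rlt_dec (Cmod z) 1). lra. destruct (Rlt_dec 1 (Cmod z)); tauto.
Qed.

Lemma ext_circle (z : C) : Cmod z = 1 -> ext z = bdry z.
Proof.
  intros Hz. unfold ext. destruct (Rlt_dec (Cmod z) 1). lra. destruct (Rlt_dec 1 (Cmod z)). lra. auto.
Qed.

Lemma level_upper : exists K, 0 < K /\ forall r, 1 / 2 <= r < 1 -> level r <= K * (1 - r).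
Proof.
  set (K := exp (2 / a)). assert (HK : 0 < K) by apply exp_pos.
  exists (4 / a * K). split. apply Rmult_lt_0_compat; auto. apply Rdiv_lt_0_compat; lra.
  intros r Hr. unfold front_time, Rpower. set (x := - (2 / a) * ln r).
  assert (E1 := ln_le_sub1 (/ r) ltac:(apply Rinv_0_lt_compat; lra)). rewrite ln_Rinv in E1 by lra.
  assert (E2 : / r - 1 <= 2 * (1 - r)).
  { apply Rmult_le_reg_r with r. lra. rewrite Rmult_minus_distr_r, Rinv_l by lra. nra. }
  assert (Ha2 : 0 < 2 / a) by (apply Rdiv_lt_0_compat; lra).
  assert (Hx : x <= 4 / a * (1 - r)).
  { unfold x. replace (4 / a * (1 - r)) with (2 / a * (2 * (1 - r))) by (field; lra). nra. }
  assert (Hx0 : 0 <= x). { unfold x. assert (ln r <= 0). { rewrite <- ln_1. destruct (Req_dec r 1) as [->|]. lra. left; apply ln_increasing; lra. } nra. }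
  assert (Hx2 : x <= 2 / a). { apply Rle_trans with (1 := Hx). replace (2 / a) with (4 / a * (1 / 2)) by (field; lra).
    apply Rmult_le_compat_l. replace (4 / a) with (2 * (2 / a)) by (field; lra). lra. lra. }
  assert (Hex : exp x <= K). { unfold K. destruct (Req_dec x (2 / a)) as [->|]. lra. left; apply exp_increasing; lra. }
  assert (E3 : exp x - 1 <= x * exp x).
  { assert (E4 := exp_ineq1_le (- x)). assert (E5 : exp x * exp (- x) = 1) by (rewrite <- exp_plus, Rplus_opp_r; apply exp_0).
    assert (0 < exp x) by apply exp_pos. nra. }
  apply Rle_trans with (1 := E3). replace (4 / a * K * (1 - r)) with (4 / a * (1 - r) * K) by ring.
  apply Rmult_le_compat; auto. left; apply exp_pos.
Qed.

(** Here [1 - q = (a T / c) p] with [T = O(1 - |w|)] at the front time and [p = O((1 - |w|)^(-k))].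
    So [q] tends to 1, and [Psi] fits together with [f] at the circle. *)
Lemma q_near_circle : exists K, 0 < K /\ forall w, 1 / 2 <= Cmod w < 1 ->
  Cmod (q (level (Cmod w)) w - 1) <= K * Rpower (1 - Cmod w) (1 - k).
Proof.
  destruct (growth H) as [B [HB HB1]]. destruct level_upper as [K [HK HK1]].
  assert (Hc := Cmod_pos c (c_neq_0 H)).
  exists (a * K / Cmod c * B). split. { apply Rmult_lt_0_compat; auto. apply Rdiv_lt_0_compat; nra. }
  intros w Hw. specialize (HK1 (Cmod w) Hw). destruct (HB1 w (proj2 Hw)) as [_ [E _]].
  assert (HT0 : 0 <= level (Cmod w)) by (apply (level_region H w); lra).
  set (T := level (Cmod w)) in *. set (x := 1 - Cmod w) in *. assert (Hx : 0 < x) by (unfold x; lra).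
  replace (q T w - 1)%C with (- (a * T / c * cp H w))%C by (unfold chainq, Cdiv; ring).
  rewrite Cmod_opp, Cmod_mult, <- RtoC_mult, Cmod_div, Cmod_R, Rabs_pos_eq by (try apply (c_neq_0 H); nra).
  replace (1 - k) with (1 + - k) by ring. rewrite Rpower_plus, Rpower_1 by auto.
  replace (a * K / Cmod c * B * (x * Rpower x (- k))) with (a * (K * x) / Cmod c * (B * Rpower x (- k))) by (field; lra).
  apply Rmult_le_compat; auto using Cmod_ge_0. apply Rdiv_le_0_compat; nra.
  apply Rmult_le_compat_r. left; apply Rinv_0_lt_compat; auto. nra.
Qed.

Lemma slit_1 : slit 1.
Proof. unfold slit. rewrite Cmod_1. simpl. lra. Qed.

Lemma Psi_near_circle eps : 0 < eps -> exists r0, 1 / 2 <= r0 < 1 /\ forall w, r0 <= Cmod w < 1 ->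
  Cmod (Psi (level (Cmod w)) w - f w) <= eps.
Proof.
  intros Heps. destruct (growth H) as [B [HB HB1]]. destruct q_near_circle as [K [HK HK1]].
  assert (Hcont : cC (fun u => Cexp (s * Clog u)) 1).
  { apply (cG_comp _ Cexp (fun u => s * Clog u)%C). apply cG_mult. apply cG_const. apply cC_Clog, slit_1. eapply dG_cG, dC_Cexp. }
  destruct (Hcont (eps / B)) as [d [Hd Hc]]. { apply Rdiv_lt_0_compat; auto. }
  destruct (Rpower_small (d / (2 * K)) (1 - k)) as [x0 [Hx0 Hx]]. { apply Rdiv_lt_0_compat; lra. } lra.
  exists (Rmax (1 / 2) (1 - x0)). split. { split. apply Rmax_l. apply Rmax_lub_lt; lra. }
  intros w Hw. assert (Hw1 := Rle_trans _ _ _ (Rmax_l _ _) (proj1 Hw)). assert (Hw2 := Rle_trans _ _ _ (Rmax_r _ _) (proj1 Hw)).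
  specialize (HK1 w ltac:(lra)). specialize (Hx (1 - Cmod w) ltac:(lra)).
  specialize (Hc (q (level (Cmod w)) w)).
  assert (E : K * Rpower (1 - Cmod w) (1 - k) <= d / 2).
  { replace (d / 2) with (K * (d / (2 * K))) by (field; lra). apply Rmult_le_compat_l; lra. }
  specialize (Hc ltac:(lra)). rewrite Clog_1 in Hc. replace (s * 0)%C with (RtoC 0) in Hc by ring. rewrite Cexp_0 in Hc.
  unfold chain_map. set (u := Cexp (s * Clog (q (level (Cmod w)) w))) in *.
  replace (f w * u - f w)%C with (f w * (u - 1))%C by ring. rewrite Cmod_mult.
  replace eps with (B * (eps / B)) by (field; lra). apply Rmult_le_compat; auto using Cmod_ge_0. apply HB1; lra. lra.
Qed.

Definition dir (z : C) : C := (z * (/ Cmod z)%R)%C.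

Lemma Cmod_dir (z : C) : z <> 0 -> Cmod (dir z) = 1.
Proof.
  intros Hz. apply Cmod_pos in Hz. unfold dir. rewrite Cmod_mult, Cmod_R, Rabs_pos_eq. field. lra.
  left. apply Rinv_0_lt_compat; auto.
Qed.

Lemma dir_eq (z : C) : z <> 0 -> z = (Cmod z * dir z)%C.
Proof.
  intros Hz. apply Cmod_pos in Hz. unfold dir. rewrite RtoC_inv by lra. field. intros E; apply RtoC_inj in E; lra.
Qed.

Lemma outw_dir (z : C) : z <> 0 -> outw z = ((/ Cmod z)%R * dir z)%C.
Proof.
  intros Hz. assert (Hm := Cmod_pos z Hz). unfold outw, dir.
  assert (Hcj : Cconj z <> 0). { apply Cmod_gt_0. rewrite Cmod_conj. auto. }
  assert (E : (z * Cconj z)%C = (Cmod z * Cmod z)%R).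
  { rewrite Cmod_sqr. destruct z as [x y]. apply C_ext; simpl; ring. }
  rewrite RtoC_inv by lra. rewrite RtoC_mult in E.
  assert (RtoC (Cmod z) <> 0) by (intros F; apply RtoC_inj in F; lra).
  transitivity (z * Cconj z * / Cconj z * (/ Cmod z * / Cmod z))%C. rewrite E. field. auto. field. auto.
Qed.

(** One estimate serves the inside, the circle and the outside: near the circle [ext z] is close to
    the value of [f] at the radial projection of [z] to a fixed inner circle, where [f] is
    continuous. The condition [r0 * Cmod z <= 1] puts the reflected point of an exterior [z] beyond
    that inner circle. *)
Lemma ext_radial eps : 0 < eps -> exists r0, 1 / 2 <= r0 < 1 /\ forall z, r0 <= Cmod z -> r0 * Cmod z <= 1 ->
  Cmod (ext z - f (r0 * dir z)%C) <= eps.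
Proof.
  intros Heps. destruct (Psi_near_circle (eps / 2)) as [r1 [Hr1 HP]]. lra.
  destruct radial_bound as [B [HB HR]].
  destruct (Rpower_small (eps / (2 * B)) (1 - k)) as [x0 [Hx0 Hx]]. { apply Rdiv_lt_0_compat; lra. } lra.
  assert (Hx0' : 0 < Rmin x0 (1 / 2)) by (apply Rmin_glb_lt; lra).
  set (r0 := Rmax r1 (1 - Rmin x0 (1 / 2))).
  assert (Hr0 : r1 <= r0) by apply Rmax_l. assert (Hr0' : 1 - Rmin x0 (1 / 2) <= r0) by apply Rmax_r.
  assert (Hr0'' : r0 < 1) by (apply Rmax_lub_lt; lra).
  assert (Hm := Rmin_l x0 (1 / 2)).
  exists r0. split. lra. intros z Hz1 Hz2.
  assert (Hz0 : z <> 0) by (apply Cmod_gt_0; lra). assert (Hdir := Cmod_dir z Hz0).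
  assert (HBe : B * Rpower (1 - r0) (1 - k) <= eps / 2).
  { replace (eps / 2) with (B * (eps / (2 * B))) by (field; lra). apply Rmult_le_compat_l. lra. apply Hx. lra. }
  destruct (Rtotal_order (Cmod z) 1) as [Hlt|[He|Hgt]].
  - rewrite ext_in by auto. rewrite (dir_eq z Hz0) at 1. apply Rle_trans with (eps / 2); [|lra].
    apply Rle_trans with (2 := HBe). apply HR; auto; lra.
  - rewrite ext_circle by auto. replace (dir z) with z. apply Rle_trans with (eps / 2); [|lra].
    apply Rle_trans with (2 := HBe). apply bdry_spec; auto; lra.
    rewrite (dir_eq z Hz0) at 1. rewrite He. ring.
  - rewrite ext_out by auto. rewrite outT_level by auto.
    assert (Hm1 : Cmod (outw z) = / Cmod z) by (apply Cmod_outw; auto).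
    assert (Hb := out_bounds z Hgt).
    assert (Hr : r0 <= Cmod (outw z)). { rewrite Hm1. apply Rmult_le_reg_r with (Cmod z). lra. rewrite Rinv_l; lra. }
    specialize (HP (outw z) ltac:(lra)).
    assert (E : Cmod (f (outw z) - f (r0 * dir z)%C) <= eps / 2).
    { rewrite outw_dir by auto. rewrite <- Hm1. apply Rle_trans with (2 := HBe). apply HR; auto; lra. }
    assert (E2 := Cmod_diff_triangle (Psi (level (Cmod (outw z))) (outw z)) (f (outw z)) (f (r0 * dir z)%C)). lra.
Qed.

Lemma cC_inv_Cmod (z : C) : z <> 0 -> cC (fun z => RtoC (/ Cmod z)) z.
Proof.
  intros Hz. apply Cmod_pos in Hz. apply (cG_real _ Rinv Cmod). apply cC_Cmod.
  apply ex_derive_continuity_pt. auto_derive. lra.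
Qed.

Lemma cC_dir (z : C) : z <> 0 -> cC dir z.
Proof. intros Hz. apply cG_mult. eapply dG_cG, dG_param. apply cC_inv_Cmod, Hz. Qed.

Lemma cC_outw (z : C) : z <> 0 -> cC outw z.
Proof.
  intros Hz eps Heps. assert (Hc : cC (fun z => (RtoC (/ Cmod z) * dir z)%C) z).
  { apply cG_mult. apply cC_inv_Cmod, Hz. apply cC_dir, Hz. }
  destruct (Hc eps Heps) as [d [Hd H1]]. exists (Rmin d (Cmod z)). split. apply Rmin_glb_lt; auto. apply Cmod_pos, Hz.
  intros y Hy. rewrite !outw_dir; auto. apply H1. apply Rlt_le_trans with (1 := Hy), Rmin_l.
  intros ->. replace (0 - z)%C with (- z)%C in Hy by ring. rewrite Cmod_opp in Hy. assert (H2 := Rmin_r d (Cmod z)). lra.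
Qed.

Lemma cC_outT (z : C) : z <> 0 -> cC (fun z => RtoC (outT z)) z.
Proof.
  intros Hz. assert (Hz' := Cmod_pos z Hz). apply (cG_real _ (fun x => level (/ x)) Cmod). apply cC_Cmod.
  apply ex_derive_continuity_pt. unfold front_time, Rpower. auto_derive. split. lra. split; auto. apply Rinv_0_lt_compat. lra.
Qed.

Lemma cG_ext_loc {X} (i g h : X -> C) x d : 0 < d -> (forall y, Cmod (i y - i x) < d -> g y = h y) ->
  cG i g x -> cG i h x.
Proof.
  intros Hd Hgh Hg eps Heps. destruct (Hg eps Heps) as [d' [Hd' H']]. exists (Rmin d d'). split. apply Rmin_glb_lt; auto.
  intros y Hy. rewrite <- !Hgh. apply H'. apply Rlt_le_trans with (1 := Hy), Rmin_r.
  replace (i x - i x)%C with (RtoC 0) by ring. rewrite Cmod_0; auto.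
  apply Rlt_le_trans with (1 := Hy), Rmin_l.
Qed.

Lemma outside_open (z y : C) : 1 < Cmod z -> Cmod (y - z) < Cmod z - 1 -> 1 < Cmod y.
Proof. intros Hz Hy. assert (E := Cmod_triangle_rev z y). rewrite Cmod_sub_sym in E. lra. Qed.

Lemma ext_continuous (z : C) : cC ext z.
Proof.
  destruct (Rtotal_order (Cmod z) 1) as [Hlt|[He|Hgt]].
  - apply cG_ext_loc with (g := f) (d := 1 - Cmod z). lra.
    + intros y Hy. symmetry. apply ext_in. apply ball_in_disc with z; auto.
    + eapply dG_cG, (f_deriv H), Hlt.
  - intros eps Heps. destruct (ext_radial (eps / 4)) as [r0 [Hr0 Hr]]. lra.
    assert (Hz0 : z <> 0) by (apply Cmod_gt_0; lra).
    assert (Hc : cC (fun z => f (r0 * dir z)%C) z).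
    { apply (cG_comp _ f (fun z => r0 * dir z)%C). apply cG_mult. apply cG_const. apply cC_dir; auto.
      eapply dG_cG, (f_deriv H). rewrite Cmod_RtoC_mult, Cmod_dir, Rabs_pos_eq by (auto; lra). lra. }
    destruct (Hc (eps / 4)) as [d [Hd Hc1]]. lra.
    exists (Rmin d (1 - r0)). split. apply Rmin_glb_lt; lra. intros y Hy.
    assert (Hy1 := Rlt_le_trans _ _ _ Hy (Rmin_l _ _)). assert (Hy2 := Rlt_le_trans _ _ _ Hy (Rmin_r _ _)).
    assert (E1 := Cmod_triangle_rev y z). assert (E2 := Cmod_triangle_rev z y). rewrite Cmod_sub_sym in E2.
    assert (K1 := Hr z ltac:(lra) ltac:(nra)). assert (K2 := Hr y ltac:(lra) ltac:(nra)). specialize (Hc1 y Hy1).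
    assert (E3 := Cmod_diff_triangle (ext y) (f (r0 * dir y)%C) (ext z)).
    assert (E4 := Cmod_diff_triangle (f (r0 * dir y)%C) (f (r0 * dir z)%C) (ext z)).
    rewrite (Cmod_sub_sym (ext z)) in K1. lra.
  - apply cG_ext_loc with (g := fun y => Psi (outT y) (outw y)) (d := Cmod z - 1). lra.
    + intros y Hy. symmetry. apply ext_out. apply outside_open with z; auto.
    + assert (Hz0 : z <> 0) by (apply Cmod_gt_0; lra). apply (cG_Psi H). apply out_region; auto.
      apply cC_outT; auto. apply cC_outw; auto.
Qed.

End Extension.

Lemma Cconj_line (z e : C) (x : R) : Cconj (z + x * e) = (Cconj z + x * Cconj e)%C.
Proof. apply C_ext; simpl; ring. Qed.

Lemma Cmod_Cexp_le (s z : C) (m : R) : 0 < m -> m <= Cmod z <= / m ->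
  Cmod (Cexp (s * Clog z)) <= exp (Cmod s * (- ln m + PI)).
Proof.
  intros Hm Hz. rewrite Cmod_Cexp.
  assert (E : fst (s * Clog z)%C <= Cmod s * (- ln m + PI)).
  { apply Rle_trans with (Cmod (s * Clog z)). { apply Rle_trans with (1 := Rle_abs _). apply fst_le_Cmod. }
    rewrite Cmod_mult. apply Rmult_le_compat_l. apply Cmod_ge_0.
    apply Rle_trans with (1 := Cmod_le_abs _). unfold Clog. simpl.
    apply Rplus_le_compat.
    - assert (E1 : ln m <= ln (Cmod z)) by (destruct (Req_dec m (Cmod z)) as [->|]; [lra|left; apply ln_increasing; lra]).
      assert (E2 : ln (Cmod z) <= - ln m).
      { rewrite <- ln_Rinv by auto. destruct (Req_dec (Cmod z) (/ m)) as [->|]; [lra|left; apply ln_increasing; lra]. }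
      apply Rabs_le. lra.
    - apply Rabs_le. assert (E1 := Carg_bound z). lra. }
  destruct E as [E| ->]. left; apply exp_increasing, E. lra.
Qed.

(** * Complex dilatation *)

Section Derivatives.
Context {a b k : R} {c : C} {f : C -> C} (H : chain a b k c f).

Local Notation s := ((a, b) : C).
Local Notation G := (chainG H).
Local Notation q := (chainq H).
Local Notation Psi := (chain_map H).
Local Notation level := (@front_time a).
Local Notation region := (@region a).
Local Notation outT := (@outer_time a).
Local Notation ext := (ext H).
Let Ha : 0 < a := ch_a H.
Let Hk : 0 <= k < 1 := ch_k H.

Lemma dR_outw (z e : C) : 1 < Cmod z ->
  dR (fun x => outw (z + x * e)) 0 (- Cconj e * (outw z * outw z)).
Proof.
  intros Hz. unfold outw.
  assert (Hc : Cconj z <> 0) by (apply Cmod_nz; rewrite Cmod_conj; lra).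
  apply dG_ext_loc with (f := fun x : R => (/ (Cconj z + x * Cconj e))%C) (d := 1). lra.
  - intros y _. rewrite Cconj_line. reflexivity.
  - assert (E0 : (Cconj z + 0 * Cconj e)%C = Cconj z) by ring.
    eapply dG_eq. apply (dG_inv RtoC (fun x : R => (Cconj z + x * Cconj e)%C)). rewrite E0. auto. apply dR_affine.
    rewrite E0. field. auto.
Qed.

(** The derivative of [outT] at [z] in the direction [e], from [1 + outT z = |z|^(2/a)]. *)
Definition outT1 (z e : C) : R := (1 + outT z) / a * (2 * (fst z * fst e + snd z * snd e)) / (Cmod z * Cmod z).

Lemma outT_alt (z : C) : z <> 0 -> outT z = exp (/ a * ln (fst z * fst z + snd z * snd z)) - 1.
Proof.
  intros Hz. apply Cmod_pos in Hz. unfold outer_time, front_time, Rpower. rewrite <- Cmod_sqr, ln_mult, ln_Rinv by auto.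
  f_equal. f_equal. field. lra.
Qed.

Lemma dR_outT (z e : C) : 1 < Cmod z -> dR (fun x => RtoC (outT (z + x * e))) 0 (outT1 z e).
Proof.
  intros Hz. assert (Hz0 : z <> 0) by (apply Cmod_nz; lra). assert (Hsq := Cmod_sqr z).
  assert (He := Cmod_ge_0 e).
  apply dG_ext_loc with (f := fun x : R => RtoC (exp (/ a * ln ((fst z + x * fst e) * (fst z + x * fst e) + (snd z + x * snd e) * (snd z + x * snd e))) - 1))
    (d := / (Cmod e + 1)). apply Rinv_0_lt_compat; lra.
  - intros y Hy. rewrite outT_alt.
    + do 5 f_equal; simpl; ring.
    + apply Cmod_nz. rewrite <- RtoC_minus, Rminus_0_r, Cmod_R in Hy.
      assert (E := Cmod_triangle_rev z (- (y * e))). rewrite Cmod_opp, Cmod_RtoC_mult in E.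
      replace (z - - (y * e))%C with (z + y * e)%C in E by ring.
      assert (Rabs y * Cmod e <= 1); [|lra].
      apply Rle_trans with (/ (Cmod e + 1) * (Cmod e + 1)). apply Rmult_le_compat; try lra. apply Rabs_pos. rewrite Rinv_l; lra.
  - assert (Hp : 0 < fst z * fst z + snd z * snd z) by (rewrite <- Hsq; nra).
    unfold outT1. rewrite outT_alt, Hsq by auto.
    apply dR_of_components; simpl.
    + auto_derive. rewrite !Rmult_0_l, !Rplus_0_r. auto. rewrite !Rmult_0_l, !Rplus_0_r. field. lra.
    + apply (is_derive_const (K := R_AbsRing) (V := R_NormedModule) 0).
Qed.

(** The common factor of the partial derivatives of the chain at the reflected point [w]: that in
    [w] is [outK * G], that in [T] is [outK * a s w]. *)
Definition outK (z : C) : C := (- (Cexp (s * Clog (q (outT z) (outw z))) * cf1 H (outw z) / (c * q (outT z) (outw z))))%C.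

Definition extD (z e : C) : C :=
  (outK z * (- Cconj e * (outw z * outw z) * G (outT z) (outw z) + a * s * outw z * outT1 z e))%C.

Lemma line_0 (z e : C) : (z + 0 * e)%C = z.
Proof. ring. Qed.

Lemma line_near (z e : C) (r : R) : 0 < r -> exists d, 0 < d /\ forall x : R, Cmod (x - 0) < d -> Cmod (z + x * e - z) < r.
Proof.
  intros Hr. assert (He := Cmod_ge_0 e). exists (r / (Cmod e + 1)). split. apply Rdiv_lt_0_compat; lra.
  intros x Hx. replace (z + x * e - z)%C with ((x - 0) * e)%C by ring. rewrite Cmod_mult.
  apply Rle_lt_trans with (r / (Cmod e + 1) * Cmod e). apply Rmult_le_compat_r; lra.
  replace r with (r / (Cmod e + 1) * (Cmod e + 1)) at 2 by (field; lra). apply Rmult_lt_compat_l; [|lra]. apply Rdiv_lt_0_compat; lra.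
Qed.

Lemma dR_ext_out (z e : C) : 1 < Cmod z -> dR (fun x => ext (z + x * e)) 0 (extD z e).
Proof.
  intros Hz. assert (Hr := out_region H z Hz).
  destruct (line_near z e (Cmod z - 1)) as [d [Hd Hd1]]. lra.
  apply dG_ext_loc with (f := fun x : R => Psi (outT (z + x * e)) (outw (z + x * e))) (d := d); auto.
  { intros y Hy. symmetry. apply ext_out. apply outside_open with z; auto. }
  eapply dG_eq.
  - apply (dG_Psi H RtoC (fun x => outT (z + x * e)) (fun x => outw (z + x * e)) 0 0).
    + rewrite line_0. auto.
    + apply dR_outw; auto.
    + apply (dG_chainq H RtoC (fun x => outT (z + x * e)) (fun x => outw (z + x * e))).
      * rewrite line_0. apply Hr.
      * apply dR_outT; auto.
      * apply dR_outw; auto.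
  - rewrite !line_0. unfold extD, outK. set (T := outT z) in *. set (w := outw z) in *. set (T1 := outT1 z e). set (ce := Cconj e).
    assert (Hw : Cmod w < 1) by apply Hr. assert (Hq := q_neq_0 H T w Hr). assert (Hc := c_neq_0 H). assert (Hs := s_neq_0 a b Ha).
    assert (E : (w * cp1 H w)%C = (cp H w * (cE H w - cp H w) / s)%C).
    { rewrite <- (p1_E H w Hw). field. auto. }
    rewrite (f_lam H w Hw), (f1_p H w Hw). set (X := Cexp (s * Clog (q T w))). set (L := Cexp (clam H w)).
    transitivity (X * (- ce * (w * w) * (cp H w * L) + w * L * s * (- (a / c) * (T1 * cp H w + T * (- ce * w * (w * cp1 H w)))) / q T w))%C.
    { field. auto. }
    rewrite E. unfold chainG. unfold chainq in *. field. split; [auto|split; auto].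
    intros F. apply Hq. transitivity ((c - a * T * cp H w) / c)%C. field; auto. rewrite F. field. auto.
Qed.

Lemma dR_ext_in (z e : C) : Cmod z < 1 -> dR (fun x => ext (z + x * e)) 0 (e * cf1 H z).
Proof.
  intros Hz. destruct (line_near z e (1 - Cmod z)) as [d [Hd Hd1]]. lra.
  apply dG_ext_loc with (f := fun x : R => f (z + x * e)%C) (d := d); auto.
  { intros y Hy. symmetry. apply ext_in. apply ball_in_disc with z; auto. }
  apply (dG_comp RtoC f (fun x => z + x * e)%C). apply dR_affine. rewrite line_0. apply (f_deriv H); auto.
Qed.

Lemma pdx_of_dR (F : C -> C) (z L : C) : dR (fun x => F (z + x * 1)%C) 0 L -> has_pdx F z L.
Proof.
  intros Hd eps Heps. destruct (Hd (eps / 2)) as [d [Hd0 H1]]. lra. exists d. split; auto. intros h Hh Hhd.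
  specialize (H1 h). cbv beta in H1. rewrite <- RtoC_minus, Rminus_0_r, Cmod_R in H1. specialize (H1 Hhd).
  change (Cmod (RtoC (/ h) * (F ((fst z + h)%R, snd z) - F z) - L) < eps).
  replace (z + h * 1)%C with ((fst z + h)%R, snd z) in H1 by (apply C_ext; simpl; ring).
  replace (z + 0 * 1)%C with z in H1 by ring.
  assert (Hh' : RtoC h <> 0) by (intros E; apply RtoC_inj in E; auto).
  replace (RtoC (/ h) * (F ((fst z + h)%R, snd z) - F z) - L)%C with ((F ((fst z + h)%R, snd z) - F z - h * L) * / h)%C.
  2: { rewrite RtoC_inv by auto. field. auto. }
  rewrite Cmod_mult, Cmod_inv, Cmod_R by auto. assert (Hp := Rabs_pos_lt h Hh).
  apply Rle_lt_trans with (eps / 2 * Rabs h * / Rabs h). apply Rmult_le_compat_r; auto. left; apply Rinv_0_lt_compat; auto.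
  rewrite Rmult_assoc, Rinv_r; lra.
Qed.

Lemma pdy_of_dR (F : C -> C) (z L : C) : dR (fun x => F (z + x * Ci)%C) 0 L -> has_pdy F z L.
Proof.
  intros Hd eps Heps. destruct (Hd (eps / 2)) as [d [Hd0 H1]]. lra. exists d. split; auto. intros h Hh Hhd.
  specialize (H1 h). cbv beta in H1. rewrite <- RtoC_minus, Rminus_0_r, Cmod_R in H1. specialize (H1 Hhd).
  change (Cmod (RtoC (/ h) * (F (fst z, (snd z + h)%R) - F z) - L) < eps).
  replace (z + h * Ci)%C with (fst z, (snd z + h)%R) in H1 by (apply C_ext; simpl; ring).
  replace (z + 0 * Ci)%C with z in H1 by ring.
  assert (Hh' : RtoC h <> 0) by (intros E; apply RtoC_inj in E; auto).
  replace (RtoC (/ h) * (F (fst z, (snd z + h)%R) - F z) - L)%C with ((F (fst z, (snd z + h)%R) - F z - h * L) * / h)%C.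
  2: { rewrite RtoC_inv by auto. field. auto. }
  rewrite Cmod_mult, Cmod_inv, Cmod_R by auto. assert (Hp := Rabs_pos_lt h Hh).
  apply Rle_lt_trans with (eps / 2 * Rabs h * / Rabs h). apply Rmult_le_compat_r; auto. left; apply Rinv_0_lt_compat; auto.
  rewrite Rmult_assoc, Rinv_r; lra.
Qed.

Lemma ext_dilatation (z : C) : Cmod z <> 1 -> exists Fx Fy, has_pdx ext z Fx /\ has_pdy ext z Fy /\
  Cnorm (Fzbar Fx Fy) <= k * Cnorm (Fz Fx Fy).
Proof.
  intros Hz. destruct (Rlt_or_le (Cmod z) 1) as [Hlt|Hge].
  - exists (1 * cf1 H z)%C, (Ci * cf1 H z)%C. split; [|split].
    + apply pdx_of_dR, dR_ext_in, Hlt.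
    + apply pdy_of_dR, dR_ext_in, Hlt.
    + change (Cmod (RtoC (/ 2) * (1 * cf1 H z + Ci * (Ci * cf1 H z))) <= k * Cmod (Fz (1 * cf1 H z)%C (Ci * cf1 H z)%C)).
      replace (RtoC (/ 2) * (1 * cf1 H z + Ci * (Ci * cf1 H z)))%C with (RtoC 0).
      * rewrite Cmod_0. apply Rmult_le_pos. lra. apply Cmod_ge_0.
      * transitivity (RtoC (/ 2) * ((1 + Ci * Ci) * cf1 H z))%C; [|ring]. rewrite Ci_sqr.
        replace (1 + RtoC (-1))%C with (RtoC 0) by (apply C_ext; simpl; ring). ring.
  - assert (Hgt : 1 < Cmod z) by lra. exists (extD z 1), (extD z Ci). split; [|split].
    + apply pdx_of_dR, dR_ext_out, Hgt.
    + apply pdy_of_dR, dR_ext_out, Hgt.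
    + change (Cmod (RtoC (/ 2) * (extD z 1 + Ci * extD z Ci)) <= k * Cmod (RtoC (/ 2) * (extD z 1 - Ci * extD z Ci))).
      assert (Hz0 : z <> 0) by (apply Cmod_nz; lra).
      assert (Hr := out_region H z Hgt). assert (HG := G_level H _ _ Hr).
      assert (Hcj : Cconj z <> 0) by (apply Cmod_nz; rewrite Cmod_conj; lra).
      set (T := outT z) in *. set (w := outw z) in *.
      assert (HT0 : 0 <= T) by apply Hr.
      assert (Ew : (w * Cconj z)%C = 1) by (unfold w, outw; field; auto).
      assert (Emod : (Cmod z * Cmod z)%R = (z * Cconj z)%C :> C).
      { rewrite Cmod_sqr. apply C_ext; simpl; ring. }
      assert (Hm0 : RtoC (Cmod z * Cmod z) <> 0) by (rewrite Emod; apply Cmult_neq_0; auto).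
      assert (Ha0 : RtoC a <> 0) by (intros E; apply RtoC_inj in E; lra).
      assert (ET : forall e, RtoC (outT1 z e) = ((1 + T) / a * (2 * (fst z * fst e + snd z * snd e)%R) / (z * Cconj z))%C).
      { intros e. unfold outT1. fold T. rewrite RtoC_div by nra. rewrite Emod, RtoC_mult, RtoC_div, RtoC_plus, RtoC_mult by lra. reflexivity. }
      assert (E1 : RtoC (fst z * fst (RtoC 1) + snd z * snd (RtoC 1)) = ((z + Cconj z) / 2)%C).
      { apply C_ext; simpl; field. }
      assert (E2 : RtoC (fst z * fst Ci + snd z * snd Ci) = (- Ci * (z - Cconj z) / 2)%C).
      { apply C_ext; simpl; field. }
      assert (Ei : Cconj Ci = (- Ci)%C) by (apply C_ext; simpl; ring).
      assert (E11 : Cconj 1 = 1) by (apply C_ext; simpl; ring).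
      (* The aim is [F_zbar = K w^2 (S - g)] and [F_z = K w S / z]. As [|w| = 1 / |z|], the quotient
         of the moduli is [|g - S| / |S|], which the level bound estimates by [k]. *)
      set (S := (s * (1 + T))%C) in *. set (g := G T w) in *. set (K := outK z).
      assert (A1 : (a * s * w * outT1 z 1)%C = (S * w * (w + / z))%C).
      { rewrite ET, E1. unfold S, w, outw. field. auto. }
      assert (A2 : (a * s * w * outT1 z Ci)%C = (- Ci * (S * w * (w - / z)))%C).
      { rewrite ET, E2. unfold S, w, outw. field. auto. }
      assert (F1 : extD z 1 = (K * (- (w * w) * g + S * w * (w + / z)))%C).
      { unfold extD. fold T w g K. rewrite A1, E11. ring. }
      assert (F2 : extD z Ci = (K * (Ci * (w * w) * g - Ci * (S * w * (w - / z))))%C).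
      { unfold extD. fold T w g K. rewrite A2, Ei. ring. }
      assert (Em1 : RtoC (-1) = (- (1))%C) by (apply C_ext; simpl; ring).
      assert (Hh2 : (RtoC (/ 2) * 2)%C = 1) by (apply C_ext; simpl; field).
      assert (Fb : (RtoC (/ 2) * (extD z 1 + Ci * extD z Ci))%C = (K * (w * w) * (S - g))%C).
      { rewrite F1, F2. transitivity (RtoC (/ 2) * (K * (w * ((w * g) * (Ci * Ci - 1) + S * ((w + / z) - (Ci * Ci) * (w - / z))))))%C. ring.
        rewrite Ci_sqr, Em1. transitivity (RtoC (/ 2) * 2 * (K * (w * w) * (S - g)))%C. ring. rewrite Hh2. ring. }
      assert (Fa : (RtoC (/ 2) * (extD z 1 - Ci * extD z Ci))%C = (K * w * S * / z)%C).
      { rewrite F1, F2. transitivity (RtoC (/ 2) * (K * (w * (- (w * g) * (1 + Ci * Ci) + S * ((w + / z) + (Ci * Ci) * (w - / z))))))%C. ring.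
        rewrite Ci_sqr, Em1. transitivity (RtoC (/ 2) * 2 * (K * w * S * / z))%C. ring. rewrite Hh2. ring. }
      rewrite Fa, Fb, !Cmod_mult, Cmod_inv by auto. unfold w. rewrite Cmod_outw by auto.
      rewrite (Cmod_sub_sym S). assert (Hz' := Rinv_0_lt_compat (Cmod z) ltac:(lra)).
      assert (HS : Cmod S = Cmod s * (1 + T)). { unfold S. rewrite Cmod_mult, <- RtoC_plus, Cmod_R, Rabs_pos_eq; lra. }
      rewrite HS. assert (HK := Cmod_ge_0 K).
      replace (k * (Cmod K * / Cmod z * (Cmod s * (1 + T)) * / Cmod z)) with (Cmod K * (/ Cmod z * / Cmod z) * (k * Cmod s * (1 + T))) by ring.
      apply Rmult_le_compat_l; auto. apply Rmult_le_pos; auto. nra.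
Qed.

(** Near the circle [q] is within [1/2] of 1; the rest of the annulus is compact, and [q] is
    continuous and free of zeros there. *)
Lemma q_compact (R0 : R) : exists m, 0 < m /\ forall z, 1 < Cmod z <= R0 -> m <= Cmod (q (outT z) (outw z)) <= / m.
Proof.
  destruct (q_near_circle H) as [K [HK HK1]].
  destruct (Rpower_small (1 / (2 * K)) (1 - k)) as [x0 [Hx0 Hx]]. { apply Rdiv_lt_0_compat; lra. } lra.
  set (x1 := Rmin x0 (1 / 2)). assert (Hx1 : 0 < x1 <= 1 / 2) by (split; [apply Rmin_glb_lt; lra|apply Rmin_r]).
  assert (Hx1' : x1 <= x0) by apply Rmin_l.
  destruct (compact_uniform R0 (fun p r => / (1 - x1) <= Cmod p <= R0 /\ r = 0)
    (fun p _ m => m <= Cmod (q (outT p) (outw p)) <= / m)) as [m [Hm Hm1]].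
  - intros p r [Hp ->]. rewrite Cmod_0. split. lra. apply Rle_trans with (Cmod p). apply Cmod_ge_0. lra.
  - intros p r Hap. split; [split|].
    + apply Rnot_lt_le. intros Hlt. destruct (Hap (/ (1 - x1) - Cmod p)) as [p' [r' [[H1 _] [H2 _]]]]. lra.
      assert (E := Cmod_triangle_rev p' p). lra.
    + apply Rnot_lt_le. intros Hlt. destruct (Hap (Cmod p - R0)) as [p' [r' [[H1 _] [H2 _]]]]. lra.
      assert (E := Cmod_triangle_rev p p'). rewrite Cmod_sub_sym in E. lra.
    + apply Cmod_le_eps_eq. intros e He. destruct (Hap e He) as [p' [r' [[_ H1] [_ H2]]]]. subst r'.
      rewrite Cmod_sub_sym. lra.
  - intros p _ m m' Hm' Hmm [E1 E2]. split. lra. apply Rle_trans with (1 := E2). apply Rinv_le_contravar; lra.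
  - intros p r [Hp _].
    assert (Hp1 : 1 < Cmod p). { apply Rlt_le_trans with (2 := proj1 Hp). rewrite <- Rinv_1 at 1. apply Rinv_lt_contravar; lra. }
    assert (Hp0 : p <> 0) by (apply Cmod_nz; lra).
    assert (Hr := out_region H p Hp1).
    assert (Hc : cC (fun p => RtoC (Cmod (q (outT p) (outw p)))) p).
    { apply cG_Cmod. apply (cG_chainq H). apply Hr. apply cC_outT; auto. apply cC_outw; auto. }
    assert (Hq := Cmod_pos _ (q_neq_0 H _ _ Hr)). set (Q := Cmod (q (outT p) (outw p))) in *.
    destruct (Hc (Q / 2)) as [d [Hd H1]]. lra.
    exists d, (Rmin (Q / 2) (/ (2 * Q))). split; auto. split. { apply Rmin_glb_lt. lra. apply Rinv_0_lt_compat; lra. }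
    intros p' _ _ Hp' _. specialize (H1 p' Hp'). rewrite <- RtoC_minus, Cmod_R in H1. apply Rabs_lt_between in H1. fold Q in H1.
    split. apply Rle_trans with (1 := Rmin_l _ _). lra.
    apply Rle_trans with (/ / (2 * Q)). rewrite Rinv_inv. lra. apply Rinv_le_contravar; [|apply Rmin_r].
    apply Rmin_glb_lt. lra. apply Rinv_0_lt_compat; lra.
  - exists (Rmin m (1 / 2)). split. apply Rmin_glb_lt; lra. intros z Hz.
    assert (Hb := out_bounds z (proj1 Hz)).
    assert (Hmm : 0 < Rmin m (1 / 2)) by (apply Rmin_glb_lt; lra).
    destruct (Rle_or_lt (/ (1 - x1)) (Cmod z)) as [Hge|Hlt].
    + destruct (Hm1 z 0) as [E1 E2]. split; [lra|auto]. split. apply Rle_trans with (2 := E1), Rmin_l.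
      apply Rle_trans with (1 := E2). apply Rinv_le_contravar; auto. apply Rmin_l.
    + assert (Hw : 1 - x1 < Cmod (outw z)).
      { rewrite Cmod_outw by (apply Cmod_nz; lra). rewrite <- (Rinv_inv (1 - x1)). apply Rinv_lt_contravar; auto.
        apply Rmult_lt_0_compat; [lra|apply Rinv_0_lt_compat; lra]. }
      specialize (HK1 (outw z) ltac:(lra)). rewrite outT_level by lra.
      assert (E : K * Rpower (1 - Cmod (outw z)) (1 - k) <= 1 / 2).
      { replace (1 / 2) with (K * (1 / (2 * K))) by (field; lra). apply Rmult_le_compat_l. lra. apply Hx. lra. }
      set (Q := q (level (Cmod (outw z))) (outw z)) in *.
      assert (E1 := Cmod_triangle_rev 1 Q). rewrite Cmod_sub_sym, Cmod_1 in E1.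
      assert (E2 := Cmod_triangle_rev Q 1). rewrite Cmod_1 in E2.
      split. apply Rle_trans with (1 := Rmin_r _ _). lra. apply Rle_trans with (/ / 2). rewrite Rinv_inv. lra.
      apply Rinv_le_contravar; auto. apply Rle_trans with (1 := Rmin_r _ _). lra.
Qed.

(** In a bounded annulus all factors of [extD] are bounded except [f'] at the reflected point, which
    brings in the singular power. *)
Lemma ext_deriv_bound (R0 : R) : 1 < R0 -> exists B, 0 < B /\ forall z e, Cmod z <> 1 -> Cmod z <= R0 -> Cmod e = 1 ->
  exists V, dR (fun x => ext (z + x * e)) 0 V /\ Cmod V <= B * Rpower (Rabs (Cmod z - 1)) (- k).
Proof.
  intros HR0. destruct (growth H) as [B [HB HB1]]. destruct (q_compact R0) as [m [Hm Hm1]].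
  assert (Hc := Cmod_pos c (c_neq_0 H)). assert (Hs := s_pos H).
  set (A := exp (Cmod s * (- ln m + PI))). assert (HA : 0 < A) by apply exp_pos.
  set (P := Rpower R0 (2 / a)). assert (HP : 0 < P) by apply exp_pos.
  (* Accounts for [1 - |w| = (|z| - 1) / |z|]: the power [-k] of the denominator is
     [|z|^k <= R0^k]. *)
  set (D := Rpower R0 k). assert (HD : 0 < D) by apply exp_pos.
  set (B' := A * (B * D) / (Cmod c * m) * (4 * Cmod s * P)).
  assert (HB' : 0 < B').
  { unfold B'. apply Rmult_lt_0_compat. apply Rdiv_lt_0_compat. repeat apply Rmult_lt_0_compat; auto. apply Rmult_lt_0_compat; auto.
    repeat apply Rmult_lt_0_compat; lra. }
  exists (B + B'). split. lra. intros z e Hz1 HzR He.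
  assert (Hpw : 0 < Rpower (Rabs (Cmod z - 1)) (- k)) by apply exp_pos.
  destruct (Rlt_or_le (Cmod z) 1) as [Hlt|Hge].
  - exists (e * cf1 H z)%C. split. apply dR_ext_in; auto. rewrite Cmod_mult, He, Rmult_1_l.
    destruct (HB1 z Hlt) as [E _]. rewrite Rabs_left by lra. replace (- (Cmod z - 1)) with (1 - Cmod z) by ring.
    rewrite Rabs_left in Hpw by lra. replace (- (Cmod z - 1)) with (1 - Cmod z) in Hpw by ring. nra.
  - assert (Hgt : 1 < Cmod z) by lra. exists (extD z e). split. apply dR_ext_out; auto.
    rewrite Rabs_pos_eq in * by lra. assert (Hz0 : z <> 0) by (apply Cmod_nz; lra).
    assert (Hr := out_region H z Hgt). assert (HG := G_level H _ _ Hr). specialize (Hm1 z (conj Hgt HzR)).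
    assert (HwC : Cmod (outw z) = / Cmod z) by (apply Cmod_outw; auto).
    assert (Hw1 : Cmod (outw z) < 1) by apply Hr.
    assert (HT0 : 0 <= outT z) by apply Hr.
    assert (HTP : 1 + outT z <= P).
    { unfold outer_time, front_time, P. replace (1 + (Rpower (/ Cmod z) (- (2 / a)) - 1)) with (Rpower (Cmod z) (2 / a)).
      apply Rpower_mono_base. lra. apply Rdiv_le_0_compat; lra.
      unfold Rpower. rewrite ln_Rinv by lra. replace (- (2 / a) * - ln (Cmod z)) with (2 / a * ln (Cmod z)) by ring. ring. }
    destruct (HB1 (outw z) Hw1) as [Ef _].
    assert (HT1 : a * Rabs (outT1 z e) <= 2 * P).
    { unfold outT1. rewrite <- (Rabs_pos_eq a) at 1 by lra. rewrite <- Rabs_mult.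
      replace (a * ((1 + outT z) / a * (2 * (fst z * fst e + snd z * snd e)) / (Cmod z * Cmod z))) with
        ((1 + outT z) * 2 * (fst z * fst e + snd z * snd e) * / (Cmod z * Cmod z)) by (field; lra).
      assert (Hdot : Rabs (fst z * fst e + snd z * snd e) <= Cmod z).
      { assert (D1 := dot_le_Cmod e z He). assert (D2 := dot_le_Cmod e (- z) He). rewrite Cmod_opp in D2. simpl in D2.
        apply Rabs_le. lra. }
      assert (Hzz : 1 <= Cmod z * Cmod z) by nra.
      rewrite !Rabs_mult, (Rabs_pos_eq (1 + outT z)), (Rabs_pos_eq 2), Rabs_inv, (Rabs_pos_eq (Cmod z * Cmod z)) by lra.
      apply Rle_trans with ((1 + outT z) * 2 * (Cmod z * / (Cmod z * Cmod z))).
      - rewrite Rmult_assoc. apply Rmult_le_compat_l. lra. apply Rmult_le_compat_r; auto. left. apply Rinv_0_lt_compat. lra.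
      - replace (Cmod z * / (Cmod z * Cmod z)) with (/ Cmod z) by (field; lra).
        assert (/ Cmod z <= 1). { rewrite <- Rinv_1. apply Rinv_le_contravar; lra. }
        assert (0 < / Cmod z) by (apply Rinv_0_lt_compat; lra). nra. }
    assert (HGb : Cmod (G (outT z) (outw z)) <= 2 * Cmod s * P).
    { assert (E1 := Cmod_triangle_rev (G (outT z) (outw z)) (s * (1 + outT z))).
      rewrite <- RtoC_plus, Cmod_mult, Cmod_R, Rabs_pos_eq in E1 by lra. rewrite <- RtoC_plus in HG.
      assert (k * Cmod s * (1 + outT z) <= Cmod s * (1 + outT z)) by (apply Rmult_le_compat_r; nra).
      assert (Cmod s * (1 + outT z) <= Cmod s * P) by (apply Rmult_le_compat_l; lra). lra. }
    assert (Hf1 : Cmod (cf1 H (outw z)) <= B * D * Rpower (Cmod z - 1) (- k)).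
    { apply Rle_trans with (1 := Ef). rewrite Rmult_assoc. apply Rmult_le_compat_l. lra.
      replace (1 - Cmod (outw z)) with ((Cmod z - 1) * / Cmod z) by (rewrite HwC; field; lra).
      rewrite <- Rpower_mult_distr by (try apply Rinv_0_lt_compat; lra). rewrite Rmult_comm. apply Rmult_le_compat_r. lra.
      replace (Rpower (/ Cmod z) (- k)) with (Rpower (Cmod z) k). apply Rpower_mono_base; lra.
      unfold Rpower. rewrite ln_Rinv by lra. f_equal. ring. }
    unfold extD, outK. rewrite Cmod_mult, Cmod_opp.
    assert (Hq0 : q (outT z) (outw z) <> 0) by (apply Cmod_nz; lra).
    rewrite Cmod_div by (apply Cmult_neq_0; auto; apply (c_neq_0 H)). rewrite !Cmod_mult.
    apply Rle_trans with (B' * Rpower (Cmod z - 1) (- k)).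
    2: { apply Rmult_le_compat_r; lra. }
    unfold B'. replace (A * (B * D) / (Cmod c * m) * (4 * Cmod s * P) * Rpower (Cmod z - 1) (- k)) with
      (A * (B * D * Rpower (Cmod z - 1) (- k)) / (Cmod c * m) * (4 * Cmod s * P)) by (field; lra).
    apply Rmult_le_compat.
    + apply Rdiv_le_0_compat. apply Rmult_le_pos; apply Cmod_ge_0. apply Rmult_lt_0_compat; auto. lra.
    + apply Cmod_ge_0.
    + unfold Rdiv. apply Rmult_le_compat.
      * apply Rmult_le_pos; apply Cmod_ge_0.
      * left. apply Rinv_0_lt_compat. apply Rmult_lt_0_compat; auto. lra.
      * apply Rmult_le_compat; auto using Cmod_ge_0. apply Cmod_Cexp_le; auto.
      * apply Rinv_le_contravar. apply Rmult_lt_0_compat; auto. apply Rmult_le_compat_l; lra.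
    + apply Rle_trans with (1 := Cmod_triangle _ _). rewrite !Cmod_mult, Cmod_opp, Cmod_conj, He, !Cmod_R, (Rabs_pos_eq a), Rmult_1_l by lra.
      assert (Hw0 := Cmod_ge_0 (outw z)). assert (HG0 := Cmod_ge_0 (G (outT z) (outw z))).
      assert (Cmod (outw z) * Cmod (outw z) * Cmod (G (outT z) (outw z)) <= 1 * (2 * Cmod s * P)).
      { apply Rmult_le_compat; auto; nra. }
      assert (a * Cmod s * Cmod (outw z) * Rabs (outT1 z e) <= 1 * (Cmod s * (2 * P))).
      { replace (a * Cmod s * Cmod (outw z) * Rabs (outT1 z e)) with (Cmod (outw z) * (Cmod s * (a * Rabs (outT1 z e)))) by ring.
        apply Rmult_le_compat; auto; try lra. apply Rmult_le_pos. lra. apply Rmult_le_pos. lra. apply Rabs_pos.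
        apply Rmult_le_compat_l; lra. }
      lra.
Qed.

End Derivatives.

(** * Absolute continuity on lines *)

(** A criterion for absolute continuity that is stable under gluing of intervals. *)
Definition ac_dominated (g : R -> C) (A B : R) : Prop :=
  forall eta, 0 < eta -> exists (L : R) (M : R -> R), 0 <= L /\ (forall u v, A <= u <= v -> v <= B -> M u <= M v) /\
    M B - M A <= eta /\ forall u v, A <= u <= v -> v <= B -> Cmod (g v - g u) <= L * (v - u) + (M v - M u).

Lemma intervals_in_le A B l : intervals_in A B l -> A <= B.
Proof.
  revert A. induction l as [|[u v] l IH]; simpl; intros A HA; auto.
  destruct HA as [H1 [H2 H3]]. specialize (IH v H3). lra.
Qed.

Lemma ac_dominated_abs_cont g A B : ac_dominated g A B -> abs_cont_on g A B.
Proof.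
  intros Hd eps Heps. destruct (Hd (eps / 2)) as [L [M [HL [HM [HT Hdom]]]]]. lra.
  exists (eps / (2 * (L + 1))). split. apply Rdiv_lt_0_compat; lra. intros l Hl Hlen.
  change (fold_right Rplus 0 (map (fun p => Cmod (g (snd p) - g (fst p))) l) < eps).
  assert (E : forall l A', A <= A' -> intervals_in A' B l ->
    fold_right Rplus 0 (map (fun p => Cmod (g (snd p) - g (fst p))) l) <=
    L * fold_right Rplus 0 (map (fun p => snd p - fst p) l) + (M B - M A') /\
    0 <= fold_right Rplus 0 (map (fun p => snd p - fst p) l)).
  { clear l Hl Hlen. induction l as [|[u v] l IH]; simpl; intros A' HA HB.
    - split; [|lra]. assert (M A' <= M B) by (apply HM; lra). lra.
    - destruct HB as [H1 [H2 H3]]. assert (H4 := intervals_in_le _ _ _ H3). destruct (IH v ltac:(lra) H3) as [I1 I2].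
      assert (D1 := Hdom u v ltac:(lra) H4). assert (D2 : M A' <= M u) by (apply HM; lra). split; lra. }
  destruct (E l A ltac:(lra) Hl) as [E1 E2].
  assert (E3 : L * fold_right Rplus 0 (map (fun p => snd p - fst p) l) <= L * (eps / (2 * (L + 1)))) by (apply Rmult_le_compat_l; lra).
  assert (E4 : L * (eps / (2 * (L + 1))) < eps / 2).
  { replace (eps / 2) with ((L + 1) * (eps / (2 * (L + 1)))) by (field; lra). apply Rmult_lt_compat_r; [|lra]. apply Rdiv_lt_0_compat; lra. }
  lra.
Qed.

Lemma ac_dominated_restrict g A B A' B' : A <= A' -> A' <= B' -> B' <= B -> ac_dominated g A B -> ac_dominated g A' B'.
Proof.
  intros H1 H2 H3 Hd eta Heta. destruct (Hd eta Heta) as [L [M [HL [HM [HT Hdom]]]]].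
  exists L, M. split; [auto|split; [|split]].
  - intros u v Hu Hv. apply HM; lra.
  - assert (M A <= M A') by (apply HM; lra). assert (M B' <= M B) by (apply HM; lra). lra.
  - intros u v Hu Hv. apply Hdom; lra.
Qed.

Lemma ac_dominated_glue g A m B : A <= m -> m <= B -> ac_dominated g A m -> ac_dominated g m B -> ac_dominated g A B.
Proof.
  intros HAm HmB H1 H2 eta Heta.
  destruct (H1 (eta / 2)) as [L1 [M1 [HL1 [HM1 [HT1 D1]]]]]. lra.
  destruct (H2 (eta / 2)) as [L2 [M2 [HL2 [HM2 [HT2 D2]]]]]. lra.
  assert (HLM : exists LM, L1 <= LM /\ L2 <= LM) by (exists (Rmax L1 L2); split; [apply Rmax_l|apply Rmax_r]).
  (* Each of [M1] and [M2] is continued as a constant beyond the gluing point [m]. *)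
  destruct HLM as [LM [HR1 HR2]]. exists LM, (fun x => M1 (Rmin x m) + M2 (Rmax x m)).
  split; [lra|split; [|split]].
  - intros u v Hu Hv. apply Rplus_le_compat.
    + apply HM1; unfold Rmin; repeat destruct Rle_dec; try split; lra.
    + apply HM2; unfold Rmax; repeat destruct Rle_dec; try split; lra.
  - rewrite Rmin_right, Rmax_left, Rmin_left, Rmax_right by lra. lra.
  - assert (P1 : forall u v, A <= u <= v -> v <= m -> Cmod (g v - g u) <= LM * (v - u) + (M1 (Rmin v m) + M2 (Rmax v m) - (M1 (Rmin u m) + M2 (Rmax u m)))).
    { intros u v Hu Hv. rewrite !Rmin_left, !Rmax_right by lra. specialize (D1 u v Hu Hv).
      assert (L1 * (v - u) <= LM * (v - u)) by (apply Rmult_le_compat_r; lra). lra. }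
    assert (P2 : forall u v, m <= u <= v -> v <= B -> Cmod (g v - g u) <= LM * (v - u) + (M1 (Rmin v m) + M2 (Rmax v m) - (M1 (Rmin u m) + M2 (Rmax u m)))).
    { intros u v Hu Hv. rewrite !Rmin_right, !Rmax_left by lra. specialize (D2 u v Hu Hv).
      assert (L2 * (v - u) <= LM * (v - u)) by (apply Rmult_le_compat_r; lra). lra. }
    intros u v Hu Hv. destruct (Rle_or_lt v m). apply P1; auto. destruct (Rle_or_lt m u). apply P2; auto; lra.
    specialize (P1 u m ltac:(lra) ltac:(lra)). specialize (P2 m v ltac:(lra) ltac:(lra)).
    assert (E := Cmod_diff_triangle (g v) (g m) (g u)). lra.
Qed.

Lemma ac_dominated_lipschitz g A B L : 0 <= L -> (forall u v, A <= u <= v -> v <= B -> Cmod (g v - g u) <= L * (v - u)) ->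
  ac_dominated g A B.
Proof.
  intros HL Hl eta Heta. exists L, (fun _ => 0). split; [auto|split; [|split]]; try (intros; lra).
  intros u v Hu Hv. specialize (Hl u v Hu Hv). lra.
Qed.

Lemma ac_dominated_reflect g A B : ac_dominated (fun x => g (- x)) (- B) (- A) -> ac_dominated g A B.
Proof.
  intros Hd eta Heta. destruct (Hd eta Heta) as [L [M [HL [HM [HT Hdom]]]]].
  exists L, (fun x => - M (- x)). split; [auto|split; [|split]].
  - intros u v Hu Hv. apply Ropp_le_contravar. apply HM; lra.
  - lra.
  - intros u v Hu Hv. specialize (Hdom (- v) (- u) ltac:(lra) ltac:(lra)). rewrite !Ropp_involutive in Hdom.
    rewrite Cmod_sub_sym. lra.
Qed.

Lemma dR_choose (g : R -> C) (P : R -> Prop) (Q : R -> C -> Prop) : (forall x, P x -> exists V, dR g x V /\ Q x V) ->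
  exists v : R -> C, forall x, P x -> dR g x (v x) /\ Q x (v x).
Proof.
  intros Hx. destruct (choice (fun x V => P x -> dR g x V /\ Q x V)) as [v Hv].
  - intros x. destruct (classic (P x)) as [Hp|Hp].
    + destruct (Hx x Hp) as [V HV]. exists V. auto.
    + exists (RtoC 0). intros; contradiction.
  - exists v. exact Hv.
Qed.

Section Singular.
Context (k : R) (Hk : 0 <= k < 1).

(** [Rpower] is an exponential and never vanishes, so the continuous extension of [x^(1-k)] by 0
    needs a case distinction. *)
Definition pospow (x : R) : R := if Rle_dec x 0 then 0 else Rpower x (1 - k).

Lemma pospow_pos x : 0 < x -> pospow x = Rpower x (1 - k).
Proof. intros Hx. unfold pospow. destruct (Rle_dec x 0); lra. Qed.

Lemma pospow_ge0 x : 0 <= pospow x.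
Proof. unfold pospow. destruct (Rle_dec x 0). lra. left; apply exp_pos. Qed.

Lemma pospow_mono x y : x <= y -> pospow x <= pospow y.
Proof.
  intros Hxy. destruct (Rle_or_lt x 0) as [Hx|Hx].
  - unfold pospow at 1. destruct (Rle_dec x 0); [|lra]. apply pospow_ge0.
  - rewrite !pospow_pos by lra. apply Rpower_mono_base; lra.
Qed.

Lemma pospow_deriv x : 0 < x -> is_derive pospow x ((1 - k) * Rpower x (- k)).
Proof.
  intros Hx. apply is_derive_ext_loc with (fun x => Rpower x (1 - k)).
  - exists (mkposreal x Hx). intros y Hy. unfold ball in Hy; simpl in Hy; unfold AbsRing_ball, abs, minus, plus, opp in Hy; simpl in Hy.
    apply Rabs_lt_between in Hy. symmetry. apply pospow_pos. lra.
  - unfold Rpower. auto_derive. lra.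
    replace ((1 - k) * ln x) with (- k * ln x + ln x) by ring. rewrite exp_plus, exp_ln by auto. field. lra.
Qed.

Lemma pospow_continuous x : continuity_pt pospow x.
Proof.
  destruct (Rlt_or_le 0 x) as [Hx|Hx].
  - apply ex_derive_continuity_pt. eexists. apply pospow_deriv, Hx.
  - intros eps Heps. destruct (Rpower_small (eps / 2) (1 - k)) as [d [Hd H1]]; try lra.
    exists d. split; auto. intros y [_ Hy]. simpl in *. unfold R_dist in *.
    replace (pospow x) with 0. 2: { unfold pospow. destruct (Rle_dec x 0); lra. }
    rewrite Rminus_0_r, Rabs_pos_eq by apply pospow_ge0.
    destruct (Rle_or_lt y 0) as [Hy0|Hy0].
    + unfold pospow. destruct (Rle_dec y 0); lra.
    + rewrite pospow_pos by auto. apply Rabs_lt_between in Hy. specialize (H1 y ltac:(lra)). lra.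
Qed.

(** On a short interval after [p] the increments are dominated by those of [K (x - p)^(1-k)], whose
    total growth there is at most [eta]; beyond it the derivative is bounded. *)
Lemma ac_dominated_right (g : R -> C) (p B c0 : R) : p < B -> 0 < c0 ->
  (forall x, p <= x <= B -> cR g x) ->
  (forall x, p < x <= B -> exists V, dR g x V /\ Cmod V <= c0 * Rpower (x - p) (- k)) ->
  ac_dominated g p B.
Proof.
  intros HpB Hc0 Hcont Hder. destruct (dR_choose g _ _ Hder) as [v Hv]. clear Hder.
  intros eta Heta. set (K := c0 / (1 - k)). assert (HK : 0 < K) by (apply Rdiv_lt_0_compat; lra).
  destruct (Rpower_small (eta / K) (1 - k)) as [x0 [Hx0 Hx]]. apply Rdiv_lt_0_compat; auto. lra.
  set (e0 := Rmin x0 (B - p)). assert (He0 : 0 < e0) by (apply Rmin_glb_lt; lra).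
  assert (He1 : e0 <= x0) by apply Rmin_l. assert (He2 : e0 <= B - p) by apply Rmin_r.
  set (L := c0 * Rpower e0 (- k)). assert (HL : 0 < L) by (apply Rmult_lt_0_compat; auto; apply exp_pos).
  set (M := fun x => K * pospow (Rmin x (p + e0) - p)).
  exists L, M. split; [lra|split; [|split]].
  - intros u w Hu Hw. unfold M. apply Rmult_le_compat_l. lra. apply pospow_mono.
    assert (Rmin u (p + e0) <= Rmin w (p + e0)) by (unfold Rmin; repeat destruct Rle_dec; lra). lra.
  - unfold M. rewrite Rmin_right, Rmin_left by lra. replace (p + e0 - p) with e0 by ring. rewrite pospow_pos by auto.
    assert (K * Rpower e0 (1 - k) <= eta).
    { replace eta with (K * (eta / K)) by (field; lra). apply Rmult_le_compat_l. lra. apply Hx. lra. }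
    assert (0 <= K * pospow (p - p)) by (apply Rmult_le_pos; [lra|apply pospow_ge0]). lra.
  - assert (P1 : forall u w, p <= u <= w -> w <= p + e0 -> Cmod (g w - g u) <= L * (w - u) + (M w - M u)).
    { intros u w Hu Hw. unfold M. rewrite !Rmin_left by lra.
      assert (E := dR_mvt g v (fun x => K * pospow (x - p)) (fun x => c0 * Rpower (x - p) (- k)) u w (proj2 Hu)).
      cbv beta in E. assert (0 <= L * (w - u)) by (apply Rmult_le_pos; lra).
      apply Rle_trans with (K * pospow (w - p) - K * pospow (u - p)); [|lra]. apply E.
      - intros t Ht. destruct (Hv t) as [V1 V2]. lra. split; [auto|split; auto].
        assert (D := pospow_deriv (t - p) ltac:(lra)).
        replace (c0 * Rpower (t - p) (- k)) with (K * (1 * ((1 - k) * Rpower (t - p) (- k)))) by (unfold K; field; lra).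
        apply (is_derive_scal (fun x => pospow (x - p))). apply (is_derive_comp pospow (fun x => x - p)); auto.
        auto_derive; auto; ring.
      - intros t Ht. split. apply Hcont; lra.
        apply continuity_pt_mult. apply continuity_pt_const; intros x y; reflexivity.
        apply (continuity_pt_comp (fun x => x - p) pospow). 2: apply pospow_continuous.
        apply ex_derive_continuity_pt. auto_derive. auto. }
    assert (P2 : forall u w, p + e0 <= u <= w -> w <= B -> Cmod (g w - g u) <= L * (w - u) + (M w - M u)).
    { intros u w Hu Hw. unfold M. rewrite !Rmin_right by lra.
      apply Rle_trans with (L * (w - u)); [|lra]. apply (dR_lipschitz g v). lra.
      intros t Ht. destruct (Hv t) as [V1 V2]. lra. split; auto. apply Rle_trans with (1 := V2).
      unfold L. apply Rmult_le_compat_l. lra. apply Rpower_anti; lra. }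
    intros u w Hu Hw. destruct (Rle_or_lt w (p + e0)). apply P1; auto. destruct (Rle_or_lt (p + e0) u). apply P2; auto; lra.
    specialize (P1 u (p + e0) ltac:(lra) ltac:(lra)). specialize (P2 (p + e0) w ltac:(lra) ltac:(lra)).
    assert (E := Cmod_diff_triangle (g w) (g (p + e0)) (g u)). lra.
Qed.

Lemma dR_reflect (g : R -> C) x V : dR g (- x) V -> dR (fun y => g (- y)) x (- V).
Proof.
  intros Hg eps Heps. destruct (Hg eps Heps) as [d [Hd H1]]. exists d. split; auto. intros y Hy.
  specialize (H1 (- y)). replace (RtoC (- y) - RtoC (- x))%C with (- (y - x))%C in H1 by (rewrite !RtoC_opp; ring).
  rewrite Cmod_opp in H1. specialize (H1 Hy).
  replace (g (- y)%R - g (- x)%R - (y - x) * - V)%C with (g (- y)%R - g (- x)%R - - (y - x) * V)%C by ring. auto.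
Qed.

Lemma cR_reflect (g : R -> C) x : cR g (- x) -> cR (fun y => g (- y)) x.
Proof.
  intros Hg eps Heps. destruct (Hg eps Heps) as [d [Hd H1]]. exists d. split; auto. intros y Hy. apply H1.
  replace (RtoC (- y) - RtoC (- x))%C with (- (y - x))%C by (rewrite !RtoC_opp; ring). rewrite Cmod_opp. auto.
Qed.

Lemma ac_dominated_left (g : R -> C) (p A c0 : R) : A < p -> 0 < c0 ->
  (forall x, A <= x <= p -> cR g x) ->
  (forall x, A <= x < p -> exists V, dR g x V /\ Cmod V <= c0 * Rpower (p - x) (- k)) ->
  ac_dominated g A p.
Proof.
  intros HpB Hc0 Hcont Hder. apply ac_dominated_reflect. apply ac_dominated_right with c0; try lra.
  - intros x Hx. apply cR_reflect, Hcont. lra.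
  - intros x Hx. destruct (Hder (- x)) as [V [V1 V2]]. lra. exists (- V)%C. split. apply dR_reflect; auto.
    rewrite Cmod_opp. replace (x - - p) with (p - - x) by ring. auto.
Qed.

End Singular.

Section ACL.
Context {a b k : R} {c : C} {f : C -> C} (H : chain a b k c f).
Local Notation ext := (ext H).
Let Hk : 0 <= k < 1 := ch_k H.

Lemma dR_translate (g : R -> C) (x : R) V : dR (fun t => g (x + t)) 0 V -> dR g x V.
Proof.
  intros Hg eps Heps. destruct (Hg eps Heps) as [d [Hd H1]]. exists d. split; auto. intros y Hy.
  specialize (H1 (y - x)). cbv beta in H1. replace (RtoC (y - x) - 0)%C with (y - x)%C in H1 by (rewrite RtoC_minus; ring).
  rewrite Rplus_0_r in H1. replace (x + (y - x)) with y in H1 by ring. auto.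
Qed.

(** [P] is the foot of the perpendicular from 0, so [|P + x e|^2 = |P|^2 + x^2]. The hypothesis on
    [|P|] excludes tangent lines: any other line meets the circle transversally or not at all, and
    the distance to the circle is comparable to the distance along the line from a crossing. At a
    tangency it would be quadratic, and the singularity [x^(-2k)] need not be integrable. *)
Lemma ext_line_ac (P e : C) (A B : R) : Cmod e = 1 -> fst P * fst e + snd P * snd e = 0 -> Cmod P <> 1 -> A <= B ->
  abs_cont_on (fun x => ext (P + x * e)%C) A B.
Proof.
  intros He Hdot HP HAB. apply ac_dominated_abs_cont.
  set (g := fun x : R => ext (P + x * e)%C).
  set (R1 := Rmax (Rabs A) (Rabs B) + Cmod P + 2).
  assert (HA1 : Rabs A <= R1 - Cmod P - 2) by (unfold R1; assert (E := Rmax_l (Rabs A) (Rabs B)); lra).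
  assert (HB1 : Rabs B <= R1 - Cmod P - 2) by (unfold R1; assert (E := Rmax_r (Rabs A) (Rabs B)); lra).
  assert (HP0 := Cmod_ge_0 P). assert (HA0 := Rabs_pos A).
  assert (HA2 := Rle_abs (- A)). rewrite Rabs_Ropp in HA2. assert (HB2 := Rle_abs B).
  assert (Hsq : forall x : R, Cmod (P + x * e) * Cmod (P + x * e) = Cmod P * Cmod P + x * x).
  { intros x. rewrite !Cmod_sqr. assert (E := Cmod_sqr e). rewrite He in E. simpl.
    replace (Cmod P * Cmod P + x * x) with (Cmod P * Cmod P + x * x * (1 * 1)) by ring.
    transitivity (fst P * fst P + snd P * snd P + 2 * x * (fst P * fst e + snd P * snd e) + x * x * (fst e * fst e + snd e * snd e)). ring.
    rewrite Hdot, <- E. ring. }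
  set (R0 := R1 + Cmod P + 1).
  destruct (ext_deriv_bound H R0) as [C0 [HC0 Hbound]]. unfold R0. lra.
  assert (Hmod : forall x, - R1 <= x <= R1 -> Cmod (P + x * e) <= R0).
  { intros x Hx. apply Rle_trans with (1 := Cmod_triangle _ _). rewrite Cmod_RtoC_mult, He.
    assert (Rabs x <= R1) by (apply Rabs_le; lra). unfold R0. lra. }
  set (dl := 1 - Cmod P * Cmod P). assert (Hdl : dl <> 0) by (unfold dl; nra).
  assert (HR0 : 0 < R0 + 1) by (unfold R0; lra).
  assert (Hgc : forall x, cR g x).
  { intros x. apply (cG_comp RtoC ext (fun x => P + x * e)%C). eapply dG_cG, dR_affine. apply ext_continuous. }
  assert (Hgd : forall x m, - R1 <= x <= R1 -> 0 < m -> m <= Rabs (x * x - dl) ->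
    exists V, dR g x V /\ Cmod V <= C0 * Rpower (m / (R0 + 1)) (- k)).
  { intros x m Hx Hm Hmx. specialize (Hmod x Hx). specialize (Hsq x). set (z := (P + x * e)%C) in *.
    assert (Hz0 := Cmod_ge_0 z).
    assert (Hprod : x * x - dl = (Cmod z - 1) * (Cmod z + 1)) by (unfold dl; nra).
    assert (Hz1 : m / (R0 + 1) <= Rabs (Cmod z - 1)).
    { apply Rle_div_l; auto. apply Rle_trans with (1 := Hmx). rewrite Hprod, Rabs_mult, (Rabs_pos_eq (Cmod z + 1)) by lra.
      apply Rmult_le_compat_l. apply Rabs_pos. lra. }
    assert (Hmp : 0 < m / (R0 + 1)) by (apply Rdiv_lt_0_compat; lra).
    destruct (Hbound z e) as [V [V1 V2]]; auto.
    { intros E. rewrite E, Rminus_eq_0, Rabs_R0 in Hz1. lra. }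
    exists V. split.
    - apply dR_translate. apply dG_ext_loc with (f := fun t : R => ext (z + t * e)%C) (d := 1); auto. lra.
      intros y _. unfold g, z. f_equal. rewrite RtoC_plus. ring.
    - apply Rle_trans with (1 := V2). apply Rmult_le_compat_l. lra. apply Rpower_anti; lra. }
  apply ac_dominated_restrict with (- R1) R1; try lra.
  destruct (Rlt_or_le dl 0) as [Hneg|Hpos].
  - destruct (dR_choose g (fun x => - R1 <= x <= R1) (fun x V => Cmod V <= C0 * Rpower (- dl / (R0 + 1)) (- k))) as [v Hv].
    { intros x Hx. apply Hgd; auto. lra. rewrite Rabs_pos_eq; nra. }
    apply ac_dominated_lipschitz with (C0 * Rpower (- dl / (R0 + 1)) (- k)).
    + apply Rmult_le_pos. lra. left; apply exp_pos.
    + intros u w Hu Hw. apply (dR_lipschitz g v). lra. intros t Ht. apply Hv. lra.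
  - set (x0 := sqrt dl). assert (Hx0 : 0 < x0) by (apply sqrt_lt_R0; lra).
    assert (Hx0s : x0 * x0 = dl) by (apply sqrt_sqrt; lra).
    assert (Hx0R : x0 < R1). { assert (Hd1 : dl <= 1) by (unfold dl; nra). clearbody x0. clear - Hd1 Hx0 Hx0s HA1 HA0 HP0. assert (x0 <= 1) by nra. lra. }
    set (c0 := C0 * Rpower (x0 / (R0 + 1)) (- k)). assert (Hc0 : 0 < c0) by (apply Rmult_lt_0_compat; auto; apply exp_pos).
    (* The line crosses the circle at [x0] and [-x0]. On each side of 0 one factor of [x^2 - x0^2]
       has modulus at least [x0], so the other one controls the distance to the circle. *)
    assert (Hnear : forall x d, - R1 <= x <= R1 -> 0 < d -> x0 * d <= Rabs (x * x - dl) ->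
      exists V, dR g x V /\ Cmod V <= c0 * Rpower d (- k)).
    { intros x d Hx Hd Hle. destruct (Hgd x (x0 * d) Hx ltac:(nra) Hle) as [V [V1 V2]]. exists V. split; auto.
      apply Rle_trans with (1 := V2). right. unfold c0. rewrite Rmult_assoc. f_equal.
      rewrite Rpower_mult_distr by (auto; apply Rdiv_lt_0_compat; lra). f_equal. field. lra. }
    apply ac_dominated_glue with (- x0); try lra; [|apply ac_dominated_glue with 0; try lra; [|apply ac_dominated_glue with x0; try lra]].
    + apply (ac_dominated_left k Hk) with c0; try lra; auto. intros x Hx. apply Hnear; try lra. rewrite <- Hx0s, Rabs_pos_eq; nra.
    + apply (ac_dominated_right k Hk) with c0; try lra; auto. intros x Hx. apply Hnear; try lra. rewrite <- Hx0s, Rabs_left1; nra.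
    + apply (ac_dominated_left k Hk) with c0; try lra; auto. intros x Hx. apply Hnear; try lra. rewrite <- Hx0s, Rabs_left1; nra.
    + apply (ac_dominated_right k Hk) with c0; try lra; auto. intros x Hx. apply Hnear; try lra. rewrite <- Hx0s, Rabs_pos_eq; nra.
Qed.

(** Covers the lines tangent to the unit circle, the only ones left out; degenerate intervals
    suffice. *)
Lemma null1_pm1 (Q : R -> Prop) : (forall x, Q x -> x = 1 \/ x = -1) -> null1 Q.
Proof.
  intros HS eps Heps. exists (fun n => match n with O => 1 | _ => -1 end), (fun n => match n with O => 1 | _ => -1 end).
  split; [|split].
  - intros; lra.
  - intros x Hx. destruct (HS x Hx) as [-> | ->]; [exists O|exists 1%nat]; lra.
  - intros N. rewrite (sum_eq _ (fun _ => 0)). rewrite sum_cte. lra. intros; lra.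
Qed.

Lemma ext_ACL : ACL_C ext.
Proof.
  split; apply null1_pm1; intros y Hy; apply NNPP; intros Hne; apply Hy; intros A B HAB.
  - assert (E := ext_line_ac (0, y) 1 A B).
    replace (fun x => ext (x, y)) with (fun x : R => ext ((0, y) + x * 1)%C).
    2: { apply FunctionalExtensionality.functional_extensionality. intros x. f_equal. apply C_ext; simpl; ring. }
    apply E; auto. apply Cmod_1. simpl; ring.
    intros E1. assert (E2 := Cmod_sqr (0, y)). rewrite E1 in E2. simpl in E2. apply Hne.
    destruct (Rle_or_lt 0 y); [left|right]; nra.
  - assert (E := ext_line_ac (y, 0) Ci A B).
    replace (fun x => ext (y, x)) with (fun x : R => ext ((y, 0) + x * Ci)%C).
    2: { apply FunctionalExtensionality.functional_extensionality. intros x. f_equal. apply C_ext; simpl; ring. }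
    apply E; auto. apply Cmod_Ci. simpl; ring.
    intros E1. assert (E2 := Cmod_sqr (y, 0)). rewrite E1 in E2. simpl in E2. apply Hne.
    destruct (Rle_or_lt 0 y); [left|right]; nra.
Qed.

End ACL.

(** * The unit circle as a plane null set *)

Lemma unit_angle (z : C) : Cmod z = 1 -> exists t, - PI <= t <= PI /\ z = (cos t, sin t).
Proof.
  intros Hz. destruct (classic (slit z)) as [Hs|Hs].
  - exists (Carg z). assert (E := Carg_bound z). split. lra.
    rewrite <- (Cexp_Clog z Hs) at 1. unfold Cexp, Clog. simpl. rewrite Hz, ln_1, exp_0. apply C_ext; simpl; ring.
  - apply slit_iff in Hs. destruct Hs as [H1 H2]. assert (E := Cmod_sqr z). rewrite Hz, H1 in E.
    exists PI. assert (H3 := PI_RGT_0). split. lra. rewrite cos_PI, sin_PI. apply C_ext; simpl; nra.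
Qed.

Lemma cos_sin_lip (x y : R) : Rabs (cos x - cos y) <= Rabs (x - y) /\ Rabs (sin x - sin y) <= Rabs (x - y).
Proof.
  assert (Hg : forall g g1 : R -> R, (forall t, is_derive g t (g1 t)) -> (forall t, Rabs (g1 t) <= 1) -> Rabs (g x - g y) <= Rabs (x - y)).
  { intros g g1 Hd Hb. destruct (MVT_gen g y x g1) as [t [_ Ht]].
    - intros t _. apply Hd.
    - intros t _. apply ex_derive_continuity_pt. eexists. apply Hd.
    - rewrite Ht, Rabs_mult. specialize (Hb t). assert (E := Rabs_pos (x - y)). nra. }
  split.
  - apply (Hg cos (fun t => - sin t)). intros t. auto_derive; auto; ring. intros t. rewrite Rabs_Ropp. apply Rabs_le. apply SIN_bound.
  - apply (Hg sin cos). intros t. auto_derive; auto; ring. intros t. apply Rabs_le. apply COS_bound.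
Qed.

Lemma null2_circle (Q : C -> Prop) : (forall z, Q z -> Cmod z = 1) -> null2 Q.
Proof.
  intros HS eps Heps. assert (HPI := PI_RGT_0).
  (* Squares of half-width [d = 2 PI / N] about [N + 1] equally spaced angles cover the circle.
     Their total area is at most [2 N * 4 d^2 = 32 PI^2 / N]. *)
  destruct (archimed_cor1 (eps / (32 * PI * PI))) as [N [HN1 HN2]]. { apply Rdiv_lt_0_compat; nra. }
  assert (HN := lt_0_INR N HN2). set (d := 2 * PI / INR N). assert (Hd : 0 < d) by (apply Rdiv_lt_0_compat; lra).
  set (th := fun n : nat => - PI + INR n * d).
  set (w := fun n : nat => if (n <=? N)%nat then d else 0).
  assert (Hw0 : forall n, 0 <= w n) by (intros n; unfold w; destruct (n <=? N)%nat; lra).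
  exists (fun n => cos (th n) - w n), (fun n => cos (th n) + w n), (fun n => sin (th n) - w n), (fun n => sin (th n) + w n).
  split; [|split].
  - intros n. specialize (Hw0 n). lra.
  - intros z Hz. destruct (unit_angle z (HS z Hz)) as [t [Ht ->]].
    assert (Hex : exists n : nat, (n <= N)%nat /\ Rabs (t - th n) <= d).
    { set (x := (t + PI) / d). assert (Hx : 0 <= x <= INR N).
      { unfold x. split. apply Rdiv_le_0_compat; lra. apply Rle_div_l; auto. unfold d. replace (INR N * (2 * PI / INR N)) with (2 * PI) by (field; lra). lra. }
      destruct (nfloor_ex x (proj1 Hx)) as [n [Hn1 Hn2]]. exists n. split. apply INR_le. lra.
      replace (t - th n) with ((x - INR n) * d) by (unfold th, x; field; lra).
      rewrite Rabs_mult, (Rabs_pos_eq d), Rabs_pos_eq by lra. nra. }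
    destruct Hex as [n [Hn1 Hn2]]. exists n. unfold w. apply Nat.leb_le in Hn1. rewrite Hn1.
    destruct (cos_sin_lip t (th n)) as [L1 L2].
    assert (M1 := Rle_trans _ _ _ L1 Hn2). assert (M2 := Rle_trans _ _ _ L2 Hn2).
    apply Rabs_le_between in M1. apply Rabs_le_between in M2. simpl. lra.
  - assert (Hdd : 0 < d * d) by (apply Rmult_lt_0_compat; auto).
    intros n. rewrite (sum_eq _ (fun n => if (n <=? N)%nat then 4 * d * d else 0)).
    2: { intros i _. unfold w. destruct (i <=? N)%nat; ring. }
    assert (E : forall m, sum_f_R0 (fun n => if (n <=? N)%nat then 4 * d * d else 0) m <= INR (S N) * (4 * d * d)).
    { assert (E : forall m, sum_f_R0 (fun n => if (n <=? N)%nat then 4 * d * d else 0) m <= INR (S (min m N)) * (4 * d * d)).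
      { induction m as [|m IH].
        - simpl. destruct N; simpl; lra.
        - rewrite tech5. destruct (S m <=? N)%nat eqn:Em.
          + apply Nat.leb_le in Em. replace (min (S m) N) with (S m) by lia. replace (min m N) with m in IH by lia. rewrite (S_INR (S m)). lra.
          + apply Nat.leb_gt in Em. replace (min (S m) N) with N by lia. replace (min m N) with N in IH by lia. lra. }
      intros m. apply Rle_trans with (1 := E m). apply Rmult_le_compat_r. lra. apply le_INR. lia. }
    apply Rle_trans with (1 := E n). rewrite S_INR.
    assert (HN3 : 1 <= INR N) by (apply (le_INR 1); lia).
    apply Rle_trans with (2 * INR N * (4 * d * d)). apply Rmult_le_compat_r; lra.
    unfold d. replace (2 * INR N * (4 * (2 * PI / INR N) * (2 * PI / INR N))) with (2 * (16 * PI * PI) * / INR N) by (field; lra).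
    assert (Hpp : 0 < 32 * PI * PI) by nra.
    apply Rlt_le in HN1. apply (Rmult_le_compat_l (32 * PI * PI)) in HN1; [|lra].
    replace (32 * PI * PI * (eps / (32 * PI * PI))) with eps in HN1 by (field; lra). lra.
Qed.

(** * Injectivity *)

Section Injectivity.
Context {a b k : R} {c : C} {f : C -> C} (H : chain a b k c f).

Local Notation s := ((a, b) : C).
Local Notation G := (chainG H).
Local Notation q := (chainq H).
Local Notation outT := (@outer_time a).
Local Notation region := (@region a).
Local Notation Psi := (chain_map H).
Local Notation ext := (ext H).
Let Ha : 0 < a := ch_a H.
Let Hk : 0 <= k < 1 := ch_k H.

Lemma near_0 (g : C -> C) (g1 : C -> C) eps : derivD g g1 -> 0 < eps ->
  exists T1, 0 < T1 /\ forall T z, T1 <= T -> region T z -> Cmod (g z - g 0) < eps.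
Proof.
  intros Hg Heps. assert (Hc : cC g 0) by (eapply dG_cG, Hg; rewrite Cmod_0; lra).
  destruct (Hc eps Heps) as [d [Hd H1]]. destruct (region_small H d Hd) as [T1 [HT1 H2]].
  exists T1. split; auto. intros T z HT Hr. apply H1. replace (z - 0)%C with z by ring. eapply H2; eauto.
Qed.

Lemma cq_lower : exists T1, 0 < T1 /\ forall T z, T1 <= T -> region T z -> a / 4 * T <= Cmod (c * q T z).
Proof.
  destruct (near_0 (cp H) (cp1 H) (1 / 2) (p_deriv H)) as [T1 [HT1 Hp]]. lra.
  assert (Hc := Cmod_pos c (c_neq_0 H)).
  exists (T1 + 4 * Cmod c / a). assert (H0 : 0 < 4 * Cmod c / a) by (apply Rdiv_lt_0_compat; lra). split. lra.
  intros T z HT Hr. specialize (Hp T z ltac:(lra) Hr). rewrite (p_0 H) in Hp.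
  replace (c * q T z)%C with (c - (a * T)%R * cp H z)%C.
  2: { unfold chainq. rewrite RtoC_mult. field. apply (c_neq_0 H). }
  assert (E := Cmod_triangle_rev ((a * T)%R * cp H z) c). rewrite (Cmod_sub_sym _ c), Cmod_RtoC_mult, Rabs_pos_eq in E by nra.
  assert (E2 := Cmod_triangle_rev 1 (cp H z)). rewrite Cmod_sub_sym, Cmod_1 in E2.
  assert (E3 : 4 * Cmod c <= a * T). { replace (4 * Cmod c) with (a * (4 * Cmod c / a)) by (field; lra). apply Rmult_le_compat_l; lra. }
  assert (a * T * (1 / 2) <= a * T * Cmod (cp H z)) by (apply Rmult_le_compat_l; nra). lra.
Qed.

Definition PsiD (T : R) (z : C) : C := (- (Cexp (s * Clog (q T z)) * cf1 H z * G T z / (c * q T z)))%C.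

Lemma dC_q T z : Cmod z < 1 -> dC (q T) z (- (a * T / c) * cp1 H z).
Proof.
  intros Hz. eapply dG_eq. apply (dG_chainq H (fun z : C => z) (fun _ => T) (fun z => z) z 0 1); auto.
  apply dG_const. apply dG_param. cbv beta. assert (Hc := c_neq_0 H). field. auto.
Qed.

Lemma dC_Psi T z : region T z -> dC (Psi T) z (PsiD T z).
Proof.
  intros Hr. assert (Hz : Cmod z < 1) by apply Hr. eapply dG_eq.
  - apply (dG_Psi H (fun z : C => z) (fun _ => T) (fun z => z) z 0 1); auto. apply dG_param. apply dC_q; auto.
  - cbv beta. unfold PsiD. assert (Hq := q_neq_0 H T z Hr). assert (Hc := c_neq_0 H). assert (Hs := s_neq_0 a b Ha).
    assert (E : (z * cp1 H z)%C = (cp H z * (cE H z - cp H z) / s)%C).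
    { rewrite <- (p1_E H z Hz). field. auto. }
    rewrite (f_lam H z Hz), (f1_p H z Hz). set (X := Cexp (s * Clog (q T z))). set (L := Cexp (clam H z)).
    transitivity (X * (cp H z * L + L * s * (- (a * T / c) * (z * cp1 H z)) / q T z))%C. { field. auto. }
    rewrite E. unfold chainG. unfold chainq in *. field. split; [auto|split; auto].
    intros F. apply Hq. transitivity ((c - a * T * cp H z) / c)%C. field; auto. rewrite F. field. auto.
Qed.

Lemma region_segment T z w t : region T z -> region T w -> 0 <= t <= 1 -> region T (segment z w t).
Proof.
  intros [Hz0 [Hz1 Hz2]] [_ [Hw1 Hw2]] Ht.
  assert (E := segment_ball z w 0 t (Rmax (Cmod z) (Cmod w)) Ht).
  replace (z - 0)%C with z in E by ring. replace (w - 0)%C with w in E by ring.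
  replace (segment z w t - 0)%C with (segment z w t) in E by ring.
  specialize (E (Rmax_l _ _) (Rmax_r _ _)). assert (E0 := Cmod_ge_0 (segment z w t)).
  split; [auto|]. unfold Rmax in E. destruct Rle_dec; split; try lra; simpl in *; nra.
Qed.

Lemma region_center T : 0 <= T -> region T 0.
Proof.
  intros HT. split; [auto|]. rewrite Cmod_0. split. lra. simpl. rewrite Rmult_0_l. left; apply exp_pos.
Qed.

(** The logarithmic derivative of [q] is [- a T p' / (c q)]. Since [|c q| >= a T / 4] by [cq_lower],
    it is bounded uniformly in large [T]. *)
Lemma logq_near : exists B T1, 0 < B /\ 0 < T1 /\ forall T z, T1 <= T -> region T z ->
  Cmod (Clog (q T z) - Clog (q T 0)) <= B * Cmod z.
Proof.
  destruct cq_lower as [T1 [HT1 Hq]]. destruct (region_small H (1 / 2)) as [T2 [HT2 Hsm]]. lra.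
  destruct (contD_bounded (cp1 H) (1 / 2)) as [B [HB HB1]]. apply (p1_cont H). lra.
  exists (4 * B), (T1 + T2). split; [lra|split; [lra|]]. intros T z HT Hr.
  assert (Hr0 := region_center T ltac:(lra)).
  replace (Clog (q T z) - Clog (q T 0))%C with (Clog (q T z) - Clog (q T 0) - (z - 0) * 0)%C by ring.
  replace (Cmod z) with (Cmod (z - 0)) by (f_equal; ring).
  apply (dC_lipschitz_segment (fun z => Clog (q T z)) (fun z => - (a * T / c) * cp1 H z * / q T z)%C).
  intros t Ht. assert (Hrs := region_segment T 0 z t Hr0 Hr Ht). set (y := segment 0 z t) in *.
  assert (Hc := c_neq_0 H). assert (Hqn := q_neq_0 H T y Hrs). split.
  - apply (dG_comp _ Clog (q T)). apply dC_q, Hrs. apply dC_Clog, q_slit, Hrs.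
  - replace (- (a * T / c) * cp1 H y * / q T y - 0)%C with (- ((a * T)%R * cp1 H y) / (c * q T y))%C.
    2: { rewrite RtoC_mult. field. auto. }
    specialize (Hq T y ltac:(lra) Hrs). specialize (HB1 y (Rlt_le _ _ (Hsm T y ltac:(lra) Hrs))).
    assert (HaT : 0 < a * T) by (apply Rmult_lt_0_compat; lra).
    rewrite Cmod_div, Cmod_opp, Cmod_RtoC_mult, Rabs_pos_eq by (try apply Cmult_neq_0; auto; lra).
    apply Rle_div_l. lra. apply Rle_trans with (a * T * B). apply Rmult_le_compat_l; lra.
    apply Rle_trans with (4 * B * (a / 4 * T)). right; field. apply Rmult_le_compat_l; lra.
Qed.

Lemma near_one_mult (u v : C) (e d : R) : Cmod (u - 1) <= e -> Cmod (v - 1) <= d -> Cmod (u * v - 1) <= e + d + e * d.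
Proof.
  intros Hu Hv. replace (u * v - 1)%C with ((u - 1) + (v - 1) + (u - 1) * (v - 1))%C by ring.
  apply Rle_trans with (1 := Cmod_triangle _ _). rewrite Cmod_mult.
  assert (E := Cmod_triangle (u - 1) (v - 1)). assert (H1 := Cmod_ge_0 (u - 1)). assert (H2 := Cmod_ge_0 (v - 1)).
  assert (Cmod (u - 1) * Cmod (v - 1) <= e * d) by (apply Rmult_le_compat; auto). lra.
Qed.

(** For large [T] the map [Psi T] is close to a dilation on the small disc where it is considered. *)
Lemma Psi_expanding : exists T1, 0 < T1 /\ forall T, T1 <= T -> exists m, 0 < m /\ forall z w, region T z -> region T w ->
  m * Cmod (z - w) <= Cmod (Psi T z - Psi T w).
Proof.
  destruct cq_lower as [T1 [HT1 Hq]]. destruct logq_near as [B [T2 [HB [HT2 Hl]]]].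
  destruct (near_0 (cf1 H) (cder (cf1 H)) (1 / 10)) as [T3 [HT3 Hf]].
  { assert (Hh := Hol_deriv f (cf1 H) (f_deriv H) (f1_cont H)). destruct Hh as [g [Hg _]]. intros z Hz. eapply cder_spec, Hg, Hz. } lra.
  destruct (near_0 (cp H) (cp1 H) (1 / 80) (p_deriv H)) as [T4 [HT4 Hp]]. lra.
  destruct (near_0 (cE H) (cE1 H) (1 / 80) (E_deriv H)) as [T5 [HT5 HE]]. lra.
  assert (Hexp := dG_cG _ _ _ _ (dC_Cexp 0)). destruct (Hexp (1 / 10)) as [d [Hd Hex]]. lra.
  assert (Hs := s_pos H).
  destruct (region_small H (d / (Cmod s * B))) as [T6 [HT6 Hsm]]. { apply Rdiv_lt_0_compat; nra. }
  exists (T1 + T2 + T3 + T4 + T5 + T6). split. lra. intros T HT.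
  assert (Hr0 := region_center T ltac:(lra)).
  set (D0 := Cexp (s * Clog (q T 0))). assert (HD0 : 0 < Cmod D0) by (apply Cmod_pos, Cexp_neq_0).
  exists (Cmod D0 / 2). split. lra.
  assert (Hf1_0 : cf1 H 0 = 1). { rewrite (f1_p H), (p_0 H), (lam_0 H), Cexp_0. ring. rewrite Cmod_0; lra. }
  (* [PsiD] is [D0] times three factors, each within [1/10] of 1, so their product is within [0.331]
     of 1. The two tolerances [1/80] add up to [1/40], and division by [|c q| >= a T / 4] turns this
     into [1/10]. *)
  assert (HDz : forall z, region T z -> Cmod (PsiD T z - D0) <= Cmod D0 / 2).
  { intros z Hr.
    assert (Hqz := q_neq_0 H T z Hr). assert (Hc := c_neq_0 H).
    set (X := (s * (Clog (q T z) - Clog (q T 0)))%C).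
    assert (U1 : Cmod (cf1 H z - 1) <= 1 / 10). { rewrite <- Hf1_0. left; apply (Hf T); auto; lra. }
    assert (U2 : Cmod (Cexp X - 1) <= 1 / 10).
    { rewrite <- Cexp_0. left; apply Hex. replace (X - 0)%C with X by ring. unfold X. rewrite Cmod_mult.
      specialize (Hl T z ltac:(lra) Hr). specialize (Hsm T z ltac:(lra) Hr).
      apply Rle_lt_trans with (Cmod s * (B * Cmod z)). apply Rmult_le_compat_l; lra.
      replace d with (Cmod s * B * (d / (Cmod s * B))) by (field; lra). rewrite <- Rmult_assoc. apply Rmult_lt_compat_l; nra. }
    assert (U3 : Cmod (- (G T z / (c * q T z)) - 1) <= 1 / 10).
    { replace (- (G T z / (c * q T z)) - 1)%C with ((a * T)%R * (cp H z - cE H z) / (c * q T z))%C.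
      2: { rewrite RtoC_mult. unfold chainG. unfold chainq in *. field. split; auto.
           intros F. apply Hqz. transitivity ((c - a * T * cp H z) / c)%C. field; auto. rewrite F. field. auto. }
      specialize (Hq T z ltac:(lra) Hr). specialize (Hp T z ltac:(lra) Hr). specialize (HE T z ltac:(lra) Hr).
      rewrite (p_0 H) in Hp. rewrite (E_0 H) in HE. assert (HaT : 0 < a * T) by (apply Rmult_lt_0_compat; lra).
      rewrite Cmod_div, Cmod_RtoC_mult, Rabs_pos_eq by (try apply Cmult_neq_0; auto; lra).
      apply Rle_div_l. lra.
      assert (E := Cmod_diff_triangle (cp H z) 1 (cE H z)). rewrite (Cmod_sub_sym 1) in E.
      apply Rle_trans with (a * T * (1 / 40)). apply Rmult_le_compat_l; lra. lra. }
    assert (E : PsiD T z = (D0 * (cf1 H z * Cexp X * - (G T z / (c * q T z))))%C).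
    { unfold PsiD, D0. replace (s * Clog (q T z))%C with (s * Clog (q T 0) + X)%C by (unfold X; ring). rewrite Cexp_plus. field. auto. }
    rewrite E. replace (D0 * (cf1 H z * Cexp X * - (G T z / (c * q T z))) - D0)%C with
      (D0 * (cf1 H z * Cexp X * - (G T z / (c * q T z)) - 1))%C by ring.
    rewrite Cmod_mult. assert (W1 := near_one_mult _ _ _ _ U1 U2). assert (W2 := near_one_mult _ _ _ _ W1 U3). nra. }
  intros z w Hz Hw.
  assert (E : Cmod (Psi T w - Psi T z - (w - z) * D0) <= Cmod D0 / 2 * Cmod (w - z)).
  { apply (dC_lipschitz_segment (Psi T) (PsiD T)). intros t Ht. assert (Hr := region_segment T z w t Hz Hw Ht).
    split. apply dC_Psi; auto. apply HDz; auto. }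
  assert (E2 := Cmod_triangle_rev ((w - z) * D0) (- (Psi T w - Psi T z - (w - z) * D0))).
  rewrite Cmod_opp, Cmod_mult in E2.
  replace ((w - z) * D0 - - (Psi T w - Psi T z - (w - z) * D0))%C with (Psi T w - Psi T z)%C in E2 by ring.
  rewrite (Cmod_sub_sym z w), (Cmod_sub_sym (Psi T z)). nra.
Qed.

(** Both points are carried to a late time [T1] where [Psi] is expanding: their distance shrinks at
    most by an exponential factor, and the values of [Psi] change by an arbitrarily small error. A
    positive [Tc] puts the whole region into a disc of radius [rho < 1], so that one constant [L]
    serves all pairs. *)
Lemma Psi_separation Tc del : 0 < Tc -> 0 < del -> exists m, 0 < m /\ forall z w, region Tc z -> region Tc w ->
  del <= Cmod (z - w) -> m <= Cmod (Psi Tc z - Psi Tc w).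
Proof.
  intros HTc Hdel. destruct Psi_expanding as [T0 [HT0 Hexp]]. set (T1 := T0 + Tc).
  destruct (Hexp T1) as [m [Hm Hm1]]. unfold T1; lra.
  set (rho := Rpower (1 + Tc) (- (a / 2))).
  assert (Hln : 0 < ln (1 + Tc)) by (rewrite <- ln_1; apply ln_increasing; lra).
  assert (Hrho : 0 < rho < 1).
  { split. apply exp_pos. unfold rho, Rpower. apply Rlt_le_trans with (exp 0); [|rewrite exp_0; lra]. apply exp_increasing. nra. }
  assert (Hrr : rho * rho = Rpower (1 + Tc) (- a)) by (unfold rho; rewrite <- Rpower_plus; f_equal; field).
  assert (Hreg : forall z, region Tc z -> Cmod z <= rho).
  { intros z [_ [_ Hz]]. rewrite <- Hrr in Hz. simpl in Hz. assert (E := Cmod_ge_0 z). apply Rnot_lt_le. intros Hlt. nra. }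
  destruct (flow_pair H rho T1) as [L [HL Hflow]]; try lra. unfold T1; lra.
  set (kap := del * exp (L * Tc) * exp (- (L * T1))).
  assert (Hkap : 0 < kap) by (unfold kap; repeat apply Rmult_lt_0_compat; auto; apply exp_pos).
  exists (m * kap / 2). split. nra. intros z w Hz Hw Hzw.
  (* Each of the two transports then costs at most [m * kap / 4], together half of the margin. *)
  set (eps := m * kap / (4 * T0)). assert (Heps : 0 < eps) by (apply Rdiv_lt_0_compat; nra).
  destruct (Hflow Tc z w eps) as [z' [w' [Hi1 [Hi2 [E1 [E2 [_ [_ E3]]]]]]]]; auto. unfold T1; lra.
  assert (HT : Tc <= T1) by (unfold T1; lra).
  assert (R1 := inner_region H Tc z T1 z' Hz HT Hi1). assert (R2 := inner_region H Tc w T1 w' Hw HT Hi2).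
  assert (E4 : kap <= Cmod (z' - w')).
  { unfold kap. apply Rmult_le_reg_r with (exp (L * T1)). apply exp_pos.
    rewrite Rmult_assoc, <- exp_plus, Rplus_opp_l, exp_0, Rmult_1_r. apply Rle_trans with (2 := E3).
    apply Rmult_le_compat_r; auto. left; apply exp_pos. }
  specialize (Hm1 z' w' R1 R2). replace (T1 - Tc) with T0 in E1, E2 by (unfold T1; ring).
  replace (eps * T0) with (m * kap / 4) in E1, E2 by (unfold eps; field; lra).
  assert (E5 := Cmod_diff_triangle (Psi T1 z') (Psi Tc z) (Psi T1 w')).
  assert (E6 := Cmod_diff_triangle (Psi Tc z) (Psi Tc w) (Psi T1 w')). rewrite (Cmod_sub_sym (Psi Tc w)) in E6. nra.
Qed.

(** At time 0 no common constant [L] is available, because points may lie arbitrarily near the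
    circle. A short preliminary flow to time [Tc] uses only the displacement bound, which is
    uniform: each point moves at most [del / 4]. Then [Psi_separation] applies. *)
Lemma f_separation del : 0 < del -> exists m, 0 < m /\ forall z w, Cmod z < 1 -> Cmod w < 1 ->
  del <= Cmod (z - w) -> m <= Cmod (f z - f w).
Proof.
  intros Hdel. set (V := a / (1 - k)). assert (HV : 0 < V) by (apply Rdiv_lt_0_compat; lra).
  set (Tc := del / (4 * V)). assert (HTc : 0 < Tc) by (apply Rdiv_lt_0_compat; lra).
  destruct (Psi_separation Tc (del / 2)) as [m [Hm Hm1]]; try lra.
  exists (m / 2). split. lra. intros z w Hz Hw Hzw.
  set (rho := Rmax (Cmod z) (Cmod w)).
  destruct (flow_pair H rho Tc) as [L [HL Hflow]]. { apply Rmax_lub_lt; auto. } lra.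
  set (eps := m / (4 * Tc)). assert (Heps : 0 < eps) by (apply Rdiv_lt_0_compat; lra).
  destruct (Hflow 0 z w eps) as [z' [w' [Hi1 [Hi2 [E1 [E2 [D1 [D2 _]]]]]]]]; auto. lra.
  apply region_0; auto. apply region_0; auto. apply Rmax_l. apply Rmax_r.
  assert (R1 := inner_region H 0 z Tc z' (region_0 z Hz) ltac:(lra) Hi1).
  assert (R2 := inner_region H 0 w Tc w' (region_0 w Hw) ltac:(lra) Hi2).
  rewrite Rminus_0_r, !Psi_at_0 in *. fold V in D1, D2.
  replace (V * Tc) with (del / 4) in D1, D2 by (unfold Tc; field; lra).
  replace (eps * Tc) with (m / 4) in E1, E2 by (unfold eps; field; lra).
  assert (E3 := Cmod_diff_triangle z z' w). assert (E4 := Cmod_diff_triangle z' w' w). rewrite (Cmod_sub_sym z z') in E3.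
  specialize (Hm1 z' w' R1 R2 ltac:(lra)).
  assert (E5 := Cmod_diff_triangle (Psi Tc z') (f z) (Psi Tc w')).
  assert (E6 := Cmod_diff_triangle (f z) (f w) (Psi Tc w')). rewrite (Cmod_sub_sym (f w)) in E6. lra.
Qed.

(** Transported to time [T2], the point [z] lies in a strictly smaller disc by [inner_sq], whereas
    [w] is on the boundary of the region. Their distance is thus bounded below, and both are
    compared at the same time. One trajectory suffices, so [flow_pair] is applied to the pair [z],
    [z]. *)
Lemma cross_separation T1 T2 : 0 <= T1 < T2 -> exists m, 0 < m /\ forall z w, region T1 z -> region T2 w ->
  Cmod w ^ 2 = Rpower (1 + T2) (- a) -> m <= Cmod (Psi T1 z - Psi T2 w).
Proof.
  intros HT. assert (Hme := mexp_bounds H).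
  set (S := Rpower (1 + T2) (- a)). assert (HS : 0 < S) by apply exp_pos.
  set (th := Rpower ((1 + T1) / (1 + T2)) (mexp (a := a) (k := k) - a)).
  assert (Hth : 0 < th < 1).
  { split. apply exp_pos. unfold th, Rpower. apply Rlt_le_trans with (exp 0); [|rewrite exp_0; lra]. apply exp_increasing.
    assert (ln ((1 + T1) / (1 + T2)) < 0). { rewrite <- ln_1. apply ln_increasing. apply Rdiv_lt_0_compat; lra. apply Rlt_div_l; lra. } nra. }
  set (del := sqrt S - sqrt (S * th)).
  assert (Hdel : 0 < del). { unfold del. assert (sqrt (S * th) < sqrt S) by (apply sqrt_lt_1; nra). lra. }
  destruct (Psi_separation T2 del) as [m [Hm Hm1]]; try lra.
  exists (m / 2). split. lra. intros z w Hz Hw HwS.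
  destruct (flow_pair H (Cmod z) T2) as [L [HL Hflow]]; try lra. apply Hz.
  set (eps := m / (2 * (T2 - T1))). assert (Heps : 0 < eps) by (apply Rdiv_lt_0_compat; lra).
  destruct (Hflow T1 z z eps) as [z' [_ [Hi1 [_ [E1 _]]]]]; auto; try lra.
  assert (R1 := inner_region H T1 z T2 z' Hz ltac:(lra) Hi1).
  assert (Q := inner_sq T1 z T2 z' Hz ltac:(lra) Hi1). fold S th in Q.
  replace (eps * (T2 - T1)) with (m / 2) in E1 by (unfold eps; field; lra).
  assert (Z1 : Cmod z' <= sqrt (S * th)).
  { rewrite <- (sqrt_pow2 (Cmod z')) by apply Cmod_ge_0. apply sqrt_le_1_alt. lra. }
  assert (W1 : Cmod w = sqrt S).
  { rewrite <- (sqrt_pow2 (Cmod w)) by apply Cmod_ge_0. f_equal. exact HwS. }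
  assert (D := Cmod_triangle_rev w z'). rewrite Cmod_sub_sym in D.
  specialize (Hm1 z' w R1 Hw ltac:(unfold del; lra)).
  assert (E2 := Cmod_diff_triangle (Psi T2 z') (Psi T1 z) (Psi T2 w)). lra.
Qed.

Lemma out_boundary z : 1 < Cmod z -> Cmod (outw z) ^ 2 = Rpower (1 + outT z) (- a).
Proof.
  intros Hz. unfold outer_time, front_time. replace (1 + (Rpower (/ Cmod z) (- (2 / a)) - 1)) with (Rpower (/ Cmod z) (- (2 / a))) by ring.
  rewrite Rpower_mult. replace (- (2 / a) * - a) with (INR 2) by (simpl; field; lra).
  rewrite Rpower_pow by (apply Rinv_0_lt_compat; lra). rewrite Cmod_outw; auto. apply Cmod_nz; lra.
Qed.

Lemma outw_inj z w : 1 < Cmod z -> 1 < Cmod w -> outw z = outw w -> z = w.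
Proof.
  intros Hz Hw E. unfold outw in E.
  assert (Hcz : Cconj z <> 0) by (apply Cmod_nz; rewrite Cmod_conj; lra).
  assert (Hcw : Cconj w <> 0) by (apply Cmod_nz; rewrite Cmod_conj; lra).
  assert (E2 : Cconj z = Cconj w).
  { transitivity (/ / Cconj z)%C. field; auto. rewrite E. field. auto. }
  rewrite <- (Cconj_conj z), E2. apply Cconj_conj.
Qed.

Lemma ext_closed_disc z eps : Cmod z <= 1 -> 0 < eps -> exists z', Cmod z' < 1 /\ Cmod (z' - z) < eps /\ Cmod (f z' - ext z) < eps.
Proof.
  intros Hz Heps. destruct (ext_continuous H z eps Heps) as [d [Hd Hc]].
  set (e := Rmin (1 / 2) (Rmin d eps / 2)). assert (He0 : 0 < Rmin d eps) by (apply Rmin_glb_lt; auto).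
  assert (He : 0 < e) by (apply Rmin_glb_lt; lra). assert (He1 : e <= 1 / 2) by apply Rmin_l.
  assert (He2 : e <= Rmin d eps / 2) by apply Rmin_r.
  assert (Hd1 := Rmin_l d eps). assert (Hd2 := Rmin_r d eps).
  exists ((1 - e)%R * z)%C. assert (Hz0 := Cmod_ge_0 z).
  assert (E1 : Cmod ((1 - e)%R * z) < 1). { rewrite Cmod_RtoC_mult, Rabs_pos_eq by lra. nra. }
  assert (E2 : Cmod ((1 - e)%R * z - z) <= e).
  { replace ((1 - e)%R * z - z)%C with (- (e * z))%C by (rewrite RtoC_minus; ring).
    rewrite Cmod_opp, Cmod_RtoC_mult, Rabs_pos_eq by lra. nra. }
  split; [auto|split; [lra|]]. rewrite <- (ext_in H) by auto. apply Hc. lra.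
Qed.

(** Points of the closed disc are approximated from inside, where the separation margins are
    uniform. Exterior points with equal images must have equal times by [cross_separation], and then
    [Psi_separation] at that time decides. *)
Lemma ext_injective z w : ext z = ext w -> z = w.
Proof.
  assert (Hdd : forall z w, Cmod z <= 1 -> Cmod w <= 1 -> ext z = ext w -> z = w).
  { clear z w. intros z w Hz Hw E. apply NNPP. intros Hne. apply Cmod_diff_pos in Hne.
    destruct (f_separation (Cmod (z - w) / 2)) as [m [Hm Hm1]]. lra.
    set (eps := Rmin (m / 4) (Cmod (z - w) / 4)). assert (Heps : 0 < eps) by (apply Rmin_glb_lt; lra).
    assert (L1 : eps <= m / 4) by apply Rmin_l. assert (L2 : eps <= Cmod (z - w) / 4) by apply Rmin_r.
    destruct (ext_closed_disc z eps Hz Heps) as [z' [Z1 [Z2 Z3]]].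
    destruct (ext_closed_disc w eps Hw Heps) as [w' [W1 [W2 W3]]].
    assert (D1 := Cmod_diff_triangle z z' w). assert (D2 := Cmod_diff_triangle z' w' w). rewrite (Cmod_sub_sym z z') in D1.
    specialize (Hm1 z' w' Z1 W1 ltac:(lra)).
    assert (D3 := Cmod_diff_triangle (f z') (ext z) (f w')). rewrite E in D3 at 2. rewrite (Cmod_sub_sym (ext w)) in D3. lra. }
  assert (Hdo : forall z w, Cmod z <= 1 -> 1 < Cmod w -> ext z <> ext w).
  { clear z w. intros z w Hz Hw E. assert (Hr := out_region H w Hw).
    destruct (cross_separation 0 (outT w)) as [m [Hm Hm1]].
    { split. lra. unfold outer_time, front_time. assert (E1 := level_lower H (/ Cmod w)). unfold front_time in E1.
      assert (B := out_bounds w Hw). rewrite Cmod_outw in B by (apply Cmod_nz; lra). specialize (E1 B). nra. }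
    destruct (ext_closed_disc z (m / 2) Hz) as [z' [Z1 [_ Z3]]]. lra.
    specialize (Hm1 z' (outw w) (region_0 z' Z1) Hr (out_boundary w Hw)). rewrite Psi_at_0 in Hm1.
    rewrite <- ext_out in Hm1 by auto. rewrite <- E in Hm1. lra. }
  intros E. destruct (Rle_or_lt (Cmod z) 1) as [Hz|Hz]; destruct (Rle_or_lt (Cmod w) 1) as [Hw|Hw].
  - apply Hdd; auto.
  - exfalso. apply (Hdo z w); auto.
  - exfalso. apply (Hdo w z); auto.
  - assert (Hoo : forall z w, 1 < Cmod z -> 1 < Cmod w -> ext z = ext w -> ~ outT z < outT w).
    { clear z w Hz Hw E. intros z w Hz Hw E Hlt. assert (Rz := out_region H z Hz). assert (Rw := out_region H w Hw).
      destruct (cross_separation (outT z) (outT w)) as [m [Hm Hm1]]. { split; auto. apply Rz. }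
      specialize (Hm1 _ _ Rz Rw (out_boundary w Hw)). rewrite <- !ext_out, E in Hm1 by auto.
      replace (ext w - ext w)%C with (RtoC 0) in Hm1 by ring. rewrite Cmod_0 in Hm1. lra. }
    assert (ET : outT z = outT w).
    { destruct (Rtotal_order (outT z) (outT w)) as [Hlt|[Heq|Hgt]]; auto.
      exfalso; apply (Hoo z w); auto. exfalso; apply (Hoo w z); auto. }
    apply outw_inj; auto. apply NNPP. intros Hne. apply Cmod_diff_pos in Hne.
    assert (Rz := out_region H z Hz). assert (Rw := out_region H w Hw). rewrite <- ET in Rw.
    assert (HT : 0 < outT z).
    { assert (E1 := level_lower H (/ Cmod z)). assert (B := out_bounds z Hz). rewrite Cmod_outw in B by (apply Cmod_nz; lra).
      specialize (E1 B). fold (outT z) in E1. nra. }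
    destruct (Psi_separation _ _ HT Hne) as [m [Hm Hm1]].
    specialize (Hm1 _ _ Rz Rw ltac:(lra)). rewrite ET in Hm1 at 2. rewrite <- !ext_out, E in Hm1 by auto.
    replace (ext w - ext w)%C with (RtoC 0) in Hm1 by ring. rewrite Cmod_0 in Hm1. lra.
Qed.

(** At the reflected point [w] one has [|Psi| >= |w| e^(-B) |q|^a e^(-|b| PI)], with
    [|w| = 1 / |z|], [|q| >= K (1 + T)] and [(1 + T)^a = |z|^2]. So the growth is at least linear in
    [|z|]. *)
Lemma ext_large M : exists R0, 1 < R0 /\ forall z, R0 <= Cmod z -> M <= Cmod (ext z).
Proof.
  destruct cq_lower as [T1 [HT1 Hq]]. destruct (lam_bounded H) as [B [HB HB1]].
  assert (Hc := Cmod_pos c (c_neq_0 H)).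
  set (K := a / (8 * Cmod c)). assert (HK : 0 < K) by (apply Rdiv_lt_0_compat; lra).
  set (C1 := exp (- B) * (exp (a * ln K) * exp (- (Rabs b * PI)))).
  assert (HC1 : 0 < C1) by (unfold C1; repeat apply Rmult_lt_0_compat; apply exp_pos).
  set (T2 := T1 + 1).
  exists (Rmax (1 + Rpower (1 + T2) (a / 2)) (Rabs M / C1)). split.
  { apply Rlt_le_trans with (2 := Rmax_l _ _). assert (0 < Rpower (1 + T2) (a / 2)) by apply exp_pos. lra. }
  intros z HR. assert (HR1 := Rle_trans _ _ _ (Rmax_l _ _) HR). assert (HR2 := Rle_trans _ _ _ (Rmax_r _ _) HR).
  assert (HP : 0 < Rpower (1 + T2) (a / 2)) by apply exp_pos.
  assert (Hz : 1 < Cmod z) by lra. assert (Hr := out_region H z Hz). assert (Hb := out_boundary z Hz).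
  assert (Hzw : Cmod (outw z) = / Cmod z) by (apply Cmod_outw, Cmod_nz; lra).
  rewrite ext_out by auto. set (T := outT z) in *. set (w := outw z) in *.
  assert (HzT : Rpower (Cmod z) (2 / a) = 1 + T).
  { unfold T, outer_time, front_time. unfold Rpower. rewrite ln_Rinv by lra. replace (- (2 / a) * - ln (Cmod z)) with (2 / a * ln (Cmod z)) by ring. ring. }
  assert (HT2 : T2 <= T).
  { assert (1 + T2 <= 1 + T); [|lra]. rewrite <- HzT.
    apply Rle_trans with (Rpower (Rpower (1 + T2) (a / 2)) (2 / a)).
    - rewrite Rpower_mult. replace (a / 2 * (2 / a)) with 1 by (field; lra). rewrite Rpower_1; unfold T2; lra.
    - apply Rpower_mono_base. lra. apply Rdiv_le_0_compat; lra. }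
  assert (HzT2 : Rpower (1 + T) a = Cmod z * Cmod z).
  { rewrite <- HzT, Rpower_mult. replace (2 / a * a) with (INR 2) by (simpl; field; lra). rewrite Rpower_pow by lra. simpl. ring. }
  assert (Hql : K * (1 + T) <= Cmod (q T w)).
  { specialize (Hq T w ltac:(unfold T2 in HT2; lra) Hr). rewrite Cmod_mult in Hq.
    apply Rmult_le_reg_l with (Cmod c); auto. apply Rle_trans with (2 := Hq).
    replace (Cmod c * (K * (1 + T))) with (a / 8 * (1 + T)) by (unfold K; field; lra). unfold T2 in HT2. nra. }
  unfold chain_map. rewrite (f_lam H w (proj1 (proj2 Hr))), !Cmod_mult, !Cmod_Cexp, Hzw.
  assert (E1 : exp (- B) <= exp (fst (clam H w))).
  { specialize (HB1 w (proj1 (proj2 Hr))). assert (E := fst_le_Cmod (clam H w)).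
    assert (E2 : - B <= fst (clam H w)). { assert (E3 := Rle_trans _ _ _ E HB1). apply Rabs_le_between in E3. lra. }
    destruct E2 as [E2| ->]. left; apply exp_increasing; auto. lra. }
  assert (HKT : 0 < K * (1 + T)) by (unfold T2 in HT2; apply Rmult_lt_0_compat; lra).
  assert (E2 : exp (a * ln K) * exp (- (Rabs b * PI)) * (Cmod z * Cmod z) <= exp (fst (s * Clog (q T w))%C)).
  { rewrite <- HzT2. unfold Rpower. rewrite <- !exp_plus.
    assert (E : a * ln K + - (Rabs b * PI) + a * ln (1 + T) <= fst (s * Clog (q T w))%C).
    { unfold Clog. simpl. assert (HA := Carg_bound (q T w)).
      assert (ln K + ln (1 + T) <= ln (Cmod (q T w))).
      { rewrite <- ln_mult by (unfold T2 in HT2; lra). destruct Hql as [Hql| ->]. left; apply ln_increasing; auto. lra. }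
      assert (b * Carg (q T w) <= Rabs b * PI).
      { apply Rle_trans with (1 := Rle_abs _). rewrite Rabs_mult. apply Rmult_le_compat_l. apply Rabs_pos. apply Rabs_le. lra. }
      nra. }
    destruct E as [E| ->]. left; apply exp_increasing; auto. lra. }
  apply Rle_trans with (/ Cmod z * exp (- B) * (exp (a * ln K) * exp (- (Rabs b * PI)) * (Cmod z * Cmod z))).
  - replace (/ Cmod z * exp (- B) * (exp (a * ln K) * exp (- (Rabs b * PI)) * (Cmod z * Cmod z))) with (C1 * Cmod z) by (unfold C1; field; lra).
    apply Rle_trans with (1 := Rle_abs M). apply (Rmult_le_compat_l C1) in HR2; [|lra].
    replace (C1 * (Rabs M / C1)) with (Rabs M) in HR2 by (field; lra). lra.
  - assert (0 < / Cmod z) by (apply Rinv_0_lt_compat; lra). apply Rmult_le_compat; auto.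
    + apply Rmult_le_pos. lra. left; apply exp_pos.
    + apply Rmult_le_pos. left; apply Rmult_lt_0_compat; apply exp_pos. nra.
    + apply Rmult_le_compat_l; lra.
Qed.

End Injectivity.

(** * Winding numbers *)

Definition polar (g : R -> C) (theta : R -> R) : Prop :=
  forall t, 0 <= t <= 1 -> g t = (Cmod (g t) * cos (theta t), Cmod (g t) * sin (theta t)).

Definition wind1 (g : R -> C) : Prop :=
  exists theta : R -> R, (forall t, continuity_pt theta t) /\ polar g theta /\ theta 1 - theta 0 = 2 * PI.

(** The argument function has to be continuous on all of [R], while curves are controlled only on
    [[0, 1]]; composing with [clamp] extends it. *)
Definition clamp (t : R) : R := Rmax 0 (Rmin t 1).

Lemma clamp_in t : 0 <= clamp t <= 1.
Proof. unfold clamp, Rmax, Rmin. repeat destruct Rle_dec; lra. Qed.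

Lemma clamp_id t : 0 <= t <= 1 -> clamp t = t.
Proof. intros Ht. unfold clamp, Rmax, Rmin. repeat destruct Rle_dec; lra. Qed.

Lemma clamp_lip t u : Rabs (clamp t - clamp u) <= Rabs (t - u).
Proof. unfold clamp, Rmax, Rmin. repeat destruct Rle_dec; unfold Rabs; repeat destruct Rcase_abs; lra. Qed.

Lemma cR_comp_clamp (g : R -> C) t : (forall t, cR g t) -> cR (fun t => g (clamp t)) t.
Proof.
  intros Hg eps Heps. destruct (Hg (clamp t) eps Heps) as [d [Hd H1]]. exists d. split; auto. intros u Hu. apply H1.
  rewrite <- !RtoC_minus, !Cmod_R in *. apply Rle_lt_trans with (2 := Hu). apply clamp_lip.
Qed.

Lemma continuity_of_cR (h : R -> R) t : cR (fun t => RtoC (h t)) t -> continuity_pt h t.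
Proof. intros Hh. apply (cR_components (fun t => RtoC (h t)) t Hh). Qed.

Lemma cR_of_continuity (h : R -> R) t : continuity_pt h t -> cR (fun t => RtoC (h t)) t.
Proof.
  intros Hh. apply (cG_real RtoC h (fun t => t)); auto. eapply dG_cG, dG_param.
Qed.

Lemma close_to_one_slit (z : C) : Cmod (z - 1) < 1 -> slit z.
Proof.
  intros Hz. unfold slit. assert (E := fst_le_Cmod (z - 1)). simpl in E. assert (E2 := Rle_lt_trans _ _ _ E Hz).
  apply Rabs_lt_between in E2. assert (E3 := Cmod_ge_0 z). lra.
Qed.

(** A Rouché argument: [h / g] stays within distance less than 1 of 1, so its principal argument is
    continuous, and adding it to an argument of [g] gives one of [h]. On a closed curve this
    correction has equal end values. *)
Lemma wind1_close (g h : R -> C) : (forall t, cR g t) -> (forall t, cR h t) -> g 0 = g 1 -> h 0 = h 1 ->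
  (forall t, 0 <= t <= 1 -> Cmod (h t - g t) < Cmod (g t)) -> wind1 g -> wind1 h.
Proof.
  intros Hg Hh Hg01 Hh01 Hclose [th [Hc [Hp Hw]]].
  assert (Hg0 : forall t, 0 <= t <= 1 -> g t <> 0).
  { intros t Ht. apply Cmod_nz. apply Rle_lt_trans with (2 := Hclose t Ht). apply Cmod_ge_0. }
  assert (Hs : forall t, 0 <= t <= 1 -> slit (h t / g t)).
  { intros t Ht. apply close_to_one_slit. specialize (Hg0 t Ht). replace (h t / g t - 1)%C with ((h t - g t) / g t)%C by (field; auto).
    rewrite Cmod_div by auto. apply Rlt_div_l. apply Cmod_pos; auto. rewrite Rmult_1_l. auto. }
  exists (fun t => th (clamp t) + Carg (h (clamp t) / g (clamp t))). split; [|split].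
  - intros t. apply continuity_of_cR. apply cG_realplus.
    + apply (cR_comp_clamp (fun t => RtoC (th t))). intros u. apply cR_of_continuity, Hc.
    + assert (Ht := clamp_in t).
      apply (cG_comp RtoC (fun w => RtoC (Carg w)) (fun t => h (clamp t) / g (clamp t))%C).
      * apply cG_mult. apply cR_comp_clamp; auto. apply cG_inv; auto. apply cR_comp_clamp; auto.
      * apply cC_Carg; auto.
  - intros t Ht. rewrite clamp_id by auto. specialize (Hp t Ht). specialize (Hs t Ht). specialize (Hg0 t Ht).
    assert (E := Cexp_Clog _ Hs). set (u := (h t / g t)%C) in *.
    assert (Eh : h t = (g t * u)%C) by (unfold u; field; auto).
    unfold Cexp, Clog in E. simpl in E. rewrite exp_ln in E by (apply Cmod_pos, slit_neq_0, Hs).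
    rewrite Eh, Cmod_mult, cos_plus, sin_plus.
    transitivity (Cmult (Cmod (g t) * cos (th t), Cmod (g t) * sin (th t)) (Cmod u * cos (Carg u), Cmod u * sin (Carg u))).
    + rewrite <- Hp, E. reflexivity.
    + apply C_ext; simpl; ring.
  - rewrite !clamp_id, Hg01, Hh01 by lra. lra.
Qed.

(** The pair of homotopy parameters is encoded as one complex number, so that continuity and
    compactness are those of the plane. Neighbouring curves are within half the modulus, uniformly
    in [t], which makes each close to the other; winding number one therefore passes in both
    directions, as [real_induction] demands. *)
Lemma wind1_homotopy (h : C -> C) : (forall p, cC h p) -> (forall l, h (l, 0) = h (l, 1)) ->
  (forall l t, 0 <= l <= 1 -> 0 <= t <= 1 -> h (l, t) <> 0) ->
  wind1 (fun t => h (0, t)) -> wind1 (fun t => h (1, t)).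
Proof.
  intros Hc H01 Hn H0.
  assert (Hline : forall l t, cR (fun t => h (l, t)) t).
  { intros l t. apply (cG_comp RtoC h (fun t => (l, t))); auto.
    apply cR_of_components; simpl. apply continuity_pt_const; intros x y; reflexivity. apply derivable_continuous_pt, derivable_pt_id. }
  assert (Hloc : forall l, 0 <= l <= 1 -> exists m, 0 < m /\ forall l' t, 0 <= t <= 1 -> Rabs (l' - l) < m ->
     Cmod (h (l', t) - h (l, t)) < Cmod (h (l, t)) / 2).
  { intros l Hl.
    destruct (compact_uniform 1 (fun p q => 0 <= fst p <= 1 /\ snd p = 0 /\ q = 0)
      (fun p q m => forall l', Rabs (l' - l) < m -> Cmod (h (l', fst p) - h (l, fst p)) < Cmod (h (l, fst p)) / 2)) as [m [Hm Hm1]].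
    - intros p q [H1 [H2 ->]]. rewrite Cmod_0. split; [|lra]. apply Rle_trans with (1 := Cmod_le_abs p).
      rewrite H2, Rabs_R0, Rabs_pos_eq; lra.
    - intros p q Hap.
      assert (E : forall del, 0 < del -> - del < fst p < 1 + del /\ - del < snd p < del /\ Cmod q < del).
      { intros del Hdel. destruct (Hap del Hdel) as [p' [q' [[H1 [H2 ->]] [H3 H4]]]].
        assert (K1 := Rle_lt_trans _ _ _ (fst_le_Cmod _) H3). assert (K2 := Rle_lt_trans _ _ _ (snd_le_Cmod _) H3). simpl in K1, K2.
        apply Rabs_lt_between in K1. apply Rabs_lt_between in K2. rewrite Cmod_sub_sym in H4.
        replace (q - 0)%C with q in H4 by ring. lra. }
      split; [|split].
      + split; apply Rnot_lt_le; intros Hlt. destruct (E (- fst p)); lra. destruct (E (fst p - 1)); lra.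
      + apply NNPP. intros Hne. destruct (E (Rabs (snd p))) as [_ [E2 _]]. apply Rabs_pos_lt; auto.
        assert (K1 := Rle_abs (snd p)). assert (K2 := Rle_abs (- snd p)). rewrite Rabs_Ropp in K2.
        unfold Rabs in *. destruct Rcase_abs; lra.
      + apply Cmod_le_eps_eq. intros e He. destruct (E e He) as [_ [_ E3]]. replace (q - 0)%C with q by ring. lra.
    - intros p q m m' Hm' Hmm HQ l' Hl'. apply HQ. lra.
    - intros p q [Hp [Hp2 _]]. assert (Hpos := Cmod_pos _ (Hn l (fst p) Hl Hp)).
      destruct (Hc (l, fst p) (Cmod (h (l, fst p)) / 8)) as [d [Hd Hd1]]. lra.
      exists (d / 2), (d / 2). split; [lra|split; [lra|]]. intros p' q' [Hp' _] Hpp _ l' Hl'.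
      assert (K1 := Rle_lt_trans _ _ _ (fst_le_Cmod _) Hpp). simpl in K1.
      assert (D1 : Cmod (h (l', fst p') - h (l, fst p)) < Cmod (h (l, fst p)) / 8).
      { apply Hd1. apply Rle_lt_trans with (1 := Cmod_le_abs _). simpl. unfold Rminus in *. lra. }
      assert (D2 : Cmod (h (l, fst p') - h (l, fst p)) < Cmod (h (l, fst p)) / 8).
      { apply Hd1. apply Rle_lt_trans with (1 := Cmod_le_abs _). simpl. rewrite Rplus_opp_r, Rabs_R0. unfold Rminus in *. lra. }
      assert (D3 := Cmod_diff_triangle (h (l', fst p')) (h (l, fst p)) (h (l, fst p'))).
      rewrite (Cmod_sub_sym (h (l, fst p))) in D3.
      assert (D4 := Cmod_triangle_rev (h (l, fst p)) (h (l, fst p'))). rewrite Cmod_sub_sym in D4. lra.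
    - exists m. split; auto. intros l' t Ht Hl'. apply (Hm1 (t, 0) 0); auto. }
  assert (Hboth : forall l, 0 <= l <= 1 -> exists m, 0 < m /\ forall l', Rabs (l' - l) < m ->
     (wind1 (fun t => h (l, t)) <-> wind1 (fun t => h (l', t)))).
  { intros l Hl. destruct (Hloc l Hl) as [m [Hm Hm1]]. exists m. split; auto. intros l' Hl'.
    split; apply wind1_close; auto; intros t Ht; specialize (Hm1 l' t Ht Hl'); assert (Hp := Cmod_ge_0 (h (l, t))).
    - assert (Hpos := Cmod_pos _ (Hn l t Hl Ht)). lra.
    - rewrite Cmod_sub_sym. assert (D4 := Cmod_triangle_rev (h (l, t)) (h (l', t))). rewrite Cmod_sub_sym in D4. lra. }
  apply (real_induction 0 1 (fun l => wind1 (fun t => h (l, t)))); auto; try lra.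
  - intros l Hl Hap. destruct (Hboth l Hl) as [m [Hm Hm1]]. destruct (Hap m Hm) as [l' [H1 [H2 H3]]].
    apply (Hm1 l'); auto. apply Rabs_lt_between. lra.
  - intros l Hl Hwl. destruct (Hboth l ltac:(lra)) as [m [Hm Hm1]].
    assert (0 < Rmin (m / 2) (1 - l)) by (apply Rmin_glb_lt; lra).
    assert (E1 := Rmin_l (m / 2) (1 - l)). assert (E2 := Rmin_r (m / 2) (1 - l)).
    exists (l + Rmin (m / 2) (1 - l)). split. lra. apply (Hm1 (l + Rmin (m / 2) (1 - l))); auto. apply Rabs_lt_between. lra.
Qed.

(** By the intermediate value theorem an argument increasing by [2 PI] takes the value [th 0 + PI],
    where the curve would point in the opposite direction. *)
Lemma wind1_const (v : C) : v <> 0 -> ~ wind1 (fun _ => v).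
Proof.
  intros Hv [th [Hc [Hp Hw]]]. apply Cmod_pos in Hv. assert (HPI := PI_RGT_0).
  destruct (IVT_gen th 0 1 (th 0 + PI)) as [t [Ht Ht1]].
  - intros t. apply Hc.
  - rewrite Rmin_left, Rmax_right; lra.
  - rewrite Rmin_left, Rmax_right in Ht by lra. assert (E1 := Hp 0 ltac:(lra)). assert (E2 := Hp t Ht). simpl in E1, E2.
    rewrite Ht1, neg_cos, neg_sin in E2.
    assert (F1 := f_equal fst E1). assert (F2 := f_equal fst E2). assert (S1 := f_equal snd E1). assert (S2 := f_equal snd E2). simpl in *.
    assert (Sc := sin2_cos2 (th 0)). unfold Rsqr in Sc.
    assert (C0' : cos (th 0) = 0) by nra. assert (S0' : sin (th 0) = 0) by nra. rewrite C0', S0' in Sc. lra.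
Qed.

(** * Proper injective maps of the plane *)

Section Homeomorphism.
Context (F : C -> C) (Hc : forall z, cC F z) (Hinj : forall z w, F z = F w -> z = w)
  (Hinf : forall M, exists R0, 0 < R0 /\ forall z, R0 <= Cmod z -> M <= Cmod (F z)) (Hd0 : dC F 0 1).

Lemma cC_cir (r : C -> R) (p : C) : cC (fun p => RtoC (r p)) p -> cC (fun p => cir (r p) (2 * PI * snd p)) p.
Proof.
  intros Hr. unfold cir. apply cG_mult; auto. apply (cG_comp _ Cexp (fun p => (2 * PI * snd p)%R * Ci)%C).
  - apply cG_mult. 2: apply cG_const. apply cG_realmult. apply cG_const. apply cC_snd.
  - eapply dG_cG, dC_Cexp.
Qed.

Lemma small_circle : exists r0, 0 < r0 /\ wind1 (fun t => F (cir r0 (2 * PI * t)) - F 0)%C.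
Proof.
  destruct (Hd0 (1 / 2)) as [d [Hd H1]]. lra. exists (d / 2). split. lra.
  apply wind1_close with (g := fun t => cir (d / 2) (2 * PI * t)).
  - intros t. apply (cG_comp RtoC (fun p => cir (d / 2) (2 * PI * snd p)) (fun t => (0, t))).
    apply cR_of_components; simpl. apply continuity_pt_const; intros x y; reflexivity. apply derivable_continuous_pt, derivable_pt_id.
    apply (cC_cir (fun _ => d / 2)). apply cG_const.
  - intros t. apply cG_plus; [|apply cG_const].
    apply (cG_comp RtoC (fun p => F (cir (d / 2) (2 * PI * snd p))) (fun t => (0, t))).
    apply cR_of_components; simpl. apply continuity_pt_const; intros x y; reflexivity. apply derivable_continuous_pt, derivable_pt_id.
    apply (cG_comp _ F (fun p => cir (d / 2) (2 * PI * snd p))); auto. apply (cC_cir (fun _ => d / 2)). apply cG_const.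
  - rewrite Rmult_0_r, Rmult_1_r, cir_2PI. reflexivity.
  - rewrite Rmult_0_r, Rmult_1_r, cir_2PI. reflexivity.
  - intros t _. set (z := cir (d / 2) (2 * PI * t)). assert (Hz : Cmod z = d / 2) by (apply Cmod_cir; lra).
    specialize (H1 z). cbv beta in H1. replace (z - 0)%C with z in H1 by ring. specialize (H1 ltac:(lra)).
    replace (F z - F 0 - z)%C with (F z - F 0 - z * 1)%C by ring. lra.
  - exists (fun t => 2 * PI * t). split; [|split].
    + intros t. apply ex_derive_continuity_pt. auto_derive. auto.
    + intros t _. rewrite Cmod_cir by lra. apply cir_comp.
    + ring.
Qed.

(** The small circle about 0, handled through [F'(0) = 1], is moved to the given one by a linear
    change of centre and radius. Injectivity keeps the image curve away from the image of the
    centre. *)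
Lemma winding_all (z : C) (r : R) : 0 < r -> wind1 (fun t => F (z + cir r (2 * PI * t)) - F z)%C.
Proof.
  intros Hr. destruct small_circle as [r0 [Hr0 Hw]].
  set (rad := fun p : C => (1 - fst p) * r0 + fst p * r).
  assert (Hrad : forall p, cC (fun p => RtoC (rad p)) p).
  { intros p. apply cG_realplus; apply cG_realmult; try apply cG_const. 2: apply cC_fst.
    apply (cG_real _ (fun x => 1 - x) fst). apply cC_fst. apply ex_derive_continuity_pt. auto_derive. auto. }
  set (h := fun p : C => (F (fst p * z + cir (rad p) (2 * PI * snd p))%C - F (fst p * z)%C)%C).
  assert (Hh1 : (fun t => F (z + cir r (2 * PI * t))%C - F z)%C = (fun t => h (1, t))).
  { apply FunctionalExtensionality.functional_extensionality. intros t. unfold h, rad. simpl.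
    replace (1 * z)%C with z by ring. replace ((1 - 1) * r0 + 1 * r) with r by ring. reflexivity. }
  change (wind1 (fun t => F (z + cir r (2 * PI * t))%C - F z)%C). rewrite Hh1. apply wind1_homotopy.
  - intros p. assert (Hf : cC (fun p : C => fst p * z)%C p) by (apply cG_mult; [apply cC_fst|apply cG_const]).
    apply cG_plus.
    + apply (cG_comp _ F (fun p : C => fst p * z + cir (rad p) (2 * PI * snd p))%C); auto. apply cG_plus; auto. apply cC_cir; auto.
    + apply (cG_comp _ Copp (fun p : C => F (fst p * z)%C)). apply (cG_comp _ F (fun p : C => fst p * z)%C); auto.
      eapply dG_cG, dG_opp, dG_param.
  - intros l. unfold h, rad. simpl. rewrite Rmult_0_r, Rmult_1_r, cir_2PI. reflexivity.
  - intros l t Hl Ht E. apply Cminus_eq0 in E. apply Hinj in E. simpl in E.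
    assert (Hrp : 0 < rad (l, t)). { unfold rad. simpl. destruct (Req_dec l 0) as [->|]. lra. assert (0 < l * r) by (apply Rmult_lt_0_compat; lra). assert (0 <= (1 - l) * r0) by (apply Rmult_le_pos; lra). lra. }
    assert (Hm : Cmod (cir (rad (l, t)) (2 * PI * t)) = rad (l, t)) by (apply Cmod_cir; lra).
    assert (Ez : cir (rad (l, t)) (2 * PI * t) = 0).
    { transitivity (l * z + cir (rad (l, t)) (2 * PI * t) - l * z)%C. ring. rewrite E. ring. }
    rewrite Ez, Cmod_0 in Hm. lra.
  - replace (fun t => h (0, t)) with (fun t => F (cir r0 (2 * PI * t)) - F 0)%C; auto.
    apply FunctionalExtensionality.functional_extensionality. intros t. unfold h, rad. simpl.
    replace (0 * z)%C with (RtoC 0) by ring. replace ((1 - 0) * r0 + 0 * r) with r0 by ring. f_equal. f_equal. ring.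
Qed.

(** If [w] were omitted, the image of a large circle, which winds once about [F 0] and hence about
    [w], could be contracted to a point without meeting [w]. *)
Lemma proper_surjective (w : C) : exists z, F z = w.
Proof.
  apply NNPP. intros Hno.
  (* Large enough for [|F 0 - w| < |F z - F 0|] on the circle of radius [R0], as [wind1_close]
     requires. *)
  destruct (Hinf (Cmod w + 2 * Cmod (F 0) + 1)) as [R0 [HR0 HR1]].
  assert (Hne : forall z, (F z - w)%C <> 0). { intros z E. apply Hno. exists z. apply Cminus_eq0, E. }
  set (h := fun p : C => (F (cir ((1 - fst p) * R0) (2 * PI * snd p)) - w)%C).
  apply (wind1_const (F 0 - w)%C); auto.
  assert (Hh1 : (fun _ : R => F 0 - w)%C = (fun t => h (1, t))).
  { apply FunctionalExtensionality.functional_extensionality. intros t. unfold h. simpl.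
    f_equal. f_equal. rewrite cir_comp. apply C_ext; simpl; ring. }
  rewrite Hh1. apply wind1_homotopy.
  - intros p. apply cG_plus; [|apply cG_const]. apply (cG_comp _ F (fun p => cir ((1 - fst p) * R0) (2 * PI * snd p))); auto.
    apply (cC_cir (fun p => (1 - fst p) * R0)). apply cG_realmult; [|apply cG_const].
    apply (cG_real _ (fun x => 1 - x) fst). apply cC_fst. apply ex_derive_continuity_pt. auto_derive. auto.
  - intros l. unfold h. simpl. rewrite Rmult_0_r, Rmult_1_r, cir_2PI. reflexivity.
  - intros l t _ _. apply Hne.
  - assert (Hw := winding_all 0 R0 HR0). revert Hw.
    assert (Hcc : forall v t, cR (fun t => F (0 + cir R0 (2 * PI * t)) - v)%C t).
    { intros v t. apply cG_plus; [|apply cG_const].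
      apply (cG_comp RtoC (fun p => F (0 + cir R0 (2 * PI * snd p))%C) (fun t => (0, t))).
      apply cR_of_components; simpl. apply continuity_pt_const; intros x y; reflexivity. apply derivable_continuous_pt, derivable_pt_id.
      apply (cG_comp _ F (fun p : C => 0 + cir R0 (2 * PI * snd p))%C); auto. apply cG_plus. apply cG_const. apply (cC_cir (fun _ => R0)). apply cG_const. }
    replace (fun t => h (0, t)) with (fun t => F (0 + cir R0 (2 * PI * t))%C - w)%C.
    2: { apply FunctionalExtensionality.functional_extensionality. intros t. unfold h. simpl. do 2 f_equal.
         replace ((1 - 0) * R0) with R0 by ring. ring. }
    apply wind1_close; auto.
    + rewrite Rmult_0_r, Rmult_1_r, cir_2PI. reflexivity.
    + rewrite Rmult_0_r, Rmult_1_r, cir_2PI. reflexivity.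
    + intros t _. replace (0 + cir R0 (2 * PI * t))%C with (cir R0 (2 * PI * t)) by ring.
      set (z := cir R0 (2 * PI * t)). assert (Hz : Cmod z = R0) by (apply Cmod_cir; lra).
      specialize (HR1 z ltac:(lra)). replace (F z - w - (F z - F 0))%C with (F 0 - w)%C by ring.
      assert (E1 := Cmod_minus_le (F 0) w). assert (E2 := Cmod_triangle_rev (F z) (F 0)). lra.
Qed.

(** For the continuity of the inverse: properness keeps preimages of a convergent sequence bounded,
    and injectivity identifies every limit point. *)
Lemma proper_homeomorphism : homeomorphism_C F.
Proof.
  split; [exact Hc|]. destruct (choice _ proper_surjective) as [g Hg].
  exists g. split; [|split; [exact Hg|]].
  - intros z. apply Hinj. apply Hg.
  - change (forall w, cC g w). intros w. apply NNPP. intros Hn.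
    assert (Hex : exists eps, 0 < eps /\ forall n : nat, exists y, Cmod (y - w) < / (INR n + 1) /\ eps <= Cmod (g y - g w)).
    { apply NNPP. intros Hne. apply Hn. intros eps Heps. apply NNPP. intros Hd. apply Hne. exists eps. split; auto.
      intros n. apply NNPP. intros Hy. apply Hd. exists (/ (INR n + 1)). split.
      apply Rinv_0_lt_compat. assert (H0 := pos_INR n). lra.
      intros y Hyw. apply Rnot_le_lt. intros Hle. apply Hy. exists y. auto. }
    destruct Hex as [eps [Heps Hseq]]. destruct (choice _ Hseq) as [y Hy].
    assert (Hn1 : forall n : nat, / (INR n + 1) <= 1).
    { intros n. assert (H0 := pos_INR n). rewrite <- Rinv_1 at 2. apply Rinv_le_contravar; lra. }
    destruct (Hinf (Cmod w + 2)) as [R0 [HR0 HR1]].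
    destruct (C_subseq (fun n => g (y n)) R0) as [phi [l [Hphi Hl]]].
    { intros n. apply Rnot_lt_le. intros Hlt. specialize (HR1 (g (y n)) ltac:(lra)). rewrite Hg in HR1.
      destruct (Hy n) as [H1 _]. specialize (Hn1 n). assert (E := Cmod_triangle_rev (y n) w). lra. }
    assert (El : F l = w).
    { apply Cmod_le_eps_eq. intros e He. destruct (Hc l (e / 2)) as [d [Hd Hd1]]. lra.
      destruct (Hl d Hd) as [N1 HN1]. destruct (archimed_cor1 (e / 2)) as [N2 [HN2 HN2']]. lra.
      set (n := max N1 N2). specialize (HN1 n ltac:(lia)). specialize (Hd1 _ HN1). rewrite Hg in Hd1.
      destruct (Hy (phi n)) as [H1 _]. assert (Hpn := incr_ge phi Hphi n).
      assert (/ (INR (phi n) + 1) <= / INR N2).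
      { apply Rinv_le_contravar. apply lt_0_INR; auto. assert (INR N2 <= INR (phi n)) by (apply le_INR; lia). lra. }
      assert (E := Cmod_diff_triangle (F l) (y (phi n)) w). rewrite (Cmod_sub_sym (F l) (y (phi n))) in E. lra. }
    assert (Egw : g w = l). { apply Hinj. rewrite Hg. auto. }
    destruct (Hl eps Heps) as [N HN]. specialize (HN N (Nat.le_refl N)). destruct (Hy (phi N)) as [_ H2]. rewrite Egw in H2. lra.
Qed.

Lemma proper_sense_preserving : sense_preserving F.
Proof.
  intros z r Hr. destruct (winding_all z r Hr) as [th [H1 [H2 H3]]]. exists th. split; [auto|split; [|auto]].
  intros t Ht. specialize (H2 t Ht). cbv beta in H2. rewrite !cir_comp in H2. exact H2.
Qed.

End Homeomorphism.

(** * Comparison of [k] with [l], and the conclusion *)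

(** After clearing the denominator, [k <= l] reads [(1 - k^2) (a k + |b| - k |s|) >= 0], which
    follows from [|s| <= a + |b|]. Likewise [l < 1] reads
    [(1 - k)^2 a + (1 - k^2) (|s| - |b|) > 0]. *)
Lemma dil_l_bounds (a b k : R) : 0 < a -> 0 <= k < 1 ->
  0 <= k <= dil_l a b k (a, b) /\ dil_l a b k (a, b) < 1.
Proof.
  intros Ha Hk. unfold dil_l. change (Cnorm (a, b)) with (Cmod (a, b)).
  assert (H1 := Cmod_ge_0 (a, b)). assert (H2 := Rabs_pos b).
  assert (Hs : Cmod (a, b) ^ 2 = a ^ 2 + Rabs b ^ 2).
  { rewrite pow2_abs. unfold Cmod. rewrite pow2_sqrt; simpl; nra. }
  assert (H3 : Rabs b <= Cmod (a, b)) by nra.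
  assert (H4 : Cmod (a, b) <= a + Rabs b) by nra.
  set (S := Cmod (a, b)) in *. set (B := Rabs b) in *.
  assert (0 <= k * k < 1) by nra.
  assert (H5 : 0 < (1 + k ^ 2) * a + (1 - k ^ 2) * S) by (simpl; nra).
  split; [split; [lra|]|].
  - apply Rmult_le_reg_r with (1 := H5). unfold Rdiv. rewrite Rmult_assoc, Rinv_l, Rmult_1_r by lra.
    assert (k * S <= a * k + B) by nra.
    assert (0 <= (1 - k * k) * (a * k + B - k * S)) by (apply Rmult_le_pos; lra). nra.
  - apply Rmult_lt_reg_r with (1 := H5). unfold Rdiv. rewrite Rmult_assoc, Rinv_l, Rmult_1_r by lra.
    assert (0 <= (1 - k * k) * (S - B)) by (apply Rmult_le_pos; lra).
    assert (0 < (1 - k) * (1 - k) * a) by (apply Rmult_lt_0_compat; [apply Rmult_lt_0_compat|]; lra). nra.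
Qed.

Theorem theorem1 :
  forall (a b k : R) (c : Cplx) (f f1 f2 : Cplx -> Cplx),
    0 < a -> 0 <= k < 1 ->
    classA f ->
    (forall z, inD z -> has_cderiv f z (f1 z)) ->
    (forall z, inD z -> has_cderiv f1 z (f2 z)) ->
    (forall z, inD z ->
       f1 z <> C0 /\ (z <> C0 -> f z <> C0) /\
       Cnorm (the_expr a (a, b) c f f1 f2 z) <= bound_M a k (a, b) c) ->
    dil_l a b k (a, b) < 1 /\ has_qc_extension (dil_l a b k (a, b)) f.
Proof.
  intros a b k c f f1 f2 Ha Hk HA Hf1 Hf2 HM.
  destruct (chain_of_hypotheses a b k c f f1 f2 Ha Hk HA Hf1 Hf2 HM) as [H].
  destruct (dil_l_bounds a b k Ha Hk) as [Hl Hl1]. split; [exact Hl1|].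
  assert (Hinf : forall M, exists R0, 0 < R0 /\ forall z, R0 <= Cmod z -> M <= Cmod (ext H z)).
  { intros M. destruct (ext_large H M) as [R0 [HR HR']]. exists R0. split; [lra|exact HR']. }
  assert (Hd0 : dC (ext H) 0 1).
  { assert (H0 : Cmod 0 < 1) by (rewrite Cmod_0; lra).
    replace (RtoC 1) with (cf1 H 0).
    2: { rewrite (f1_p H), (p_0 H), (lam_0 H), Cexp_0 by auto. ring. }
    apply dG_ext_loc with (f := f) (d := 1); [lra| |apply (f_deriv H); auto].
    intros y Hy. symmetry. apply ext_in. replace y with (y - 0)%C by ring. exact Hy. }
  exists (ext H). split; [|intros z Hz; apply ext_in, Hz].
  split; [lra|]. split; [|split; [|split; [apply ext_ACL|]]].
  - exact (proper_homeomorphism _ (ext_continuous H) (ext_injective H) Hinf Hd0).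
  - exact (proper_sense_preserving _ (ext_continuous H) (ext_injective H) Hd0).
  - apply null2_circle. intros z Hz. apply NNPP. intros Hz1. apply Hz.
    destruct (ext_dilatation H z Hz1) as [Fx [Fy [Hx [Hy Hxy]]]]. exists Fx, Fy. split; [exact Hx|split; [exact Hy|]].
    apply Rle_trans with (1 := Hxy). apply Rmult_le_compat_r; [apply Cmod_ge_0|apply Hl].
Qed.
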